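(* Let $p\ge2$ be an integer and $\mathfrak q=e^{i\pi/p}$, and let $\mathscr C_p$ be the category of finite-dimensional $\overline{\mathscr U}_{\mathfrak q}s\ell(2)$-modules. (1) The category $\mathscr C_p$ has a decomposition $\mathscr C_p=\bigoplus_{s=0}^{p}\mathscr C_p(s)$, where each $\mathscr C_p(s)$ is a full subcategory, with the following properties. (2) Each of the subcategories $\mathscr C_p(0)$ and $\mathscr C_p(p)$ is semisimple and contains precisely one irreducible module, $\mathscr X^+_p$ and $\mathscr X^-_p$ respectively. (3) Each subcategory $\mathscr C_p(s)$, $1\le s\le p-1$, contains precisely two irreducible modules $\mathscr X^+_s$ and $\mathscr X^-_{p-s}$ and the following set of indecomposable modules: - the projective modules $\mathscr P^+_s$ and $\mathscr P^-_{p-s}$; - three series of indecomposable modules: (a) the modules $\mathscr W^+_s(n)$ and $\mathscr W^-_{p-s}(n)$ for all integers $n\ge2$; (b) the modules $\mathscr M^+_s(n)$ and $\mathscr M^-_{p-s}(n)$ for all integers $n\ge2$; (c) the modules $\mathscr O^+_s(n,z)$ and $\mathscr O^-_{p-s}(n,z)$ for all $z\in\mathbb{CP}^1$ and integers $n\ge1$. This exhausts the list of (non-irreducible) indecomposable modules in $\mathscr C_p(s)$, up to isomorphism.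
   Context: All spaces are over $\mathbb C$. $\overline{\mathscr U}_{\mathfrak q}s\ell(2)$ is the algebra generated by $E,F,K$ with relations $E^p=F^p=0$, $K^{2p}=\mathbf 1$, $KEK^{-1}=\mathfrak q^2E$, $KFK^{-1}=\mathfrak q^{-2}F$, $[E,F]=\frac{K-K^{-1}}{\mathfrak q-\mathfrak q^{-1}}$. Write $[n]=\frac{\mathfrak q^n-\mathfrak q^{-n}}{\mathfrak q-\mathfrak q^{-1}}$. By convention ''indecomposable'' refers to non-irreducible indecomposable modules. Irreducible modules: for $1\le s\le p$ and $a=\pm$ (read as $\pm1$), $\mathscr X^a_s$ has basis $\mathsf a_0,\dots,\mathsf a_{s-1}$ with $K\mathsf a_n=a\mathfrak q^{s-1-2n}\mathsf a_n$, $E\mathsf a_n=a[n][s-n]\mathsf a_{n-1}$, $F\mathsf a_n=\mathsf a_{n+1}$, where $\mathsf a_{-1}=\mathsf a_s=0$. Let $1\le s\le p-1$, $a=\pm$. For complex $n\times m$ matrices $A,B$, let $\mathscr I^a_s(A,B)$ be the module with basis $\mathsf a^{(j)}_l$ ($1\le j\le m$, $0\le l\le s-1$), $\mathsf x^{(i)}_k$ ($1\le i\le n$, $0\le k\le p-s-1$), in which for each $i$ the $\mathsf x^{(i)}_k$ span a copy of $\mathscr X^{-a}_{p-s}$ (with the formulas above), and $K,E,F$ act on each family $\mathsf a^{(j)}_l$ by the formulas of $\mathscr X^a_s$ except that $F\mathsf a^{(j)}_{s-1}=\sum_iA_{ij}\mathsf x^{(i)}_0$ and $E\mathsf a^{(j)}_0=\sum_iB_{ij}\mathsf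 x^{(i)}_{p-s-1}$. Then: - $\mathscr W^a_s(n)$, $n\ge2$ ($n$ copies of $\mathscr X^a_s$ on top and $n-1$ copies of $\mathscr X^{-a}_{p-s}$ in the socle): $A=(I_{n-1}\,|\,0)$, $B=(0\,|\,I_{n-1})$, of size $(n-1)\times n$. - $\mathscr M^a_s(n)$, $n\ge2$ ($n-1$ copies of $\mathscr X^a_s$ on top and $n$ copies of $\mathscr X^{-a}_{p-s}$ in the socle): $A$ and $B$ are the $n\times(n-1)$ matrices obtained from $I_{n-1}$ by adding a zero row at the bottom, respectively at the top. - $\mathscr O^a_s(n,z)$, $n\ge1$, $z=z_1:z_2\in\mathbb{CP}^1$ ($n$ copies of $\mathscr X^a_s$ on top and $n$ copies of $\mathscr X^{-a}_{p-s}$ in the socle): $A=I_n$, $B=J_n(z_2/z_1)$ if $z_1\ne0$, and $A=J_n(0)$, $B=I_n$ if $z_1=0$, where $J_n(\lambda)$ is the $n\times n$ Jordan block with eigenvalue $\lambda$. For $n=1$ this is isomorphic to the module with $F\mathsf a_{s-1}=z_1\mathsf x_0$, $E\mathsf a_0=z_2\mathsf x_{p-s-1}$. - $\mathscr P^a_s$ has dimension $2p$ and basis $\{\mathsf b_n,\mathsf a_n\}_{0\le n\le s-1}\cup\{\mathsf x_k,\mathsf y_k\}_{0\le k\le p-s-1}$ with $K\mathsf a_n=a\mathfrak q^{s-1-2n}\mathsf a_n$, $K\mathsf b_n=a\mathfrak q^{s-1-2n}\mathsf b_n$, $K\mathsf x_k=-a\mathfrak q^{p-s-1-2k}\mathsf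 x_k$, $K\mathsf y_k=-a\mathfrak q^{p-s-1-2k}\mathsf y_k$; $E\mathsf x_k=-a[k][p-s-k]\mathsf x_{k-1}$ ($\mathsf x_{-1}=0$); $E\mathsf y_k=-a[k][p-s-k]\mathsf y_{k-1}$ for $k\ge1$, $E\mathsf y_0=\mathsf a_{s-1}$; $E\mathsf a_n=a[n][s-n]\mathsf a_{n-1}$ ($\mathsf a_{-1}=0$); $E\mathsf b_n=a[n][s-n]\mathsf b_{n-1}+\mathsf a_{n-1}$ for $n\ge1$, $E\mathsf b_0=\mathsf x_{p-s-1}$; $F\mathsf x_k=\mathsf x_{k+1}$ for $k\le p-s-2$, $F\mathsf x_{p-s-1}=\mathsf a_0$; $F\mathsf y_k=\mathsf y_{k+1}$ ($\mathsf y_{p-s}=0$); $F\mathsf a_n=\mathsf a_{n+1}$ ($\mathsf a_s=0$); $F\mathsf b_n=\mathsf b_{n+1}$ for $n\le s-2$, $F\mathsf b_{s-1}=\mathsf y_0$. *)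

(* Defs.v *)
From HB Require Import structures.
From mathcomp Require Import all_boot all_order all_algebra.
From mathcomp Require Import reals trigo.
From mathcomp Require Import complex.
Set Implicit Arguments.
Unset Strict Implicit.
Unset Printing Implicit Defensive.
Import Order.TTheory GRing.Theory Num.Theory.
Local Open Scope ring_scope.
Local Open Scope complex_scope.

(* exp (i pi / p), written as cos (pi / p) + i sin (pi / p) *)
Definition qroot (R : realType) (p : nat) : R[i] :=
  cos (pi / p%:R) +i* sin (pi / p%:R).

Definition qnum (R : realType) (p n : nat) : R[i] :=
  let q := qroot R p in (q ^+ n - q ^- n) / (q - q^-1).

(* A finite-dimensional complex vector space with three endomorphisms. It is a
   module over the algebra generated by E, F, K exactly when these endomorphisms
   satisfy the defining relations, see is_module. *)
Record rep (R : realType) := Rep {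
  carrier :> vectType R[i];
  opE : 'End(carrier);
  opF : 'End(carrier);
  opK : 'End(carrier)
}.
Arguments Rep {R carrier} opE opF opK.

Definition lpow (R : realType) (V : vectType R[i]) (f : 'End(V)) (n : nat) :
    'End(V) :=
  iter n (fun g => (f \o g)%VF) \1%VF.

(* The relation K ^ 2p = 1 makes K bijective, so that K^-1, which in general is
   only a partial inverse, is the two-sided inverse of K. *)
Definition is_module (R : realType) (p : nat) (M : rep R) : Prop :=
  let q := qroot R p in
  let E := opE M in let F := opF M in let K := opK M in
  [/\ lpow E p = 0 /\ lpow F p = 0,
      lpow K (2 * p) = \1%VF,
      (K \o E \o K^-1)%VF = q ^+ 2 *: E,
      (K \o F \o K^-1)%VF = q ^- 2 *: F
    & (E \o F)%VF - (F \o E)%VF = (q - q^-1)^-1 *: (K - K^-1%VF)].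

Definition is_hom (R : realType) (M N : rep R) (f : 'Hom(M, N)) : Prop :=
  [/\ (f \o opE M)%VF = (opE N \o f)%VF,
      (f \o opF M)%VF = (opF N \o f)%VF
    & (f \o opK M)%VF = (opK N \o f)%VF].

Definition isomorphic (R : realType) (M N : rep R) : Prop :=
  exists (f : 'Hom(M, N)) (g : 'Hom(N, M)),
    [/\ is_hom f, is_hom g, (g \o f)%VF = \1%VF & (f \o g)%VF = \1%VF].

Definition is_submodule (R : realType) (M : rep R) (U : {vspace M}) : Prop :=
  [/\ (opE M @: U <= U)%VS, (opF M @: U <= U)%VS & (opK M @: U <= U)%VS].

Definition irreducible (R : realType) (M : rep R) : Prop :=
  (fullv : {vspace M}) != 0%VS /\
  forall U : {vspace M}, is_submodule U -> U = 0%VS \/ U = fullv.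

Definition indecomposable (R : realType) (M : rep R) : Prop :=
  (fullv : {vspace M}) != 0%VS /\
  forall U V : {vspace M}, is_submodule U -> is_submodule V ->
    (U + V)%VS = fullv -> (U :&: V)%VS = 0%VS -> U = 0%VS \/ V = 0%VS.

Definition nonirr_indecomposable (R : realType) (M : rep R) : Prop :=
  indecomposable M /\ ~ irreducible M.

Definition projective (R : realType) (p : nat) (P : rep R) : Prop :=
  is_module p P /\
  forall (M N : rep R) (g : 'Hom(M, N)) (f : 'Hom(P, N)),
    is_module p M -> is_module p N -> is_hom g -> is_hom f ->
    limg g = fullv ->
    exists h : 'Hom(P, M), is_hom h /\ (g \o h)%VF = f.

(* M is the direct sum of the finite family N, presented as a biproduct *)
Definition is_dsum (R : realType) (I : finType) (N : I -> rep R) (M : rep R) :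
    Prop :=
  exists (inj : forall i, 'Hom(N i, M)) (prj : forall i, 'Hom(M, N i)),
    [/\ (forall i, is_hom (inj i)) /\ (forall i, is_hom (prj i)),
        forall i, (prj i \o inj i)%VF = \1%VF,
        forall i j, i != j -> (prj j \o inj i)%VF = 0
      & \sum_i (inj i \o prj i)%VF = \1%VF].

(* The category of finite-dimensional modules is the direct sum of the full
   subcategories whose objects are given by the predicates C i: these are
   closed under isomorphism, there is no nonzero morphism between objects of two
   different ones, and every module is a direct sum of one object of each. *)
Definition is_decomposition (R : realType) (p : nat) (I : finType)
    (C : I -> rep R -> Prop) : Prop :=
  [/\ forall i (M : rep R), C i M -> is_module p M,
      forall i (M N : rep R), C i M -> is_module p N -> isomorphic M N -> C i N,
      forall i j (M N : rep R) (f : 'Hom(M, N)),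
        i != j -> C i M -> C j N -> is_hom f -> f = 0
    & forall M : rep R, is_module p M ->
        exists N : I -> rep R, (forall i, C i (N i)) /\ is_dsum N M].

Definition semisimple (R : realType) (C : rep R -> Prop) : Prop :=
  forall M, C M ->
    exists (n : nat) (N : 'I_n -> rep R),
      (forall i, C (N i) /\ irreducible (N i)) /\ is_dsum N M.

(* In {ffun I -> C}, with standard basis indexed by I, the k-th vector of the
   family of basis vectors labelled by lab, and 0 when k is out of range. *)
Definition bvec (R : realType) (I : finType) (n : nat) (lab : 'I_n -> I)
    (k : nat) : {ffun I -> R[i]^o} :=
  if insub k is Some i then [ffun j => (j == lab i)%:R] else 0.

(* the endomorphism sending the i-th standard basis vector to f i *)
Definition lin_ext (R : realType) (I : finType) (f : I -> {ffun I -> R[i]^o}) :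
    'End({ffun I -> R[i]^o}) :=
  linfun (fun v : {ffun I -> R[i]^o} => \sum_i (v i : R[i]) *: f i).

(* In the modules below the sign a is the complex number 1 or -1. Where an index
   k.-1 occurs with k = 0, its coefficient qnum p 0 vanishes. *)

Definition modX (R : realType) (p : nat) (a : R[i]) (s : nat) : rep R :=
  let q := qroot R p in
  let br := qnum R p in
  let va (k : nat) : {ffun 'I_s -> R[i]^o} := bvec R (@id 'I_s) k in
  Rep
    (lin_ext (fun k : 'I_s => (a * br k * br (s - k)%N) *: va k.-1))
    (lin_ext (fun k : 'I_s => va k.+1))
    (lin_ext (fun k : 'I_s => (a * q ^ (s%:Z - 1 - 2 * k%:Z)) *: va k)).

(* the module I^a_s(A, B); inl (j, l) labels a^(j)_l, inr (i, k) labels x^(i)_k *)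
Definition modI (R : realType) (p : nat) (a : R[i]) (s n m : nat)
    (A B : 'M[R[i]]_(n, m)) : rep R :=
  let q := qroot R p in
  let br := qnum R p in
  let I : finType := (('I_m * 'I_s) + ('I_n * 'I_(p - s)))%type in
  let va (j : 'I_m) (l : nat) : {ffun I -> R[i]^o} :=
    bvec R (fun l' : 'I_s => inl (j, l') : I) l in
  let vx (i : 'I_n) (k : nat) : {ffun I -> R[i]^o} :=
    bvec R (fun k' : 'I_(p - s) => inr (i, k') : I) k in
  Rep
    (lin_ext (fun b : I => match b with
      | inl (j, l) =>
          if l == 0%N :> nat then \sum_i B i j *: vx i (p - s).-1
          else (a * br l * br (s - l)%N) *: va j l.-1
      | inr (i, k) => (- a * br k * br (p - s - k)%N) *: vx i k.-1
      end))
    (lin_ext (fun b : I => match b with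
      | inl (j, l) =>
          if l == s.-1 :> nat then \sum_i A i j *: vx i 0%N else va j l.+1
      | inr (i, k) => vx i k.+1
      end))
    (lin_ext (fun b : I => match b with
      | inl (j, l) => (a * q ^ (s%:Z - 1 - 2 * l%:Z)) *: va j l
      | inr (i, k) => (- a * q ^ ((p - s)%N%:Z - 1 - 2 * k%:Z)) *: vx i k
      end)).

Definition modW (R : realType) (p : nat) (a : R[i]) (s n : nat) : rep R :=
  modI p a s
    (\matrix_(i < n.-1, j < n) (i == j :> nat)%:R)
    (\matrix_(i < n.-1, j < n) (i.+1 == j :> nat)%:R).

Definition modM (R : realType) (p : nat) (a : R[i]) (s n : nat) : rep R :=
  modI p a s
    (\matrix_(i < n, j < n.-1) (i == j :> nat)%:R)
    (\matrix_(i < n, j < n.-1) (i == j.+1 :> nat)%:R).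

Definition jordan (R : realType) (n : nat) (c : R[i]) : 'M[R[i]]_n :=
  \matrix_(i < n, j < n) (c *+ (i == j) + (i.+1 == j :> nat)%:R).

(* z1 : z2 are homogeneous coordinates, meaningful when not both are 0 *)
Definition modO (R : realType) (p : nat) (a : R[i]) (s n : nat) (z1 z2 : R[i]) :
    rep R :=
  if z1 == 0 then modI p a s (jordan n 0) 1%:M
  else modI p a s 1%:M (jordan n (z2 / z1)).

(* The labels of b_n, a_n, x_k, y_k are respectively inl (inl n), inl (inr n),
   inr (inl k), inr (inr k). *)
Definition modP (R : realType) (p : nat) (a : R[i]) (s : nat) : rep R :=
  let q := qroot R p in
  let br := qnum R p in
  let I : finType := (('I_s + 'I_s) + ('I_(p - s) + 'I_(p - s)))%type in
  let vb (n : nat) : {ffun I -> R[i]^o} :=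
    bvec R (fun n' : 'I_s => inl (inl n') : I) n in
  let va (n : nat) : {ffun I -> R[i]^o} :=
    bvec R (fun n' : 'I_s => inl (inr n') : I) n in
  let vx (k : nat) : {ffun I -> R[i]^o} :=
    bvec R (fun k' : 'I_(p - s) => inr (inl k') : I) k in
  let vy (k : nat) : {ffun I -> R[i]^o} :=
    bvec R (fun k' : 'I_(p - s) => inr (inr k') : I) k in
  Rep
    (lin_ext (fun e : I => match e with
      | inl (inl n) =>
          if n == 0%N :> nat then vx (p - s).-1
          else (a * br n * br (s - n)%N) *: vb n.-1 + va n.-1
      | inl (inr n) => (a * br n * br (s - n)%N) *: va n.-1
      | inr (inl k) => (- a * br k * br (p - s - k)%N) *: vx k.-1
      | inr (inr k) =>
          if k == 0%N :> nat then va s.-1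
          else (- a * br k * br (p - s - k)%N) *: vy k.-1
      end))
    (lin_ext (fun e : I => match e with
      | inl (inl n) => if n == s.-1 :> nat then vy 0%N else vb n.+1
      | inl (inr n) => va n.+1
      | inr (inl k) => if k == (p - s).-1 :> nat then va 0%N else vx k.+1
      | inr (inr k) => vy k.+1
      end))
    (lin_ext (fun e : I => match e with
      | inl (inl n) => (a * q ^ (s%:Z - 1 - 2 * n%:Z)) *: vb n
      | inl (inr n) => (a * q ^ (s%:Z - 1 - 2 * n%:Z)) *: va n
      | inr (inl k) => (- a * q ^ ((p - s)%N%:Z - 1 - 2 * k%:Z)) *: vx k
      | inr (inr k) => (- a * q ^ ((p - s)%N%:Z - 1 - 2 * k%:Z)) *: vy k
      end)).

Inductive indec_list (R : realType) (p : nat) (a : R[i]) (s : nat) :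
    rep R -> Prop :=
  | IndecP : indec_list p a s (modP p a s)
  | IndecW n : (2 <= n)%N -> indec_list p a s (modW p a s n)
  | IndecM n : (2 <= n)%N -> indec_list p a s (modM p a s n)
  | IndecO n z1 z2 : (1 <= n)%N -> (z1, z2) != (0, 0) ->
      indec_list p a s (modO p a s n z1 z2).

(* Main.v *)
Require Import Defs.
From HB Require Import structures.
From mathcomp Require Import all_boot all_order all_algebra.
From mathcomp Require Import boolp reals trigo.
From mathcomp Require Import complex.
From mathcomp Require Import ring zify.
Set Implicit Arguments.
Unset Strict Implicit.
Unset Printing Implicit Defensive.
Import Order.TTheory GRing.Theory Num.Theory.
Local Open Scope ring_scope.
Local Open Scope complex_scope.

(* The Casimir element satisfies a polynomial whose roots are the values
   (q^i + q^-i) / (q - q^-1)^2, and the values taken at i and 2p - i agree: grouping equal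
   roots gives the idempotents that cut a module into its blocks. In a block with 0 < s < p
   let N be the Casimir element minus its eigenvalue; then N^2 = 0, every nonzero submodule
   contains a vector of weight a q^(s-1) or -a q^(p-s-1) killed by E, and the vectors of
   these two weights generate the module. If N v <> 0 for such a weight vector v, then v
   generates a copy of the projective cover, which is also injective, so it splits off.
   If N = 0, the module is a direct sum of two modules I(A, B), one for each of the two
   kinds of top, and I(A, B) is indecomposable exactly when the pair (A, B), that is, the
   maps F^s and E^(p-s) from top to socle, is an indecomposable matrix pencil; Kronecker's
   classification of these gives the families W, M and O. *)

(** * Indecomposable pencils of matrices *)

Section Pencils.
Variable F : numClosedFieldType.

(** Two devices recur. First, on a weight vector of a block, E F and F E act as a scalar plus N.
    Since N^2 = 0 this is invertible as soon as the scalar is nonzero, so a weight vector can be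
    rewritten as E^n F^n u or F^n E^n u as long as no critical weight is crossed. Enough such
    factors turn E^p = F^p = 0 into the relations F^s N v = 0 and E N v = 0, which make a vector v
    of top weight generate an image of the projective module. Second, a summand is split off by a
    map from a model into the object and a map back. If their composite is invertible, it normalises
    to an idempotent, and indecomposability forces this idempotent to be the identity. The map back
    is the difficulty: for a singular pencil it solves a linear system whose obstruction would be a
    chain shorter than the minimal one, and for the projective module it is the transpose of a
    homomorphism into the dual. The exchange of (a, s) and (-a, p - s) is an involution that
    preserves the Casimir value, so statements are proved for one of the two kinds of top and used
    for both. *)

Definition endo_indec n (H : 'M[F]_n) :=
  forall P : 'M_n, P *m P = P -> P *m H = H *m P -> P = 0 \/ P = 1%:M.

(** A pencil is a representation of the Kronecker quiver: [P] acts on the source of the two maps,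
    [Q] on their target. Idempotent endomorphisms replace direct sums because every candidate
    summand below arrives as such a pair. *)
Definition pencil_indec n m (A B : 'M[F]_(n, m)) :=
  forall (P : 'M_m) (Q : 'M_n), P *m P = P -> Q *m Q = Q ->
    Q *m A = A *m P -> Q *m B = B *m P ->
    (P = 0 /\ Q = 0) \/ (P = 1%:M /\ Q = 1%:M).

Definition pencil_iso n m n' m' (A B : 'M[F]_(n, m)) (A' B' : 'M[F]_(n', m')) :=
  exists (P : 'M_(m', m)) (P' : 'M_(m, m')) (Q : 'M_(n', n)) (Q' : 'M_(n, n')),
    [/\ P *m P' = 1%:M, P' *m P = 1%:M, Q *m Q' = 1%:M & Q' *m Q = 1%:M] /\
    (Q *m A = A' *m P /\ Q *m B = B' *m P).

Definition pencilWA n : 'M[F]_(n.-1, n) := \matrix_(i, j) (i == j :> nat)%:R.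
Definition pencilWB n : 'M[F]_(n.-1, n) := \matrix_(i, j) (i.+1 == j :> nat)%:R.

Definition jordan_block n (c : F) : 'M[F]_n :=
  \matrix_(i < n, j < n) (c *+ (i == j) + (i.+1 == j :> nat)%:R).

(* The entries of row [i] and column [j] outside the matrix read as 0. *)
Definition mxnat n m (A : 'M[F]_(n, m)) (i j : nat) : F :=
  if insub i is Some i' then if insub j is Some j' then A i' j' else 0 else 0.

Lemma mxnatE n m (A : 'M[F]_(n, m)) (i : 'I_n) (j : 'I_m) : mxnat A i j = A i j.
Proof. by rewrite /mxnat !valK. Qed.

Lemma sum_pick n (f : 'I_n -> F) (k : nat) :
  \sum_(i < n) (k == i :> nat)%:R * f i =
  if insub k is Some i then f i else 0.
Proof.
case: insubP => [i _ <-|kn].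
  rewrite (bigD1 i) //= eqxx mul1r big1 ?addr0 // => j ji.
  by rewrite eq_sym (inj_eq val_inj) (negPf ji) mul0r.
rewrite big1 // => i _; case: eqP => [ki|_]; last by rewrite mul0r.
by rewrite ki ltn_ord in kn.
Qed.

Lemma mul_shift n m (k : nat -> nat) (A : 'M[F]_(n, m)) r (i : 'I_r) (j : 'I_m) :
  ((\matrix_(i < r, j < n) (k i == j :> nat)%:R : 'M[F]_(r, n)) *m A) i j = mxnat A (k i) j.
Proof.
rewrite mxE; under eq_bigr do rewrite mxE.
rewrite (sum_pick (fun l => A l j)) /mxnat.
by case: insubP => // a; rewrite ?valK.
Qed.

Lemma mul_shiftr n m (k : nat -> nat) (A : 'M[F]_(n, m)) r (i : 'I_n) (j : 'I_r) :
  (A *m (\matrix_(i < m, j < r) (i == k j :> nat)%:R : 'M[F]_(m, r))) i j = mxnat A i (k j).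
Proof.
rewrite mxE; under eq_bigr do rewrite mxE eq_sym mulrC.
rewrite (sum_pick (fun l => A i l)) /mxnat valK.
by case: insubP.
Qed.

Lemma mul_shiftS n m (A : 'M[F]_(n, m)) r (i : 'I_n) (j : 'I_r) :
  (A *m (\matrix_(i < m, j < r) (i.+1 == j :> nat)%:R : 'M[F]_(m, r))) i j =
  if j == 0%N :> nat then 0 else mxnat A i j.-1.
Proof.
case: eqP => [j0|/eqP j0].
  by rewrite mxE big1 // => l _; rewrite mxE j0 mulr0.
rewrite -(mul_shiftr predn) !mxE; apply: eq_bigr => l _; rewrite !mxE.
by case: j j0 => [[|j] ?].
Qed.

Lemma mul_WA n m (A : 'M[F]_(n, m)) (i : 'I_n.-1) (j : 'I_m) :
  (pencilWA n *m A) i j = mxnat A i j.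
Proof. exact: (mul_shift id). Qed.

Lemma mul_WB n m (A : 'M[F]_(n, m)) (i : 'I_n.-1) (j : 'I_m) :
  (pencilWB n *m A) i j = mxnat A i.+1 j.
Proof. exact: (mul_shift S). Qed.

Lemma mulr_WA n m (A : 'M[F]_(n, m.-1)) (i : 'I_n) (j : 'I_m) :
  (A *m pencilWA m) i j = mxnat A i j.
Proof. exact: (mul_shiftr id). Qed.

Lemma mulr_WB n m (A : 'M[F]_(n, m.-1)) (i : 'I_n) (j : 'I_m) :
  (A *m pencilWB m) i j = if j == 0%N :> nat then 0 else mxnat A i j.-1.
Proof. exact: mul_shiftS. Qed.

Lemma jordan_block0 n : jordan_block n 0 = \matrix_(i, j) (i.+1 == j :> nat)%:R.
Proof. by apply/matrixP => i j; rewrite !mxE mul0rn add0r. Qed.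

Lemma jordan_blockE n c : jordan_block n c = c%:M + jordan_block n 0.
Proof. by apply/matrixP => i j; rewrite jordan_block0 !mxE. Qed.

(** A diagonal below the main one starts in column 0 and a diagonal above it ends in column [r],
    where the entries are [z]. Only the main diagonal escapes. *)
Lemma toeplitz_scalar (T : Type) (z : T) (f : nat -> nat -> T) r :
  (forall i j, (i < r)%N -> (j < r)%N -> f i.+1 j.+1 = f i j) ->
  (forall i, (i < r)%N -> f i.+1 0%N = z) -> (forall i, (i < r)%N -> f i r = z) ->
  forall i j, (i <= r)%N -> (j <= r)%N -> f i j = if i == j then f r r else z.
Proof.
move=> fS f0 fr i j ir jr.
have sh d a b : (a + d <= r)%N -> (b + d <= r)%N -> f (a + d)%N (b + d)%N = f a b.
  elim: d => [|d IH] ha hb; first by rewrite !addn0.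
  move: ha hb; rewrite !addnS => ha hb.
  by rewrite fS // IH // ltnW.
case: (ltngtP i j) => [ij|ij|->].
- by rewrite -(sh (r - j)%N) ?subnKC // ?fr //; lia.
- have := sh j (i - j)%N 0%N; rewrite subnK ?add0n; last exact: ltnW.
  move=> -> //; have -> : (i - j = (i - j).-1.+1)%N by lia.
  by apply: f0; lia.
- by rewrite -(sh (r - j)%N) ?subnKC.
Qed.

(** Entrywise, the first equation says that [Q] agrees with the upper rows of [P], and the second
    that [P] is constant along diagonals. Entries of [Q] out of range read as 0 and supply the
    boundary values. So this pencil has only scalar endomorphisms. *)
Lemma pencilW_End r (P : 'M[F]_r.+1) (Q : 'M[F]_r) :
  Q *m pencilWA r.+1 = pencilWA r.+1 *m P ->
  Q *m pencilWB r.+1 = pencilWB r.+1 *m P ->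
  P = (P ord_max ord_max)%:M /\ Q = (P ord_max ord_max)%:M.
Proof.
move=> HA HB.
have eA (i : 'I_r) (j : 'I_r.+1) : mxnat Q i j = mxnat P i j.
  have := congr1 (fun M : 'M_(_, _) => M i j) HA.
  by rewrite (mulr_WA (m := r.+1) Q) (mul_WA (n := r.+1)).
have eB (i : 'I_r) (j : 'I_r.+1) :
    (if j == 0%N :> nat then 0 else mxnat Q i j.-1) = mxnat P i.+1 j.
  have := congr1 (fun M : 'M_(_, _) => M i j) HB.
  by rewrite (mulr_WB (m := r.+1) Q) (mul_WB (n := r.+1)).
have eA' i j : (i < r)%N -> (j < r.+1)%N -> mxnat Q i j = mxnat P i j.
  by move=> ir jr; have := eA (Ordinal ir) (Ordinal jr).
have eP i j : (i <= r)%N -> (j <= r)%N ->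
    mxnat P i j = if i == j then mxnat P r r else 0.
  apply: toeplitz_scalar => {}i; [move=> {}j ir jr|move=> ir|move=> ir].
  - by have := eB (Ordinal ir) (@Ordinal r.+1 j.+1 jr) => /= <-; apply: eA'; rewrite // ltnW.
  - by have := eB (Ordinal ir) ord0 => /= <-.
  - have := eA (Ordinal ir) ord_max => /= <-.
    by rewrite /mxnat; case: insubP => // a _ _; case: insubP => // b; rewrite ltnn.
have eR : mxnat P r r = P ord_max ord_max by have := mxnatE P ord_max ord_max.
split; apply/matrixP => i j; rewrite mxE.
  by rewrite -(mxnatE P) (eP i j (leq_ord i) (leq_ord j)) eR mulrb.
have ir := ltn_ord i; have jr := ltn_ord j.
rewrite -(mxnatE Q) (eA' i j ir (ltnW jr)) (eP i j (ltnW ir) (ltnW jr)) eR.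
by rewrite mulrb.
Qed.

Lemma upper_unit n (T : 'M[F]_n) c : c != 0 ->
  (forall i j : 'I_n, (j < i)%N -> T i j = 0) -> (forall i, T i i = c) ->
  T \in unitmx.
Proof.
move=> c0 Tu Td; rewrite -unitmx_tr unitmxE det_trig.
  by rewrite unitfE prodf_seq_neq0; apply/allP => i _; rewrite mxE Td c0.
by apply/is_trig_mxP => i j ij; rewrite mxE Tu.
Qed.

(** A matrix commuting with the nilpotent Jordan block is constant along diagonals and zero below
    the main one. If it is idempotent, its diagonal is 0 or 1, so [1%:M - P] or [P] is invertible,
    and an invertible idempotent is the identity. *)
Lemma jordan_indec n (c : F) : (0 < n)%N -> endo_indec (jordan_block n c).
Proof.
case: n => // n _ P PP PJ.
have {PJ}PJ : P *m jordan_block n.+1 0 = jordan_block n.+1 0 *m P.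
  by move: PJ; rewrite jordan_blockE mulmxDl mulmxDr scalar_mxC => /addrI.
have eP (i j : 'I_n.+1) : (if j == 0%N :> nat then 0 else mxnat P i j.-1) = mxnat P i.+1 j.
  have := congr1 (fun M : 'M_(_, _) => M i j) PJ.
  by rewrite jordan_block0 (mul_shift S) mul_shiftS.
have eS i j : (i < n)%N -> (j < n)%N -> mxnat P i.+1 j.+1 = mxnat P i j.
  by move=> ir jr; have := eP (Ordinal (leqW ir)) (@Ordinal n.+1 j.+1 jr).
have e0 i : (i < n)%N -> mxnat P i.+1 0 = 0.
  by move=> ir; have := eP (Ordinal (leqW ir)) ord0 => /= <-.
have sh d a b : (a + d <= n)%N -> (b + d <= n)%N -> mxnat P (a + d) (b + d) = mxnat P a b.
  elim: d => [|d IH] ha hb; first by rewrite !addn0.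
  by move: ha hb; rewrite !addnS => ha hb; rewrite eS // IH // ltnW.
have lo (i j : 'I_n.+1) : (j < i)%N -> P i j = 0.
  move=> ji; have iN := leq_ord i; have jN := leq_ord j.
  have := sh j (i - j)%N 0%N; rewrite subnK ?add0n -?mxnatE; last exact: ltnW.
  move=> -> //.
  have -> : (i - j = (i - j).-1.+1)%N by lia.
  by apply: e0; lia.
have di (i : 'I_n.+1) : P i i = P ord0 ord0.
  by rewrite -!mxnatE /= -(sh i 0%N 0%N) ?add0n // -ltnS.
have PP0 : P ord0 ord0 * P ord0 ord0 = P ord0 ord0.
  rewrite -{3}PP mxE (bigD1 ord0) //= big1 ?addr0 // => i i0.
  by rewrite (lo i) ?mulr0 // lt0n.
have : P ord0 ord0 == 0 \/ P ord0 ord0 == 1.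
  apply/orP; rewrite -[X in _ || X]subr_eq0 -mulf_eq0 mulrBr mulr1 PP0 subrr //.
case=> /eqP P0; [left|right].
  have U : 1%:M - P \in unitmx.
    apply: (@upper_unit _ _ 1); first exact: oner_neq0.
      by move=> i j ij; rewrite !mxE lo // -val_eqE /= gtn_eqF // subr0.
    by move=> i; rewrite !mxE di P0 subr0 eqxx.
  rewrite -[P](mulKmx U) mulmxBl mul1mx PP subrr mulmx0 //.
have U : P \in unitmx.
  by apply: (@upper_unit _ _ 1 (oner_neq0 _) lo) => i; rewrite di P0.
by rewrite -[RHS](mulVmx U) -{3}PP mulKmx.
Qed.
End Pencils.

(** * Splitting a Jordan block off an endomorphism *)

Section PencilClassification.
Variable F : numClosedFieldType.

(* Fitting: with char_poly H = X^k r, r(0) <> 0 and u X^(k+1) + w r = 1, the matrix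
   (w r)(H) is an idempotent commuting with H. *)
Lemma endo_indec_unit_or_nilp n (H : 'M[F]_n) : endo_indec H ->
  H \in unitmx \/ exists k, H ^+ k = 0.
Proof.
case: n H => [|n] H Hi.
  by left; rewrite unitmxE det_mx00 unitr1.
pose ch := char_poly H.
have ch0 : ch != 0 by apply: monic_neq0; apply: char_poly_monic.
have [k [r r0 chE]] := multiplicity_XsubC ch 0.
move: r0; rewrite ch0 /= => r0.
rewrite polyC0 subr0 in chE.
have cop : coprimep ('X^(k.+1)) r.
  apply: coprimep_expl; rewrite -['X]subr0 -polyC0.
  by rewrite coprimep_sym coprimep_XsubC.
have [[u w] /= uw] := Bezout_eq1_coprimepP _ _ cop.
pose P := horner_mx H (w * r).
have uE : horner_mx H (u * 'X^(k.+1)) + P = 1.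
  by rewrite /P -rmorphD uw rmorph1.
have chH : horner_mx H (r * 'X^(k.+1)) = 0.
  by rewrite exprSr mulrA -chE rmorphM /= Cayley_Hamilton mul0r.
have z : P * horner_mx H (u * 'X^(k.+1)) = 0.
  rewrite /P -rmorphM /= (_ : w * r * _ = (w * u) * (r * 'X^(k.+1))); last by rewrite mulrACA.
  by rewrite rmorphM /= chH mulr0.
have PP : P *m P = P.
  by rewrite -[RHS]mulr1 -uE mulrDr z add0r.
have PH : P *m H = H *m P by apply: comm_horner_mx.
have hX : horner_mx H 'X^(k.+1) = H ^+ k.+1 by rewrite rmorphXn /= horner_mx_X.
have [P0|P1] := Hi P PP PH.
  left; move: uE; rewrite P0 addr0 rmorphM /= hX exprSr mulrA => /mulmx1_unit [].
  by [].
right; exists k.+1; rewrite -hX -[LHS]mulr1 -[1]P1 /P -rmorphM /=.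
rewrite mulrC -mulrA.
by rewrite rmorphM /= chH mulr0.
Qed.

(* A longest Jordan chain of the nilpotent part splits off. *)
Lemma endo_indec_jordan n (H : 'M[F]_n) (z : F) : (0 < n)%N -> endo_indec H ->
  H - z%:M \notin unitmx ->
  exists d (P : 'M_(d, n)) (P' : 'M_(n, d)),
    [/\ (0 < d)%N, P *m P' = 1%:M, P' *m P = 1%:M & P *m H = jordan_block d z *m P].
Proof.
move=> n0 Hi Hz; pose N := H - z%:M.
have Ni : endo_indec N.
  move=> P PP PN; apply: Hi => //; move: PN.
  by rewrite /N mulmxBl mulmxBr scalar_mxC => /addIr.
have [/(negP Hz)//|ex] := endo_indec_unit_or_nilp Ni.
have exb : exists k, N ^+ k == 0 by case: ex => k Nk; exists k; apply/eqP.
case: (ex_minnP exb) => -[|d] /eqP Nd dmin.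
  case: n n0 H Hi Hz N Ni ex exb Nd dmin => // n _ H Hi Hz N Ni ex exb Nd dmin.
  by move/eqP: Nd; rewrite expr0 oner_eq0.
have Nd0 : N ^+ d != 0 by apply/negP => /dmin; rewrite ltnn.
have [i [j Nij]] : exists i j, (N ^+ d) i j != 0.
  apply: contra_notP (negP Nd0) => nex; apply/eqP/matrixP => i j; rewrite mxE.
  by apply: contra_notP nex => /eqP ?; exists i, j.
(* A nonzero entry (i, j) of the last nonzero power of [N] gives a Jordan chain of columns N^(d-b)
   e_j and a chain of rows e_i N^a to test it against. *)
pose X : 'M_(n, d.+1) := \matrix_(a, b) (N ^+ (d - b)%N) a j.
pose Y : 'M_(d.+1, n) := \matrix_(a, b) (N ^+ a) i b.
pose J : 'M[F]_d.+1 := jordan_block d.+1 0.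
have eqS k : N *m N ^+ k = N ^+ k.+1 by rewrite exprS.
have eqSr k : N ^+ k *m N = N ^+ k.+1 by rewrite exprSr.
have NXJ : N *m X = X *m J.
  apply/matrixP => a b; rewrite /J jordan_block0 mul_shiftS.
  have -> : (N *m X) a b = (N ^+ (d - b).+1) a j.
    by rewrite -eqS !mxE; apply: eq_bigr => c _; rewrite !mxE.
  case: eqP => [->|b0]; first by rewrite subn0 Nd mxE.
  have b1 : (b.-1 < d.+1)%N by have := ltn_ord b; lia.
  rewrite (mxnatE X a (Ordinal b1)) mxE /=; congr (fun_of_matrix (_ ^+ _)).
  by have := ltn_ord b; lia.
have YNJ : Y *m N = J *m Y.
  apply/matrixP => a b; rewrite /J jordan_block0 (mul_shift S).
  have -> : (Y *m N) a b = (N ^+ a.+1) i b.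
    by rewrite -eqSr !mxE; apply: eq_bigr => c _; rewrite !mxE.
  have := leq_ord a; rewrite leq_eqVlt => /orP[/eqP ad|ad].
    by rewrite ad Nd mxE /mxnat; case: insubP => // c; rewrite ltnn.
  by rewrite (mxnatE Y (@Ordinal d.+1 a.+1 ad) b) mxE.
(* The entry (a, b) is the entry (i, j) of N^(a+d-b): zero for b < a, and the chosen nonzero one on
   the diagonal. *)
pose T := Y *m X.
have TE (a b : 'I_d.+1) : T a b = (N ^+ (a + (d - b))) i j.
  by rewrite exprD !mxE; apply: eq_bigr => c _; rewrite !mxE.
have TU : T \in unitmx.
  apply: (upper_unit Nij) => [a b ba|a]; last by rewrite TE subnKC // leq_ord.
  rewrite TE (_ : (_ + _ = d.+1 + (a - b.+1))%N); last by have := leq_ord b; lia.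
  by rewrite exprD Nd mul0r mxE.
have TJ : T *m J = J *m T by rewrite /T -mulmxA -NXJ !mulmxA YNJ.
have TVJ : invmx T *m J = J *m invmx T.
  by rewrite -[in LHS](mulmxK TU J) -TJ -mulmxA mulKmx.
(* The two chains are dual up to the invertible [T], so this is an idempotent onto the span of the
   Jordan chain. *)
pose P := X *m invmx T *m Y.
have PP : P *m P = P.
  by rewrite /P !mulmxA -[_ *m Y *m X]mulmxA -/T mulmxKV.
have PN : P *m N = N *m P.
  by rewrite /P !mulmxA NXJ -[_ *m Y *m N]mulmxA YNJ !mulmxA -[_ *m invmx T *m J]mulmxA TVJ mulmxA.
exists d.+1, (invmx T *m Y), X; split => //.
- by rewrite -mulmxA mulVmx.
- have [P0|<-] := Ni P PP PN; last by rewrite mulmxA.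
  have YPX : Y *m P *m X = T by rewrite /P !mulmxA -/T mulmxV // mul1mx.
  have := TE ord0 ord0; rewrite -YPX P0 mulmx0 mul0mx mxE /= add0n subn0.
  by move/esym/eqP; rewrite (negPf Nij).
- have HE : H = z%:M + N by rewrite /N addrC subrK.
  rewrite HE jordan_blockE mulmxDr mulmxDl scalar_mxC; congr (_ + _).
  by rewrite -mulmxA YNJ !mulmxA TVJ.
Qed.
End PencilClassification.

(** * Splitting a minimal chain off a singular pencil *)

Section PencilChains.
Variable F : numClosedFieldType.

(* A chain of length r is a polynomial kernel vector sum_j e_j t^j of B - t A of degree < r. *)
Definition pencil_chain n m (A B : 'M[F]_(n, m)) (r : nat) (e : nat -> 'cV[F]_m) :=
  [/\ forall j, (r <= j)%N -> e j = 0, B *m e 0%N = 0 &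
      forall j, A *m e j = B *m e j.+1].

Definition has_chain n m (A B : 'M[F]_(n, m)) (r : nat) :=
  exists2 e, pencil_chain A B r e & exists j, e j != 0.

(** Columns beyond the width read as 0, so that the columns of a matrix can form a chain indexed by
    all naturals. *)
Definition mxncol n m (A : 'M[F]_(n, m)) (j : nat) : 'cV_n := \col_i mxnat A i j.

Lemma mxncol_out n m (A : 'M[F]_(n, m)) j : (m <= j)%N -> mxncol A j = 0.
Proof.
move=> mj; apply/colP => i; rewrite !mxE /mxnat valK.
by case: insubP => // k _ kj; move: (ltn_ord k); rewrite kj ltnNge mj.
Qed.

Lemma mxnat_mul n m r (A : 'M[F]_(n, m)) (X : 'M[F]_(m, r)) (i : 'I_n) j :
  mxnat (A *m X) i j = (A *m mxncol X j) i 0.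
Proof.
rewrite /mxnat valK mxE; case: insubP => [k _ <-|kj].
  by rewrite mxE; apply: eq_bigr => l _; rewrite mxE mxnatE.
by rewrite big1 // => l _; rewrite mxE /mxnat valK insubN // mulr0.
Qed.

(** The columns of [cokermx L] are functionals that vanish on the row space of [L]. One of them is
    nonzero on [t], and the trace pairing expresses it by a matrix [G]. *)
Lemma functional_off n k r (L : 'M[F]_(r, n * k)) (t : 'M[F]_(n, k)) :
  ~ (exists u : 'rV_r, u *m L = mxvec t) ->
  exists G : 'M_(k, n), (forall Y, (exists u : 'rV_r, u *m L = mxvec Y) -> \tr (G *m Y) = 0) /\
    \tr (G *m t) != 0.
Proof.
move=> nt.
have {nt} : mxvec t *m cokermx L != 0.
  rewrite -submxE; apply/negP => /submxP [u tu]; apply: nt; by exists u.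
move/rV0Pn => [c tc].
pose g (Y : 'M_(n, k)) := (mxvec Y *m cokermx L) 0 c.
pose G : 'M_(k, n) := \matrix_(i, l) g (delta_mx l i).
have gE Y : \tr (G *m Y) = g Y.
  rewrite {2}(matrix_sum_delta Y) /g linear_sum mulmx_suml summxE.
  rewrite [RHS](eq_bigr (fun l => \sum_i Y l i * g (delta_mx l i))).
    rewrite exchange_big; apply: eq_bigr => i _; rewrite mxE; apply: eq_bigr => l _.
    by rewrite mxE mulrC.
  move=> l _; rewrite linear_sum mulmx_suml summxE; apply: eq_bigr => i _.
  by rewrite linearZ -scalemxAl mxE.
exists G; split; last by rewrite gE.
move=> Y [u uY]; rewrite gE /g -uY -mulmxA mulmx_coker mulmx0 mxE //.
Qed.

Lemma mxtrace_delta n m (M : 'M[F]_(n, m)) x a : \tr (M *m delta_mx x a) = M a x.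
Proof.
rewrite /mxtrace (bigD1 a) //= big1 ?addr0 => [|i ia].
  rewrite mxE (bigD1 x) //= mxE !eqxx mulr1 big1 ?addr0 // => i ix.
  by rewrite mxE (negPf ix) mulr0.
by rewrite mxE big1 // => j _; rewrite mxE (negPf ia) andbF mulr0.
Qed.

(** A chain of length one is a common kernel vector of [A] and [B]. It spans a summand with empty
    target, cut out by a rank one idempotent. *)
Lemma pencil_indec_chain1 n m (A B : 'M[F]_(n, m)) : pencil_indec A B ->
  has_chain A B 1 -> pencil_iso A B (pencilWA F 1) (pencilWB F 1).
Proof.
move=> AB [e [e0 Be Ae] [j ej]].
have {ej} ej : e 0%N != 0 by case: j ej => // j; rewrite e0 ?eqxx.
have {Ae} Ae : A *m e 0%N = 0 by rewrite Ae e0 // mulmx0.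
have /cV0Pn [i ei] := ej.
pose Y : 'rV_m := (e 0%N i 0)^-1 *: delta_mx 0 i.
have Ye : Y *m e 0%N = 1%:M.
  apply/matrixP => a b; rewrite !ord1 -scalemxAl -rowE !mxE mulVf //.
have [||||[P0 _]|[P1 Q1]] := AB (e 0%N *m Y) 0.
- by rewrite -!mulmxA [Y *m (_ *m _)]mulmxA Ye mul1mx.
- by rewrite mul0mx.
- by rewrite mulmxA Ae !mul0mx.
- by rewrite mulmxA Be !mul0mx.
- case/negP: ej; rewrite -[e _]mulmx1 -Ye mulmxA P0 mul0mx //.
exists Y, (e 0%N), (0 : 'M_(0, n)), (0 : 'M_(n, 0)); split; split => //.
- by apply/matrixP => [[]].
- by rewrite mulmx0.
- by apply/matrixP => [[]].
- by apply/matrixP => [[]].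
Qed.

(** The chain embeds the model pencil through [Xe] and [Xf]. A map back is determined by its
    component [G] on targets, and minimality of the length is what makes a suitable [G] exist. *)
Lemma pencil_indec_chain n m (A B : 'M[F]_(n, m)) r : pencil_indec A B ->
  has_chain A B r -> (forall r', (r' < r)%N -> ~ has_chain A B r') ->
  (0 < r)%N /\ pencil_iso A B (pencilWA F r) (pencilWB F r).
Proof.
move=> AB hr rmin.
case: r hr rmin => [|[|k]] hr rmin.
- by case: hr => e [e0 _ _] [j]; rewrite e0 ?eqxx.
- by split => //; apply: pencil_indec_chain1.
split => //; case: hr => e [e0 Be Ae] [j0 ej0].
have ek : e k.+1 != 0.
  apply/eqP => ek; apply: (rmin k.+1) => //; exists e; last by exists j0.
  by split => // j; rewrite leq_eqVlt => /orP[/eqP <- //|]; apply: e0.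
have Aek : A *m e k.+1 = 0 by rewrite Ae e0 // mulmx0.
pose Xe : 'M_(m, k.+2) := \matrix_(i, j) e j i 0.
pose Xf : 'M_(n, k.+1) := \matrix_(i, j) (A *m e j) i 0.
have XeE j : mxncol Xe j = e j.
  case: (ltnP j k.+2) => jk; last by rewrite mxncol_out // e0.
  by apply/colP => i; rewrite mxE (mxnatE Xe i (Ordinal jk)) mxE.
have XfE j (i : 'I_n) : mxnat Xf i j = (A *m e j) i 0.
  case: (ltnP j k.+1) => jk; first by rewrite (mxnatE Xf i (Ordinal jk)) mxE.
  have := congr1 (fun M : 'cV_n => M i 0) (mxncol_out Xf jk); rewrite mxE => ->.
  by move: jk; rewrite leq_eqVlt => /orP[/eqP <-|jk]; rewrite ?Aek ?e0 ?mulmx0.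
have XfA : Xf *m pencilWA F k.+2 = A *m Xe.
  apply/matrixP => i j; rewrite (mulr_WA (m := k.+2)) XfE.
  by rewrite -(mxnatE (A *m Xe)) mxnat_mul XeE.
have XfB : Xf *m pencilWB F k.+2 = B *m Xe.
  apply/matrixP => i j; rewrite (mulr_WB (m := k.+2)) XfE.
  rewrite -(mxnatE (B *m Xe)) mxnat_mul XeE; case: eqP => [->|/eqP jn0].
    by rewrite Be mxE.
  by rewrite Ae prednK // lt0n.
(* The trace of G t is the last diagonal entry of G [Xf], the scalar that has to be nonzero. *)
pose t : 'M_(n, k.+1) := \matrix_(i, j) ((j == k :> nat)%:R * (A *m e k) i 0).
(* [G] extends to a morphism of pencils exactly when its trace pairing kills every B X WA - A X WB,
   with WA and WB the model matrices of size [k.+1]. The row space of [L] consists of these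
   matrices. *)
pose L := lin_mulmx B *m lin_mulmxr (pencilWA F k.+1) -
          lin_mulmx A *m lin_mulmxr (pencilWB F k.+1).
have LE (X : 'M_(m, k)) : mxvec X *m L =
    mxvec (B *m X *m pencilWA F k.+1 - A *m X *m pencilWB F k.+1).
  by rewrite mulmxBr !mulmxA !mul_vec_lin -linearB.
have [|G [G0 Gt]] := @functional_off _ _ _ L t.
  case=> u; rewrite -[u]vec_mxK LE => /(can_inj mxvecK).
  move: (vec_mx u : 'M_(m, k)) => X LX.
  (* If [t] were of that form, column j would read B X_j - A X_(j-1) = [j = k] A e_k, and A e_k = B
     e_(k+1). As X_k reads as 0, subtracting e_(k+1) at index k produces a nonzero chain of length k
     + 1, shorter than the minimal one. *)
  pose e' j : 'cV_m := mxncol X j - (j == k)%:R *: e k.+1.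
  have LX' j : (j <= k)%N -> B *m e' j = if j == 0%N then 0 else A *m mxncol X j.-1.
    move=> jk; apply/colP => i.
    have := congr1 (fun M : 'M_(_, _) => M i (Ordinal (jk : (j < k.+1)%N))) LX.
    rewrite mxE [X in _ + X]mxE (mulr_WA (m := k.+1)) (mulr_WB (m := k.+1)) !mxnat_mul /=.
    rewrite [t _ _]mxE /= Ae /e' mulmxBr -scalemxAr.
    move/eqP; rewrite subr_eq => /eqP H; rewrite mxE H [X in _ + X]mxE [X in - X]mxE.
    by rewrite addrC addKr; case: eqP; rewrite // mxE.
  apply: (rmin k.+1) => //; exists e'; last first.
    exists k; rewrite /e' mxncol_out // eqxx scale1r sub0r oppr_eq0 //.
  split => [j jk||j].
  - by rewrite /e' mxncol_out 1?ltnW // gtn_eqF // scale0r subr0.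
  - by rewrite LX'.
  case: (ltngtP j k) => jk.
  - by rewrite LX' //= /e' ltn_eqF // scale0r subr0.
  - rewrite /e' !mxncol_out ?gtn_eqF ?scale0r ?subr0 ?mulmx0 //; lia.
  - rewrite /e' jk !mxncol_out ?eqxx ?(gtn_eqF (ltnSn _)) ?scale1r ?scale0r //.
    by rewrite subr0 sub0r mulmxN Aek oppr0 mulmx0.
have GG : pencilWA F k.+1 *m G *m B = pencilWB F k.+1 *m G *m A.
  apply/eqP; rewrite -subr_eq0; apply/eqP/matrixP => a x; rewrite [RHS]mxE.
  rewrite -mxtrace_delta mulmxBl linearB /=.
  rewrite -[_ *m B *m _]mulmxA -[_ *m G *m (B *m _)]mulmxA mxtrace_mulC.
  rewrite -[_ *m A *m _]mulmxA -[_ *m G *m (A *m _)]mulmxA [X in _ - X]mxtrace_mulC.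
  rewrite -!mulmxA -linearB -mulmxBr; apply: G0; exists (mxvec (delta_mx x a)).
  by rewrite LE !mulmxA.
(* Row i has to be row i of G A and also row i - 1 of G B; [GG] says that the two agree where both
   exist. *)
pose Ye : 'M_(k.+2, m) := \matrix_(i, j) if i == 0%N :> nat then mxnat (G *m A) 0 j
                                      else mxnat (G *m B) i.-1 j.
have YeB : G *m B = pencilWB F k.+2 *m Ye.
  apply/matrixP => i j; rewrite (mul_WB (n := k.+2)).
  by rewrite (mxnatE Ye (lift ord0 i)) [RHS]mxE /= -(mxnatE (G *m B)).
have YeA : G *m A = pencilWA F k.+2 *m Ye.
  apply/matrixP => i j; rewrite (mul_WA (n := k.+2)).
  rewrite (mxnatE Ye (widen_ord (leqnSn _) i)) [RHS]mxE /=.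
  rewrite -(mxnatE (G *m A)); case: eqP => [-> //|/eqP i0].
  have ik : (i.-1 < k)%N by have := ltn_ord i; lia.
  have := congr1 (fun M : 'M_(k, m) => M (Ordinal ik) j) GG.
  rewrite -!mulmxA (mul_WA (n := k.+1)) (mul_WB (n := k.+1)) /= => ->.
  by rewrite prednK // lt0n.
(* The composite is an endomorphism of the model pencil, hence a scalar [c]. *)
have [|| TeE TfE] := @pencilW_End _ k.+1 (Ye *m Xe) (G *m Xf).
- by rewrite -mulmxA XfA !mulmxA YeA.
- by rewrite -mulmxA XfB !mulmxA YeB.
set c := (_ ord_max ord_max) in TeE TfE.
have c0 : c != 0.
  move: Gt; rewrite /mxtrace (bigD1 ord_max) //= big1 ?addr0 => [|i ik].
    have -> : (G *m t) ord_max ord_max = (G *m Xf) ord_max ord_max.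
      by rewrite !mxE; apply: eq_bigr => l _; rewrite !mxE eqxx mul1r.
    by rewrite TfE mxE eqxx.
  rewrite mxE big1 // => l _; rewrite mxE.
  by case: eqP => [ik'|_]; rewrite ?mul0r ?mulr0 //; case/eqP: ik; apply: val_inj.
have cc : c^-1 *: (c%:M : 'M[F]_k.+2) = 1%:M by rewrite scale_scalar_mx mulVf.
have cc' : c^-1 *: (c%:M : 'M[F]_k.+1) = 1%:M by rewrite scale_scalar_mx mulVf.
have [||||[P0 _]|[P1 Q1]] := AB (Xe *m (c^-1 *: Ye)) (Xf *m (c^-1 *: G)).
- by rewrite mulmxA -[_ *m _ *m Xe]mulmxA -scalemxAl TeE cc mulmx1.
- by rewrite mulmxA -[_ *m _ *m Xf]mulmxA -scalemxAl TfE cc' mulmx1.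
- by rewrite -mulmxA -scalemxAl YeA mulmxA -XfA -mulmxA -!scalemxAr.
- by rewrite -mulmxA -scalemxAl YeB mulmxA -XfB -mulmxA -!scalemxAr.
- have : Xe *m (c^-1 *: Ye) *m Xe = Xe by rewrite -mulmxA -scalemxAl TeE cc mulmx1.
  rewrite P0 mul0mx => Xe0; case/negP: ek.
  by rewrite -XeE -Xe0; apply/eqP/colP => i; rewrite !mxE /mxnat; do 2?case: insubP => *; rewrite ?mxE.
exists (c^-1 *: Ye), Xe, (c^-1 *: G), Xf; split; split => //.
- by rewrite -scalemxAl TeE cc.
- by rewrite -scalemxAl TfE cc'.
- by rewrite -scalemxAl YeA -scalemxAr.
- by rewrite -scalemxAl YeB -scalemxAr.
Qed.
End PencilChains.

(** * Kronecker's theorem for indecomposable pencils *)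

Section KroneckerTheorem.
Variable F : numClosedFieldType.

(* If sum_k c_k v_k = 0 with (B - k A) v_k = 0, then sum_k c_k v_k prod_(l <> k) (t - l)
   is a polynomial kernel vector of B - t A. *)
Lemma singular_has_chain n m (A B : 'M[F]_(n, m)) :
  (forall k, (k <= m)%N -> exists2 v : 'cV_m, v != 0 & B *m v = k%:R *: (A *m v)) ->
  exists r, has_chain A B r.
Proof.
move=> sing.
have /choice [v hv] (k : 'I_m.+1) : exists v : 'cV_m, v != 0 /\ B *m v = (k : nat)%:R *: (A *m v).
  by have [v] := sing k (leq_ord k); exists v.
pose V : 'M_(m.+1, m) := \matrix_(i, j) v i j 0.
have [c c0 cV] : exists2 c : 'rV_m.+1, c != 0 & c *m V = 0.
  have : kermx V != 0.
    rewrite -mxrank_eq0 mxrank_ker -lt0n subn_gt0.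
    exact: leq_ltn_trans (rank_leq_col V) _.
  by case/rowV0Pn => u /sub_kermxP uV u0; exists u.
have cv : \sum_i c 0 i *: v i = 0.
  apply/colP => j; have := congr1 (fun M : 'rV_m => M 0 j) cV.
  rewrite !mxE summxE => H; rewrite -[RHS]H; apply: eq_bigr => i _; rewrite !mxE //.
pose pk (k : 'I_m.+1) : {poly F} := \prod_(l < m.+1 | l != k) ('X - (l%:R)%:P).
pose Pi : {poly F} := \prod_(l < m.+1) ('X - (l%:R)%:P).
have pkE (k : 'I_m.+1) : Pi = ('X - ((k : nat)%:R)%:P) * pk k by rewrite /Pi (bigD1 k).
have sPi : size Pi = m.+2.
  by rewrite size_prod_XsubC [index_enum _]unlock -enumT size_enum_ord.
have sz (k : 'I_m.+1) : (size (pk k) <= m.+1)%N.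
  have pk0 : pk k != 0.
    by apply: contra_eqN sPi => /eqP pk0; rewrite (pkE k) pk0 mulr0 size_poly0.
  have := sPi; rewrite (pkE k) size_mul ?polyXsubC_eq0 // size_XsubC.
  by rewrite add2n => -[->].
have coefk (k : 'I_m.+1) j : (k : nat)%:R * (pk k)`_j = (if j is j'.+1 then (pk k)`_j' else 0) - Pi`_j.
  rewrite (pkE k) mulrBl coefB coefXM coefCM; case: j => [|j] /=; ring.
pose e j : 'cV_m := \sum_k (c 0 k * (pk k)`_j) *: v k.
exists m.+1, e; [split|].
- move=> j mj; rewrite /e big1 // => k _.
  by rewrite nth_default ?mulr0 ?scale0r // (leq_trans (sz k)).
- rewrite /e mulmx_sumr (eq_bigr (fun k => (- Pi`_0) *: (A *m (c 0 k *: v k)))).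
    by rewrite -scaler_sumr -mulmx_sumr cv mulmx0 scaler0.
  move=> k _; rewrite -!scalemxAr (hv k).2 !scalerA; congr (_ *: _).
  by rewrite -mulrA [_ * k%:R]mulrC coefk; ring.
- move=> j; apply/esym/eqP; rewrite -subr_eq0 /e !mulmx_sumr -sumrB.
  rewrite (eq_bigr (fun k => (- Pi`_j.+1) *: (A *m (c 0 k *: v k)))).
    by rewrite -scaler_sumr -mulmx_sumr cv mulmx0 scaler0.
  move=> k _; rewrite -!scalemxAr (hv k).2 !scalerA -scalerBl; congr (_ *: _).
  by rewrite -mulrA [_ * k%:R]mulrC coefk; ring.
have [k ck] : exists k, c 0 k != 0 by have /rV0Pn := c0.
apply: contrapT => ne.
have e0 j : e j = 0 by apply: contra_notP ne => /eqP ?; exists j.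
(* Evaluation at t = k leaves only the k-th term. Its coefficient is nonzero because distinct
   naturals stay distinct in characteristic zero. *)
have [vk _] := hv k; case/negP: vk.
have : \sum_(j < m.+1) (k : nat)%:R ^+ j *: e j = 0.
  by rewrite big1 // => j _; rewrite e0 scaler0.
rewrite /e; under eq_bigr do rewrite scaler_sumr.
rewrite exchange_big /= (eq_bigr (fun l => (c 0 l * (pk l).[k%:R]) *: v l)).
  have Xk (l : 'I_m.+1) : ('X - ((l : nat)%:R)%:P : {poly F}).[k%:R] = (k : nat)%:R - (l : nat)%:R.
    by rewrite !hornerE.
  rewrite (bigD1 k) //= [X in _ + X]big1 ?addr0 => [|l lk].
    move=> /eqP; rewrite scaler_eq0 mulf_eq0 (negPf ck) /= => /orP[|//].
    rewrite horner_prod => /prodf_eq0 [l lk].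
    by rewrite Xk subr_eq0 eqr_nat eq_sym val_eqE (negPf lk).
  by rewrite horner_prod (bigD1 k) 1?eq_sym //= Xk subrr mul0r mulr0 scale0r.
move=> l _; rewrite (horner_coef_wide _ (sz l)) mulr_sumr scaler_suml.
by apply: eq_bigr => j _; rewrite scalerA; congr (_ *: _); ring.
Qed.

Lemma pencil_indec_tr n m (A B : 'M[F]_(n, m)) :
  pencil_indec A B -> pencil_indec A^T B^T.
Proof.
move=> AB P Q PP QQ PA PB.
have tr k l (X Y : 'M[F]_(k, l)) : X^T = Y^T -> X = Y by move/(can_inj trmxK).
have [||||[p q]|[p q]] := AB Q^T P^T; try by apply: tr; rewrite !trmx_mul !trmxK.
- by left; split; apply: tr; rewrite trmx0.
- by right; split; apply: tr; rewrite trmx1.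
Qed.

Lemma pencil_iso_tr n m n' m' (A B : 'M[F]_(n, m)) (A' B' : 'M[F]_(n', m')) :
  pencil_iso A B A' B' -> pencil_iso A^T B^T A'^T B'^T.
Proof.
move=> [P [P' [Q [Q' [[PP' P'P QQ' Q'Q] [QA QB]]]]]].
exists Q'^T, Q^T, P'^T, P^T; rewrite -!trmx_mul PP' P'P QQ' Q'Q !trmx1; split => //.
split; congr trmx.
  by rewrite -[LHS]mul1mx -Q'Q -!mulmxA [Q *m _]mulmxA QA -mulmxA PP' mulmx1.
  by rewrite -[LHS]mul1mx -Q'Q -!mulmxA [Q *m _]mulmxA QB -mulmxA PP' mulmx1.
Qed.

Lemma pencil_chain_or_inj n m (A B : 'M[F]_(n, m)) :
  (exists r, has_chain A B r) \/
  exists k : nat, forall v : 'cV_m, (B - k%:R *: A) *m v = 0 -> v = 0.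
Proof.
have [inj|ninj] := pselect (exists k : nat, forall v : 'cV_m, (B - k%:R *: A) *m v = 0 -> v = 0).
  by right.
left; apply: singular_has_chain => k _; apply: contrapT => nv; apply: ninj; exists k => v.
rewrite mulmxBl -scalemxAl => /eqP; rewrite subr_eq0 => /eqP Bv.
by apply: contrapT => /eqP v0; apply: nv; exists v.
Qed.

Lemma inj_mxrank n m (A : 'M[F]_(n, m)) :
  (forall v : 'cV_m, A *m v = 0 -> v = 0) -> \rank A = m.
Proof.
move=> inj; rewrite -mxrank_tr; apply/eqP; rewrite -/(row_free _) -kermx_eq0.
apply/eqP/row_matrixP => i; rewrite row0; apply: (can_inj (@trmxK _ _ _)); rewrite trmx0.
by apply: inj; apply: (can_inj (@trmxK _ _ _)); rewrite trmx_mul trmxK -row_mul mulmx_ker row0 trmx0.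
Qed.

Lemma min_chain n m (A B : 'M[F]_(n, m)) : pencil_indec A B ->
  (exists r, has_chain A B r) ->
  exists2 r, (0 < r)%N & pencil_iso A B (pencilWA F r) (pencilWB F r).
Proof.
move=> AB [r hr].
have ex : exists r, `[< has_chain A B r >] by exists r; apply/asboolP.
case: (ex_minnP ex) => r0 /asboolP hr0 rmin.
have [|r00 iso] := pencil_indec_chain AB hr0; last by exists r0.
by move=> r' rr' /asboolP /rmin; rewrite leqNgt rr'.
Qed.

Lemma pencil_indec_unit n (A B : 'M[F]_n) : pencil_indec A B -> A \in unitmx ->
  endo_indec (invmx A *m B).
Proof.
move=> AB UA P PP PB.
have [||||[P0 _]|[P1 _]] := AB P (A *m P *m invmx A); [..|by left|by right] => //.
- by rewrite !mulmxA mulmxKV // -[A *m P *m P]mulmxA PP.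
- by rewrite mulmxKV.
- by rewrite -!mulmxA PB !mulmxA mulmxV // mul1mx.
Qed.

Lemma pencil_iso_unit n (A B : 'M[F]_n) z : pencil_indec A B -> A \in unitmx ->
  (0 < n)%N -> invmx A *m B - z%:M \notin unitmx ->
  exists2 d, (0 < d)%N & pencil_iso A B (1%:M : 'M_d) (jordan_block d z).
Proof.
move=> AB UA n0 zev.
have [e [P [P' [d0 PP' P'P PH]]]] := endo_indec_jordan n0 (pencil_indec_unit AB UA) zev.
exists e => //; exists P, P', (P *m invmx A), (A *m P'); split; split => //.
- by rewrite -!mulmxA mulKmx.
- by rewrite mulmxA -[A *m _ *m P]mulmxA P'P mulmx1 mulmxV.
- by rewrite -mulmxA mulVmx // mulmx1 mul1mx.
- by rewrite -mulmxA PH.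
Qed.

Lemma pencil_indec_sym n m (A B : 'M[F]_(n, m)) : pencil_indec A B -> pencil_indec B A.
Proof. by move=> AB P Q PP QQ QB QA; apply: AB. Qed.

Lemma eigenvalue_exists n (H : 'M[F]_n) : (0 < n)%N -> exists z, H - z%:M \notin unitmx.
Proof.
case: n H => // n H _.
have [|z rz] := @closed_rootP F (char_poly H) _; first by rewrite size_char_poly.
exists z; move: rz; rewrite -eigenvalue_root_char => /eigenvalueP [v Hv v0].
apply: contra v0 => U; rewrite -[v](mulmxK U) mulmxBr Hv scalar_mxC.
by rewrite mul_scalar_mx subrr mul0mx.
Qed.

(** With no chain for the pencil or its transpose, some combination is injective and some transposed
    one too, so the pencil is square and [C] is invertible. What remains is the single endomorphism
    C^-1 A: if it is invertible the eigenvalue is finite, if nilpotent the eigenvalue is infinite.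
    The bound on n + m excludes the empty pencil, which satisfies [pencil_indec] vacuously. *)
Theorem pencil_classification n m (A B : 'M[F]_(n, m)) : pencil_indec A B -> (0 < n + m)%N ->
  [\/ exists2 r, (0 < r)%N & pencil_iso A B (pencilWA F r) (pencilWB F r),
      exists2 r, (0 < r)%N & pencil_iso A B (pencilWA F r)^T (pencilWB F r)^T,
      exists2 d, (0 < d)%N & exists z, pencil_iso A B (1%:M : 'M_d) (jordan_block d z) |
      exists2 d, (0 < d)%N & pencil_iso A B (jordan_block d 0) (1%:M : 'M_d)].
Proof.
move=> AB nm0.
have [ch|[k inj]] := pencil_chain_or_inj A B.
  by apply: Or41; apply: min_chain.
have [ch|[l injT]] := pencil_chain_or_inj A^T B^T.
  have [r r0 iso] := min_chain (pencil_indec_tr AB) ch.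
  by apply: Or42; exists r => //; rewrite -[A]trmxK -[B]trmxK; apply: pencil_iso_tr.
have r1 := inj_mxrank inj; have r2 := inj_mxrank injT.
have nm : n = m.
  have h1 := rank_leq_row (B - k%:R *: A); have h2 := rank_leq_row (B^T - l%:R *: A^T).
  by apply/eqP; move: h1 h2; rewrite r1 r2 => h1 h2; rewrite eqn_leq h1 h2.
subst m; have n0 : (0 < n)%N by move: nm0; rewrite addn_gt0 orbb.
have {r1 r2 injT inj l} UC : B - k%:R *: A \in unitmx by rewrite -row_free_unit /row_free r1.
set C := B - _ in UC; have BE : B = C + k%:R *: A by rewrite /C subrK.
(* The pairs (C, A) and (A, B) span the same pencil and have the same endomorphisms. *)
have Gi : endo_indec (invmx C *m A).
  apply: pencil_indec_unit UC => P Q PP QQ QC QA; apply: AB => //.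
  by rewrite BE mulmxDr mulmxDl QC -scalemxAr QA scalemxAl.
have [UG|[e Ge]] := endo_indec_unit_or_nilp Gi.
  have UA : A \in unitmx by rewrite -[A](mulKVmx UC) unitmx_mul UC.
  have [z zev] := eigenvalue_exists (invmx A *m B) n0.
  by apply: Or43; have [d d0 iso] := pencil_iso_unit AB UA n0 zev; exists d => //; exists z.
have nUA : A \notin unitmx.
  apply/negP => UA; have : (invmx C *m A) ^+ e \in unitmx.
    elim: e {Ge} => [|e IH]; first by rewrite expr0 unitmx1.
    by rewrite exprS unitmx_mul IH unitmx_mul unitmx_inv UC UA.
  rewrite Ge; case: (n) n0 => // n' _.
  by rewrite unitmxE det0 unitr0.
(* B = C (1 + k G) with G = C^-1 A nilpotent, and the geometric series inverts 1 + k G. *)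
have UB : B \in unitmx.
  have := subrX1 (- (k%:R *: (invmx C *m A))) e.
  have -> (c : F) (G : 'M[F]_n) i : (- (c *: G)) ^+ i = (- c) ^+ i *: G ^+ i.
    elim: i => [|i IH]; first by rewrite !expr0 scale1r.
    rewrite !exprS IH -scaleNr -[LHS]/(((- c) *: G) *m (_ *: _)).
    by rewrite -scalemxAl -scalemxAr scalerA.
  rewrite Ge scaler0 sub0r => H.
  have : C *m (1%:M + k%:R *: (invmx C *m A)) = B.
    by rewrite mulmxDr mulmx1 -scalemxAr mulKVmx // -BE.
  move=> <-; rewrite unitmx_mul UC /=; move/(congr1 -%R): H; rewrite opprK -mulNr opprB opprK => /esym.
  by move=> /mulmx1_unit [].
have [|d d0 [P [P' [Q [Q' [[PP' P'P QQ' Q'Q] [QB QA]]]]]]] :=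
    @pencil_iso_unit n B A 0 (pencil_indec_sym AB) UB n0.
  by rewrite raddf0 subr0 unitmx_mul unitmx_inv UB.
by apply: Or44; exists d => //; exists P, P', Q, Q'.
Qed.

Lemma pencilW_indec r : (0 < r)%N -> pencil_indec (pencilWA F r) (pencilWB F r).
Proof.
case: r => // r _ P Q PP QQ QA QB.
have [PE QE] := pencilW_End QA QB; set c := (P _ _) in PE QE.
have : c * c = c.
  have := congr1 (fun M : 'M_r.+1 => M ord0 ord0) PP.
  by rewrite PE -scalar_mxM !mxE eqxx.
rewrite PE QE => /eqP; rewrite -subr_eq0 -{3}[c]mulr1 -mulrBr mulf_eq0 subr_eq0.
by case/orP => /eqP ->; [left; rewrite !raddf0|right].
Qed.

Lemma pencilW_tr_indec r : (0 < r)%N -> pencil_indec (pencilWA F r)^T (pencilWB F r)^T.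
Proof. by move=> r0; apply/pencil_indec_tr/pencilW_indec. Qed.

Lemma pencil1J_indec n z : (0 < n)%N -> pencil_indec (1%:M : 'M[F]_n) (jordan_block n z).
Proof.
move=> n0 P Q PP QQ; rewrite mulmx1 mul1mx => -> PJ.
by have [->|->] := jordan_indec n0 PP PJ; [left|right].
Qed.

Lemma pencilJ1_indec n z : (0 < n)%N -> pencil_indec (jordan_block n z) (1%:M : 'M[F]_n).
Proof. by move=> n0; apply/pencil_indec_sym/pencil1J_indec. Qed.
End KroneckerTheorem.

(** * Roots of unity and polynomials in an endomorphism *)

Section RootOfUnity.
Variables (R : realType) (p : nat).
Hypothesis hp : (1 < p)%N.
Local Notation q := (qroot R p).
Local Notation h := (q - q^-1).

Lemma qroot_exp k : q ^+ k = cos (k%:R * (pi / p%:R)) +i* sin (k%:R * (pi / p%:R)).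
Proof.
elim: k => [|k IH]; first by rewrite expr0 mul0r cos0 sin0.
have -> : k.+1%:R * (pi / p%:R) = pi / p%:R + k%:R * (pi / p%:R) :> R by rewrite -natr1; ring.
by rewrite exprS IH /qroot cosD sinD; apply/eqP; rewrite eq_complex /= eqxx addrC eqxx.
Qed.

Lemma pn0 : p%:R != 0 :> R.
Proof. by rewrite pnatr_eq0 -lt0n ltnW. Qed.

Lemma qroot_p : q ^+ p = -1.
Proof.
rewrite qroot_exp mulrC divfK ?pn0 // cospi sinpi.
by apply/eqP; rewrite eq_complex /= oppr0 !eqxx.
Qed.

(** For these k the imaginary part sin (k pi / p) is positive. *)
Lemma qroot_Im k : (0 < k < p)%N -> q ^+ k <> 1 /\ q ^+ k <> -1.
Proof.
case/andP=> k0 kp; rewrite qroot_exp.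
have : 0 < sin (k%:R * (pi / p%:R) : R).
  apply: sin_gt0_pi; rewrite mulr_gt0 ?divr_gt0 ?pi_gt0 ?ltr0n //=; last exact: ltnW.
  rewrite mulrA ltr_pdivrMr ?ltr0n; last exact: ltnW.
  by rewrite mulrC ltr_pM2l ?pi_gt0 // ltr_nat.
by move=> s0; split=> /eqP; rewrite eq_complex /= ?oppr0 (gt_eqF s0) andbF.
Qed.

Lemma qroot_neq0 : q != 0.
Proof.
apply/eqP => q0; have := qroot_p; rewrite q0 expr0n gtn_eqF; last exact: ltnW.
by move/eqP; rewrite eq_sym oppr_eq0 oner_eq0.
Qed.

Lemma qroot_exp1 k : (q ^+ k == 1) = (2 * p %| k)%N.
Proof.
have q2p : q ^+ (2 * p) = 1 by rewrite mulnC exprM qroot_p sqrrN expr1n.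
rewrite {1}(divn_eq k (2 * p)) exprD [(_ %/ _ * _)%N]mulnC exprM q2p expr1n mul1r /dvdn.
have : (k %% (2 * p) < 2 * p)%N by rewrite ltn_mod; lia.
move: (k %% _)%N => r rp; case: (posnP r) => [->|r0]; first by rewrite expr0 !eqxx.
apply/eqP.
case: (ltngtP r p) => rp'; first by have [] := @qroot_Im r _; rewrite ?r0.
  rewrite -(subnK (ltnW rp')) exprD qroot_p mulrN1 => /eqP.
  rewrite eqr_oppLR => /eqP; have [] := @qroot_Im (r - p)%N _; last by [].
  by lia.
by rewrite rp' qroot_p => /eqP; rewrite -subr_eq0 -opprD oppr_eq0 -[1 + 1]/2%:R pnatr_eq0.
Qed.

Lemma qroot_2p : q ^+ (2 * p) = 1.
Proof. by apply/eqP; rewrite qroot_exp1. Qed.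

Lemma qnum_eq0 n : (qnum R p n == 0) = (p %| n)%N.
Proof.
have key k : (q ^+ k - q ^- k == 0) = (p %| k)%N.
  rewrite subr_eq0 -(inj_eq (mulIf (expf_neq0 k qroot_neq0))) mulVf ?expf_neq0 ?qroot_neq0 //.
  by rewrite -exprD qroot_exp1 addnn -mul2n dvdn_pmul2l.
rewrite /qnum mulf_eq0 key invr_eq0 -[q - _]/(q ^+ 1 - q ^- 1) key.
by rewrite [(_ %| 1)%N]gtnNdvd // orbF.
Qed.

Lemma qdiff_neq0 : h != 0.
Proof.
have := qnum_eq0 1; rewrite gtnNdvd // /qnum => /negbT.
by rewrite mulf_eq0 negb_or => /andP[].
Qed.

Lemma qnum0 : qnum R p 0 = 0.
Proof. by apply/eqP; rewrite qnum_eq0 dvdn0. Qed.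

Lemma qnum_neq0 n : (0 < n < p)%N -> qnum R p n != 0.
Proof. by case/andP=> n0 np; rewrite qnum_eq0 gtnNdvd. Qed.

End RootOfUnity.

(** * Polynomials in an endomorphism and Chinese remainders *)

Section PolyEval.
Variables (F : fieldType).

Definition pev (V : vectType F) (f : 'End(V)) (P : {poly F}) : 'End(V) :=
  \sum_(i < size P) P`_i *: iter i (fun g => (f \o g)%VF) \1%VF.

Lemma coprime_prod_dvdp (I : finType) (Q : I -> {poly F}) (x : {poly F}) :
  (forall i j, i != j -> coprimep (Q i) (Q j)) -> (forall i, Q i %| x) ->
  \prod_i Q i %| x.
Proof.
move=> cop dv; have : uniq (index_enum I) by apply: index_enum_uniq.
elim: (index_enum I) => [|i s IH] /=; first by rewrite big_nil dvd1p.
case/andP=> is_ us; rewrite big_cons Gauss_dvdp ?dv ?IH //.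
rewrite big_seq; apply: (big_ind (coprimep (Q i))).
- exact: coprimep1.
- by move=> a b; rewrite coprimepMr => -> ->.
by move=> j js; apply: cop; apply: contraNneq is_ => ->.
Qed.

(** Take e_i = u_i P_i, where P_i is the product of the other factors and u_i inverts it modulo Q_i.
    Evaluated at an endomorphism killed by the whole product, the e_i become orthogonal idempotents
    with sum 1. *)
Lemma poly_CRT (I : finType) (Q : I -> {poly F}) :
  (forall i j, i != j -> coprimep (Q i) (Q j)) ->
  exists e : I -> {poly F},
    [/\ forall i j, i != j -> Q j %| e i,
        forall i, \prod_j Q j %| Q i * e i & \prod_j Q j %| 1 - \sum_i e i].
Proof.
move=> cop; pose P i := \prod_(j | j != i) Q j.
have PQ i : coprimep (P i) (Q i).
  apply: (big_ind (fun x => coprimep x (Q i))).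
  - exact: coprime1p.
  - by move=> a b; rewrite coprimepMl => -> ->.
  by move=> j; apply: cop.
have /choice [u uP] i : exists u : {poly F} * {poly F}, u.1 * P i + u.2 * Q i = 1.
  by apply/Bezout_eq1_coprimepP.
have dP i j : i != j -> Q j %| (u i).1 * P i.
  by move=> ij; rewrite dvdp_mull // /P (bigD1 j) 1?eq_sym //= dvdp_mulr.
exists (fun i => (u i).1 * P i); split => //.
- by move=> i; rewrite [\prod_j _](bigD1 i) //= mulrCA dvdp_mull.
apply: coprime_prod_dvdp => // i; rewrite (bigD1 i) //= opprD addrA -(uP i).
rewrite [_ - _ * P i]addrC addKr dvdp_add ?dvdp_mull // dvdpNr.
apply: (big_ind (fun x => Q i %| x)); [exact: dvdp0|exact: dvdp_add|].
by move=> j ij; apply: dP.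
Qed.

Variables (V : vectType F) (f : 'End(V)).
Notation lpow := (fun i => iter i (fun g => (f \o g)%VF) \1%VF).

Lemma pev_wide n (P : {poly F}) : (size P <= n)%N ->
  pev f P = \sum_(i < n) P`_i *: lpow i.
Proof.
move=> sP; rewrite /pev (big_ord_widen _ (fun i => P`_i *: lpow i) sP) big_mkcond /=.
apply: eq_bigr => i _; case: ltnP => // sPi.
by rewrite nth_default // scale0r.
Qed.

Lemma pevD P Q : pev f (P + Q) = pev f P + pev f Q.
Proof.
pose n := maxn (size P) (size Q).
rewrite (@pev_wide n) ?size_polyD // (@pev_wide n P) ?leq_maxl // (@pev_wide n Q) ?leq_maxr //.
by rewrite -big_split; apply: eq_bigr => i _; rewrite coefD scalerDl.
Qed.

Lemma pevCM c P : pev f (c%:P * P) = c *: pev f P.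
Proof.
rewrite (@pev_wide (size P)); last by rewrite mul_polyC size_scale_leq.
by rewrite scaler_sumr; apply: eq_bigr => i _; rewrite coefCM scalerA.
Qed.

Lemma pevC c : pev f c%:P = c *: \1%VF.
Proof. by rewrite (@pev_wide 1) ?size_polyC_leq1 // big_ord1 coefC. Qed.

Lemma pevB P Q : pev f (P - Q) = pev f P - pev f Q.
Proof. by rewrite -[- Q]mulN1r -polyCN pevD pevCM scaleN1r. Qed.

Lemma pev0 : pev f 0 = 0.
Proof. by rewrite -polyC0 pevC scale0r. Qed.

Lemma pev1 : pev f 1 = \1%VF.
Proof. by rewrite -polyC1 pevC scale1r. Qed.

Lemma pev_sum I r (A : pred I) (P : I -> {poly F}) :
  pev f (\sum_(i <- r | A i) P i) = \sum_(i <- r | A i) pev f (P i).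
Proof. exact: (big_morph _ pevD pev0). Qed.

Lemma pevXM P : pev f ('X * P) = (f \o pev f P)%VF.
Proof.
have sc (g : 'I_(size P) -> 'End(V)) : (f \o \sum_i g i)%VF = \sum_i (f \o g i)%VF.
  apply/lfunP => v; rewrite comp_lfunE !sum_lfunE linear_sum.
  by apply: eq_bigr => i _; rewrite comp_lfunE.
rewrite (@pev_wide (size P).+1); last first.
  by rewrite (leq_trans (size_polyMleq _ _)) // size_polyX.
rewrite big_ord_recl coefXM eqxx scale0r add0r /pev sc; apply: eq_bigr => i _.
by rewrite coefXM /= comp_lfunZr.
Qed.

Lemma pevX : pev f 'X = f.
Proof. by rewrite -['X]mulr1 pevXM pev1 comp_lfun1r. Qed.

Lemma pevM P Q : pev f (P * Q) = (pev f P \o pev f Q)%VF.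
Proof.
elim/poly_ind: P Q => [|P c IH] Q; first by rewrite mul0r pev0 comp_lfun0l.
rewrite mulrDl pevD pevCM -mulrA IH pevXM pevD IH pevX pevC comp_lfunDl -comp_lfunZl comp_lfun1l.
by rewrite comp_lfunA.
Qed.

Lemma pev_stable (U : {vspace V}) P v : (f @: U <= U)%VS -> v \in U -> pev f P v \in U.
Proof.
move=> fU; elim/poly_ind: P v => [|P c IH] v vU; first by rewrite pev0 lfunE mem0v.
rewrite mulrC pevD pevXM pevC add_lfunE comp_lfunE scale_lfunE id_lfunE rpredD ?rpredZ //.
by apply: (subvP fU); rewrite memv_img ?IH.
Qed.

Lemma pev_dvd0 P Q : P %| Q -> pev f P = 0 -> pev f Q = 0.
Proof. by case/dvdpP => u ->; rewrite pevM => ->; rewrite comp_lfun0r. Qed.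

Lemma pev_dvdv0 P Q v : P %| Q -> pev f P v = 0 -> pev f Q v = 0.
Proof. by case/dvdpP => u ->; rewrite pevM comp_lfunE => ->; rewrite linear0. Qed.

Lemma lpow_pevXn n : lpow n = pev f 'X^n.
Proof.
elim: n => [|n IH]; first by rewrite expr0 pev1.
by rewrite exprS pevXM -IH.
Qed.

Lemma pev_XsubC c v : pev f ('X - c%:P) v = f v - c *: v.
Proof. by rewrite pevB pevX pevC add_lfunE opp_lfunE scale_lfunE id_lfunE. Qed.
End PolyEval.

Lemma pev_comm (F : fieldType) (V W : vectType F) (f : 'End(V)) (g : 'End(W)) (u : 'Hom(V, W)) P :
  (u \o f = g \o u)%VF -> (u \o pev f P = pev g P \o u)%VF.
Proof.
move=> H; elim/poly_ind: P => [|P c IH]; first by rewrite !pev0 comp_lfun0l comp_lfun0r.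
rewrite mulrC !pevD !pevXM !pevC comp_lfunDl comp_lfunDr comp_lfunA H -comp_lfunA IH comp_lfunA.
by rewrite -comp_lfunZl -comp_lfunZr comp_lfun1l comp_lfun1r.
Qed.

(** * Weight vectors and the Casimir element *)

Lemma lpowE (R : realType) (V : vectType R[i]) (f : 'End(V)) n v : lpow f n v = iter n f v.
Proof. by elim: n => [|n IH] /=; rewrite ?id_lfunE // comp_lfunE IH. Qed.

Section LfunLinear.
Variables (F : fieldType) (V W : vectType F) (f : 'Hom(V, W)).
Lemma lfunZ c v : f (c *: v) = c *: f v. Proof. exact: linearZ. Qed.
Lemma lfunD v w : f (v + w) = f v + f w. Proof. exact: linearD. Qed.
Lemma lfunB v w : f (v - w) = f v - f w. Proof. exact: linearB. Qed.
Lemma lfun0 : f 0 = 0. Proof. exact: linear0. Qed.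
Lemma lfun_sum I (r : seq I) (P : pred I) (v : I -> V) :
  f (\sum_(i <- r | P i) v i) = \sum_(i <- r | P i) f (v i).
Proof. exact: linear_sum. Qed.
End LfunLinear.

(** This is the shape of [casimirE], so that an operator passes through the Casimir expression in
    one rewrite. *)
Lemma lfun_lin3 (F : fieldType) (V W : vectType F) (f : 'Hom(V, W)) a b c x y z :
  f (z + c *: (a *: x + b *: y)) = f z + c *: (a *: f x + b *: f y).
Proof. by rewrite lfunD lfunZ lfunD !lfunZ. Qed.

Section Casimir.
Variables (R : realType) (p : nat).
Hypothesis hp : (1 < p)%N.
Local Notation q := (qroot R p).
Local Notation h := (q - q^-1).

Definition casimir (M : rep R) : 'End(M) :=
  (opF M \o opE M)%VF + h ^- 2 *: (q *: opK M + q^-1 *: (opK M)^-1%VF).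

(* The Casimir element acts by gam k on a vector of weight k killed by E. *)
Definition gam (k : R[i]) : R[i] := (q * k + (q * k)^-1) / h ^+ 2.

Definition wt (M : rep R) (k : R[i]) (v : M) := opK M v = k *: v.

(** The right side is the eigenvalue of [E, F] on weight k. It reconciles F E = C - [gam k] with E F
    = C - [gam (q ^- 2 * k)] on that weight space. *)
Lemma gam_step (k : R[i]) : k != 0 -> gam k - gam (q ^- 2 * k) = h^-1 * (k - k^-1).
Proof.
have x0 := qroot_neq0 R hp; have xd := qdiff_neq0 R hp.
have e1 : q * q - 1 = h * q by rewrite mulrBl mulVf.
have e : q * q - 1 != 0 by rewrite e1 mulf_neq0.
rewrite /gam; move: x0 e; clear; move: (q) => x x0 e k0; field.
by rewrite x0 e k0.
Qed.

Section OneModule.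
Variables (M : rep R).
Hypothesis HM : is_module p M.
Local Notation E := (opE M).
Local Notation F := (opF M).
Local Notation K := (opK M).
Implicit Types (v w : M) (k : R[i]).

Lemma opE_p v : iter p E v = 0.
Proof. by case: HM => [[E0 _] _ _ _ _]; rewrite -lpowE E0 lfunE. Qed.

Lemma opF_p v : iter p F v = 0.
Proof. by case: HM => [[_ F0] _ _ _ _]; rewrite -lpowE F0 lfunE. Qed.

Lemma opK_2p v : iter (2 * p) K v = v.
Proof. by case: HM => [_ K1 _ _ _]; rewrite -lpowE K1 id_lfunE. Qed.

Lemma opK_inj : lker K == 0%VS.
Proof.
apply/lker0P => v w vw; rewrite -[v]opK_2p -[w]opK_2p.
have -> : (2 * p = (2 * p).-1.+1)%N by lia.
by rewrite !iterSr vw.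
Qed.

Lemma opKK v : K (K^-1%VF v) = v.
Proof. by rewrite -comp_lfunE lker0_compfV ?opK_inj // id_lfunE. Qed.

Lemma opVK v : K^-1%VF (K v) = v.
Proof. by rewrite -comp_lfunE lker0_compVf ?opK_inj // id_lfunE. Qed.

Lemma opKE v : K (E v) = q ^+ 2 *: E (K v).
Proof.
case: HM => [_ _ H _ _]; have := congr1 (fun f : 'End(M) => f (K v)) H.
by rewrite scale_lfunE !comp_lfunE opVK.
Qed.

Lemma opKF v : K (F v) = q ^- 2 *: F (K v).
Proof.
case: HM => [_ _ _ H _]; have := congr1 (fun f : 'End(M) => f (K v)) H.
by rewrite scale_lfunE !comp_lfunE opVK.
Qed.

Lemma q2_neq0 : q ^+ 2 != 0. Proof. by rewrite expf_neq0 ?qroot_neq0. Qed.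

Lemma opVE v : K^-1%VF (E v) = q ^- 2 *: E (K^-1%VF v).
Proof.
have := opKE (K^-1%VF v); rewrite opKK => H.
apply: (can_inj opVK); rewrite opKK lfunZ H.
by rewrite scalerA mulVf ?scale1r // q2_neq0.
Qed.

Lemma opVF v : K^-1%VF (F v) = q ^+ 2 *: F (K^-1%VF v).
Proof.
have := opKF (K^-1%VF v); rewrite opKK => H.
apply: (can_inj opVK); rewrite opKK lfunZ H.
by rewrite scalerA mulfV ?scale1r // q2_neq0.
Qed.

Lemma opEF v : E (F v) = F (E v) + h^-1 *: (K v - K^-1%VF v).
Proof.
case: HM => [_ _ _ _ H]; have := congr1 (fun f : 'End(M) => f v) H.
rewrite scale_lfunE !add_lfunE !opp_lfunE !comp_lfunE => <-.
by rewrite addrC subrK.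
Qed.

Lemma casimirE v : casimir M v = F (E v) + h ^- 2 *: (q *: K v + q^-1 *: K^-1%VF v).
Proof. by rewrite /casimir add_lfunE scale_lfunE add_lfunE !scale_lfunE comp_lfunE. Qed.

(** These compare the coefficients of K and K^-1 when the Casimir element is moved past E (first
    two) and past F (last two): the change in the K part cancels the commutator of E and F. *)
Lemma casimir_coef (x : R[i]) (d := x - x^-1) : x != 0 -> d != 0 ->
  [/\ d ^- 2 * (x * x ^+ 2) = d^-1 * x ^+ 2 + d ^- 2 * x,
      d ^- 2 * (x^-1 * x ^- 2) = - (d^-1 * x ^- 2) + d ^- 2 * x^-1,
      d ^- 2 * (x * x ^- 2) = - d^-1 + d ^- 2 * x &
      d ^- 2 * (x^-1 * x ^+ 2) = d^-1 + d ^- 2 * x^-1].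
Proof.
move=> x0 d0; have e1 : x * x - 1 = d * x by rewrite /d mulrBl mulVf.
have e : x * x - 1 != 0 by rewrite e1 mulf_neq0.
by rewrite /d; split; field; rewrite x0.
Qed.

Lemma cas_E v : casimir M (E v) = E (casimir M v).
Proof.
rewrite !casimirE lfun_lin3 opEF -addrA; congr (_ + _).
rewrite !opKE !opVE; set A := E (K v); set B := E _.
have [c1 c2 _ _] := casimir_coef (qroot_neq0 R hp) (qdiff_neq0 R hp).
rewrite !scalerDr !scalerN !scalerA -scaleNr addrACA -!scalerDl.
by congr (_ *: _ + _ *: _); rewrite ?c1 // -c2 mulrA.
Qed.

Lemma cas_F v : casimir M (F v) = F (casimir M v).
Proof.
rewrite !casimirE lfun_lin3 opEF lfunD lfunZ lfunB -addrA; congr (_ + _).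
rewrite !opKF !opVF; set A := F (K v); set B := F _.
have [_ _ c1 c2] := casimir_coef (qroot_neq0 R hp) (qdiff_neq0 R hp).
rewrite !scalerDr !scalerN !scalerA -scaleNr addrACA -!scalerDl.
by congr (_ *: _ + _ *: _); rewrite -?mulrA ?c1 ?c2; ring.
Qed.

Lemma cas_K v : casimir M (K v) = K (casimir M v).
Proof.
rewrite !casimirE lfun_lin3 opVK opKK; congr (_ + _).
by rewrite opKF opKE lfunZ scalerA mulVf ?scale1r // q2_neq0.
Qed.

Lemma wt_V k v : k != 0 -> wt k v -> K^-1%VF v = k^-1 *: v.
Proof.
move=> k0 kv; apply: (can_inj opVK).
by rewrite opKK lfunZ kv scalerA mulVf // scale1r.
Qed.

Lemma wt_E k v : wt k v -> wt (q ^+ 2 * k) (E v).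
Proof. by rewrite /wt => kv; rewrite opKE kv lfunZ scalerA. Qed.

Lemma wt_F k v : wt k v -> wt (q ^- 2 * k) (F v).
Proof. by rewrite /wt => kv; rewrite opKF kv lfunZ scalerA. Qed.

Lemma wt_iterE n k v : wt k v -> wt (q ^+ (2 * n) * k) (iter n E v).
Proof.
move=> kv; elim: n => [|n IH]; first by rewrite muln0 expr0 mul1r.
by have := wt_E IH; rewrite mulrA -exprD mulnS.
Qed.

Lemma wt_iterF n k v : wt k v -> wt (q ^- (2 * n) * k) (iter n F v).
Proof.
move=> kv; elim: n => [|n IH]; first by rewrite muln0 expr0 invr1 mul1r.
by have := wt_F IH; rewrite mulrA -invfM -exprD mulnS.
Qed.

Lemma wtD k v w : wt k v -> wt k w -> wt k (v + w).
Proof. by rewrite /wt lfunD scalerDr => -> ->. Qed.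

Lemma wtZ k c v : wt k v -> wt k (c *: v).
Proof. by rewrite /wt lfunZ => ->; rewrite !scalerA mulrC. Qed.

Lemma wtB k v w : wt k v -> wt k w -> wt k (v - w).
Proof. by move=> kv kw; rewrite -scaleN1r; apply: wtD => //; apply: wtZ. Qed.

Lemma wt0 k : wt k (0 : M).
Proof. by rewrite /wt lfun0 scaler0. Qed.

Lemma wt_sum k I (r : seq I) (P : pred I) (v : I -> M) :
  (forall i, P i -> wt k (v i)) -> wt k (\sum_(i <- r | P i) v i).
Proof. by move=> kv; apply: big_ind => //; [exact: wt0|exact: wtD]. Qed.

Lemma wt_cas k v : wt k v -> wt k (casimir M v).
Proof. by rewrite /wt -cas_K => ->; rewrite lfunZ. Qed.

Lemma FE_wt k v : k != 0 -> wt k v -> F (E v) = casimir M v - gam k *: v.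
Proof.
move=> k0 kv; rewrite casimirE (wt_V k0 kv) kv !scalerA -scalerDl scalerA.
rewrite -addrA -scalerBl (_ : _ - _ = 0) ?scale0r ?addr0 //.
rewrite /gam [(q * k)^-1]invfM; ring.
Qed.

Lemma EF_wt k v : k != 0 -> wt k v -> E (F v) = casimir M v - gam (q ^- 2 * k) *: v.
Proof.
move=> k0 kv; rewrite opEF (FE_wt k0 kv) (wt_V k0 kv) kv -scalerBl scalerA.
rewrite -addrA -(gam_step k0); congr (_ + _).
by rewrite scalerBl addKr.
Qed.

Lemma iter_cas_E n v : iter n E (casimir M v) = casimir M (iter n E v).
Proof. by elim: n => //= n ->; rewrite cas_E. Qed.

Lemma iter_cas_F n v : iter n F (casimir M v) = casimir M (iter n F v).
Proof. by elim: n => //= n ->; rewrite cas_F. Qed.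

Lemma lfun_iterZ (f : 'End(M)) n a v : iter n f (a *: v) = a *: iter n f v.
Proof. by elim: n => //= n ->; rewrite lfunZ. Qed.

Lemma lfun_iterD (f : 'End(M)) n v w : iter n f (v + w) = iter n f v + iter n f w.
Proof. by elim: n => //= n ->; rewrite lfunD. Qed.

Lemma lfun_iterB (f : 'End(M)) n v w : iter n f (v - w) = iter n f v - iter n f w.
Proof. by elim: n => //= n ->; rewrite lfunB. Qed.

Lemma lfun_iter0 (f : 'End(M)) n : iter n f 0 = 0.
Proof. by elim: n => //= n ->; rewrite lfun0. Qed.

Lemma lfun_iter_out (f : 'End(M)) m n v : (m <= n)%N -> iter m f v = 0 -> iter n f v = 0.
Proof. by move=> mn f0; rewrite -(subnK mn) iterD f0 lfun_iter0. Qed.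

Lemma EFn k n v : k != 0 -> wt k v ->
  E (iter n.+1 F v) = iter n F (casimir M v - gam (q ^- (2 * n.+1) * k) *: v).
Proof.
move=> k0 kv; have kn := wt_iterF n kv.
rewrite /= (EF_wt _ kn) ?mulf_neq0 ?invr_neq0 ?expf_neq0 ?qroot_neq0 //.
by rewrite lfun_iterB lfun_iterZ iter_cas_F mulrA -invfM -exprD mulnS.
Qed.

Lemma FEn k n v : k != 0 -> wt k v ->
  F (iter n.+1 E v) = iter n E (casimir M v - gam (q ^+ (2 * n) * k) *: v).
Proof.
move=> k0 kv; have kn := wt_iterE n kv.
rewrite /= (FE_wt _ kn) ?mulf_neq0 ?expf_neq0 ?qroot_neq0 //.
by rewrite lfun_iterB lfun_iterZ iter_cas_E.
Qed.

Lemma FnEn k n v : k != 0 -> wt k v ->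
  iter n F (iter n E v) =
  pev (casimir M) (\prod_(j < n) ('X - (gam (q ^+ (2 * j) * k))%:P)) v.
Proof.
move=> k0 kv; elim: n v kv => [|n IH] v kv; first by rewrite big_ord0 pev1 id_lfunE.
rewrite [X in X = _]iterSr (FEn n k0 kv) IH; last by apply: wtB (wtZ _ kv); apply: wt_cas.
by rewrite big_ord_recr /= pevM comp_lfunE pev_XsubC.
Qed.
End OneModule.
End Casimir.

(** * Top weights, Casimir values and weight spaces *)

Section Blocks.
Variables (R : realType) (p : nat).
Hypothesis hp : (1 < p)%N.
Local Notation q := (qroot R p).
Local Notation h := (q - q^-1).
Local Notation gam := (@gam R p).
Local Notation br := (qnum R p).
Local Notation q0 := (qroot_neq0 R hp).

(* the weight a q^(s-1) of the first basis vector of modX p a s *)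
Definition topw (a : R[i]) (s : nat) : R[i] := a * q ^+ s / q.

Lemma sign_inv (a : R[i]) : a * a = 1 -> a^-1 = a.
Proof.
move=> aa; have a0 : a != 0 by apply: contra_eq_neq aa => ->; rewrite mul0r eq_sym oner_neq0.
by apply: (mulfI a0); rewrite aa mulfV.
Qed.

Lemma sign_neq0 (a : R[i]) : a * a = 1 -> a != 0.
Proof. by move=> aa; apply: contra_eq_neq aa => ->; rewrite mul0r eq_sym oner_neq0. Qed.

Lemma topw_neq0 a s : a * a = 1 -> topw a s != 0.
Proof. by move=> /sign_neq0 a0; rewrite !mulf_neq0 ?invr_neq0 ?expf_neq0 ?q0. Qed.

Lemma topw_exp a s k : a * q ^ (s%:Z - 1 - 2 * k%:Z) = q ^- (2 * k) * topw a s.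
Proof.
rewrite /topw !expfzDr ?q0 // exprN1 -[2 * k%:Z]PoszM -exprnN -exprnP.
by ring.
Qed.

Lemma qroot_sub s : (s <= p)%N -> q ^+ (p - s) = - q ^- s.
Proof.
move=> sp; have : q ^+ (p - s) * q ^+ s = -1 by rewrite -exprD subnK // qroot_p.
by move/(congr1 (fun x => x / q ^+ s)); rewrite mulfK ?expf_neq0 ?q0 // mulN1r.
Qed.

(** This comes from q^p = -1. Consequently F^s leads from the top weight of (a, s) to the top weight
    of (-a, p - s). *)
Lemma topw_flip a s : (s <= p)%N -> topw (- a) (p - s) = q ^- (2 * s) * topw a s.
Proof.
move=> sp; rewrite /topw qroot_sub // mulrNN mul2n -addnn exprD.
have := expf_neq0 s q0; have := q0; move: q (q ^+ s) => x X x0 X0.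
by field; rewrite x0 X0.
Qed.

Lemma signN (a : R[i]) : a * a = 1 -> - a * - a = 1. Proof. by rewrite mulrNN. Qed.

Lemma topw_flipK a s : (s <= p)%N -> topw (- - a) (p - (p - s)) = topw a s.
Proof. by move=> sp; rewrite opprK subKn. Qed.

Lemma gam_topw a s : a * a = 1 -> gam (topw a s) = a * (q ^+ s + q ^- s) / h ^+ 2.
Proof.
move=> aa; rewrite /gam /topw mulrCA mulfV ?q0 // mulr1 invfM (sign_inv aa).
by rewrite mulrDr.
Qed.

Lemma gam_flip a s : a * a = 1 -> (s <= p)%N -> gam (topw (- a) (p - s)) = gam (topw a s).
Proof.
move=> aa sp; rewrite !gam_topw ?signN // qroot_sub // invrN invrK.
by rewrite mulNr -mulrN opprD !opprK addrC.
Qed.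

(** By [EFn], E acts along the string F^n v through a difference of Casimir values; the
    factorisation identifies it with the structure constants of [modX]. *)
Lemma topcoef a s n : a * a = 1 -> (n <= s)%N ->
  gam (topw a s) - gam (q ^- (2 * n) * topw a s) = a * br n * br (s - n).
Proof.
move=> aa ns; rewrite gam_topw // /gam /topw.
have -> : (q * (q ^- (2 * n) * (a * q ^+ s / q)))^-1 = a * (q ^+ n * q ^+ n / q ^+ s).
  rewrite -{2}(sign_inv aa) mul2n -addnn exprD.
  have := expf_neq0 s q0; have := expf_neq0 n q0; have := q0; have := sign_neq0 aa.
  move: a q (q ^+ n) (q ^+ s) {aa} => a x X Y a0 x0 X0 Y0.
  by field; rewrite a0 x0 X0 Y0.
rewrite /qnum -{1 2 3 4}(subnK ns) mul2n -addnn !exprD.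
have := expf_neq0 (s - n) q0; have := expf_neq0 n q0; have := q0; have := qdiff_neq0 R hp.
move: (q) (q ^+ n) (q ^+ (s - n)) => x X Y d0 x0 X0 Y0.
have e1 : x * x - 1 = (x - x^-1) * x by rewrite mulrBl mulVf.
have e : x * x - 1 != 0 by rewrite e1 mulf_neq0.
by field; rewrite x0 e X0 Y0.
Qed.

Lemma topcoef_neq0 a s n : a * a = 1 -> (0 < n < s)%N -> (s <= p)%N ->
  gam (q ^- (2 * n) * topw a s) != gam (topw a s).
Proof.
move=> aa /andP[n0 ns] sp; rewrite eq_sym -subr_eq0 topcoef //; last exact: ltnW.
by apply: mulf_neq0; [apply: mulf_neq0; first exact: sign_neq0|]; apply: qnum_neq0; lia.
Qed.

(** The difference factors as (x - y)(xy - 1). This two-to-one behaviour is why two top weights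
    share each Casimir value. *)
Lemma inv_sum_eq (x y : R[i]) : x != 0 -> y != 0 -> x + x^-1 = y + y^-1 -> x = y \/ x * y = 1.
Proof.
move=> x0 y0 H; have : (x - y) * (x * y - 1) = 0.
  have -> : (x - y) * (x * y - 1) = x * y * ((x + x^-1) - (y + y^-1)) by field; rewrite x0 y0.
  by rewrite H subrr mulr0.
by move/eqP; rewrite mulf_eq0 !subr_eq0 => /orP[/eqP|/eqP]; [left|right].
Qed.

Lemma gam_inj a s k : a * a = 1 -> (s <= p)%N -> k != 0 -> gam k = gam (topw a s) ->
  k = topw a s \/ k = topw (- a) (p - s).
Proof.
move=> aa sp k0; rewrite gam_topw // /gam => /(mulIf _) H.
have {H} : q * k + (q * k)^-1 = a * (q ^+ s + q ^- s).
  by apply: H; rewrite invr_neq0 // expf_neq0 // qdiff_neq0.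
rewrite (topw_flip _ sp) mulrDr -{2}(sign_inv aa) -invfM /topw mul2n -addnn exprD.
have := expf_neq0 s q0; have := q0; have := sign_neq0 aa; have := sign_inv aa.
move: (q) (q ^+ s) => x Y ai a0 x0 Y0 H.
have [H'|H'] := inv_sum_eq (mulf_neq0 x0 k0) (mulf_neq0 a0 Y0) H; [left|right].
  by rewrite -H'; field.
have : k = x * k * (a * Y) / (x * (a * Y)) by field; rewrite x0 a0 Y0.
by rewrite H' -{2}ai => ->; field; rewrite x0 a0 Y0.
Qed.

Section WeightDecomposition.

(** X^(2p) - 1 has the distinct roots q^m, and Chinese remainders give the weight projections as
    polynomials in K. The polynomials are chosen before the module, so the projections commute with
    every homomorphism. *)
Lemma wt_polys : exists e : 'I_(2 * p) -> {poly R[i]},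
  forall M : rep R, is_module p M ->
    [/\ forall (m : 'I_(2 * p)) v, wt (q ^+ m) (pev (opK M) (e m) v),
        forall v : M, v = \sum_m pev (opK M) (e m) v &
        forall (m n : 'I_(2 * p)) v, wt (q ^+ m) v -> pev (opK M) (e n) v = (n == m)%:R *: v].
Proof.
have prim : (2 * p).-primitive_root q.
  apply/andP; split; first by lia.
  apply/forallP => i; rewrite unity_rootE qroot_exp1 //; apply/eqP.
  have := ltn_ord i; rewrite leq_eqVlt => /orP[/eqP->|ip]; first by rewrite dvdnn eqxx.
  by rewrite gtnNdvd // (ltn_eqF ip).
have inj (i j : 'I_(2 * p)) : i != j -> q ^+ i != q ^+ j.
  by move=> ij; rewrite (eq_prim_root_expr prim) !modn_small // val_eqE.
have [|e [e1 e2 e3]] := @poly_CRT _ _ (fun m : 'I_(2 * p) => 'X - (q ^+ m)%:P).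
  by move=> i j ij; apply: coprimep_XsubC2; rewrite subr_eq0 inj // eq_sym.
exists e => M HM.
have ann P : \prod_(j < 2 * p) ('X - (q ^+ j)%:P) %| P -> pev (opK M) P = 0.
  move/pev_dvd0; apply; have := factor_Xn_sub_1 prim; rewrite big_mkord => ->.
  rewrite pevB -lpow_pevXn pev1; apply/lfunP => v.
  by rewrite add_lfunE opp_lfunE id_lfunE -/(lpow _ _) lpowE (opK_2p HM) subrr lfunE.
have dec v : v = \sum_m pev (opK M) (e m) v.
  have := congr1 (fun f : 'End(M) => f v) (ann _ e3).
  rewrite pevB pev1 pev_sum add_lfunE opp_lfunE id_lfunE sum_lfunE lfunE.
  by move/eqP; rewrite subr_eq0 => /eqP.
split => //.
  move=> m v; apply/eqP; rewrite -subr_eq0 -pev_XsubC -comp_lfunE -pevM.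
  by rewrite ann // lfunE.
have off (m n : 'I_(2 * p)) v : wt (q ^+ m) v -> n != m -> pev (opK M) (e n) v = 0.
  move=> vm nm; apply: (pev_dvdv0 (e1 _ _ nm)).
  by rewrite pev_XsubC vm subrr.
move=> m n v vm; case: eqP => [->|/eqP nm]; last by rewrite scale0r (off _ _ _ vm).
rewrite scale1r [RHS](dec v) (bigD1 m) //= big1 ?addr0 // => j jm.
exact: off vm jm.
Qed.

Variables (M : rep R).
Hypothesis HM : is_module p M.

Lemma wt_span (P : M -> Prop) : P 0 -> (forall v w, P v -> P w -> P (v + w)) ->
  (forall k v, k != 0 -> wt k v -> P v) -> forall v, P v.
Proof.
move=> P0 PD Pw v; have [e /(_ M HM) [ew edec _]] := wt_polys.
rewrite [v]edec; apply: big_ind => // m _.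
by apply: Pw (ew m v); rewrite expf_neq0 ?q0.
Qed.

Lemma submoduleE (U : {vspace M}) : is_submodule U ->
  [/\ forall v, v \in U -> opE M v \in U, forall v, v \in U -> opF M v \in U &
      forall v, v \in U -> opK M v \in U].
Proof.
by case=> UE UF UK; split=> v vU; [apply: (subvP UE)|apply: (subvP UF)|apply: (subvP UK)];
  rewrite memv_img.
Qed.

Lemma submodule_iter (U : {vspace M}) n v : is_submodule U -> v \in U ->
  iter n (opE M) v \in U /\ iter n (opF M) v \in U.
Proof.
by move=> /submoduleE [UE UF _] vU; elim: n => [|n [IE IF]] //=; split; [apply: UE|apply: UF].
Qed.

(** The last nonzero E^n u is killed by E. The kernel of E is stable under K, so the weight
    components of that vector are killed as well, and one of them is nonzero. *)
Lemma submodule_singular (U : {vspace M}) : is_submodule U -> U != 0%VS ->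
  exists k v, [/\ v \in U, v != 0, opE M v = 0, k != 0 & wt k v].
Proof.
move=> subU; rewrite -vpick0; set u := vpick U => u0; have uU : u \in U by apply: memv_pick.
have ex : exists n, iter n (opE M) u == 0 by exists p; rewrite (opE_p HM).
case: (ex_minnP ex) => -[|n] /eqP En nmin; first by rewrite /= in En; rewrite En eqxx in u0.
set v := iter n (opE M) u.
have v0 : v != 0 by apply/negP => /nmin; rewrite ltnn.
have vU : v \in U by case: (submodule_iter n subU uU).
have [e /(_ M HM) [ew edec _]] := wt_polys.
have [m vm] : exists m, pev (opK M) (e m) v != 0.
  apply: contrapT => ne; case/negP: v0; rewrite [v]edec big1 // => m _.
  by apply: contra_notP ne => /eqP ?; exists m.
exists (q ^+ m), (pev (opK M) (e m) v); split => //.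
- by apply: pev_stable => //; case: subU.
- apply/eqP; rewrite -memv_ker; apply: pev_stable; last by rewrite memv_ker; apply/eqP.
  apply/subvP => x /memv_imgP [w]; rewrite memv_ker => /eqP Ew ->.
  rewrite memv_ker -[_ == 0](inj_eq (scalerI (expf_neq0 2 q0))) scaler0.
  by rewrite -(opKE hp HM) Ew lfun0.
- by rewrite expf_neq0 ?q0.
Qed.

End WeightDecomposition.
End Blocks.

(** * Weight vectors in a block where N^2 = 0 *)

Section BlockModules.
Variables (R : realType) (p : nat).
Hypothesis hp : (1 < p)%N.
Local Notation q := (qroot R p).
Local Notation gam := (@gam R p).
Local Notation br := (qnum R p).
Local Notation q0 := (qroot_neq0 R hp).
Local Notation topw := (@topw R p).

Definition nilc (b : R[i]) (M : rep R) : 'End(M) := casimir p M - b *: \1%VF.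

Lemma nilcE b (M : rep R) v : nilc b M v = casimir p M v - b *: v.
Proof. by rewrite /nilc add_lfunE opp_lfunE scale_lfunE id_lfunE. Qed.

Section OneBlock.
Variables (M : rep R) (b : R[i]).
Hypothesis HM : is_module p M.
Hypothesis HN : forall v : M, nilc b M (nilc b M v) = 0.
Local Notation E := (opE M).
Local Notation F := (opF M).
Local Notation N := (nilc b M).
Implicit Types (v w u : M) (k : R[i]).

Lemma nilc_E v : N (E v) = E (N v).
Proof. by rewrite !nilcE cas_E // lfunB lfunZ. Qed.
Lemma nilc_F v : N (F v) = F (N v).
Proof. by rewrite !nilcE cas_F // lfunB lfunZ. Qed.
Lemma nilc_K v : N (opK M v) = opK M (N v).
Proof. by rewrite !nilcE cas_K // lfunB lfunZ. Qed.
Lemma nilc_iterF n v : N (iter n F v) = iter n F (N v).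
Proof. by elim: n => //= n <-; rewrite nilc_F. Qed.
Lemma nilc_iterE n v : N (iter n E v) = iter n E (N v).
Proof. by elim: n => //= n <-; rewrite nilc_E. Qed.
Lemma nilc_wt k v : wt k v -> wt k (N v).
Proof. by move=> kv; rewrite nilcE; apply: wtB (wtZ _ kv); apply: wt_cas. Qed.

Lemma cas_nilc c v : casimir p M v - c *: v = N v + (b - c) *: v.
Proof. by rewrite nilcE scalerBl addrA subrK. Qed.

(** On the block, C - c equals (b - c) + N with N^2 = 0, whose inverse is (b - c)^-1 - (b - c)^-2
    N. *)
Lemma nilc_invert c k v : c != b -> wt k v ->
  exists2 u, wt k u & casimir p M u - c *: u = v.
Proof.
move=> cb kv; have d0 : b - c != 0 by rewrite subr_eq0 eq_sym.
exists ((b - c)^-1 *: v - (b - c) ^- 2 *: N v).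
  by apply: wtB; apply: wtZ => //; apply: nilc_wt.
rewrite cas_nilc lfunB !lfunZ HN scaler0 subr0 scalerBr !scalerA mulfV // scale1r.
by rewrite expr2 invfM mulrA mulfV // mul1r addrC subrK.
Qed.

(** E^n F^n is a product of operators C - c on the weight space, each invertible when c differs from
    [b]. Writing v in this form lets additional powers of E reach E^p = 0. *)
Lemma lift_EF n k v : k != 0 -> wt k v ->
  (forall j, (j < n)%N -> gam (q ^- (2 * j.+1) * k) != b) ->
  exists2 u, wt k u & v = iter n E (iter n F u).
Proof.
move=> k0; elim: n v => [|n IH] v kv gb; first by exists v.
have [u ku vE] := IH v kv (fun j jn => gb j (leqW jn)).
have [w kw wE] := nilc_invert (gb n (ltnSn _)) ku.
exists w => //; rewrite iterSr (EFn hp HM n k0 kw) wE //.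
Qed.

Lemma lift_FE n k v : k != 0 -> wt k v ->
  (forall j, (j < n)%N -> gam (q ^+ (2 * j) * k) != b) ->
  exists2 u, wt k u & v = iter n F (iter n E u).
Proof.
move=> k0; elim: n v => [|n IH] v kv gb; first by exists v.
have [u ku vE] := IH v kv (fun j jn => gb j (leqW jn)).
have [w kw wE] := nilc_invert (gb n (ltnSn _)) ku.
exists w => //; rewrite iterSr (FEn hp HM n k0 kw) wE //.
Qed.

Variables (a : R[i]) (s : nat).
Hypothesis aa : a * a = 1.
Hypothesis sp : (s <= p)%N.
Hypothesis hb : b = gam (topw a s).

(** E v = 0 makes v an eigenvector of N with eigenvalue [gam k - b], and N^2 = 0 forces this
    eigenvalue to vanish. *)
Lemma singular_wt k v : k != 0 -> wt k v -> v != 0 -> E v = 0 ->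
  k = topw a s \/ k = topw (- a) (p - s).
Proof.
move=> k0 kv v0 Ev; apply: (gam_inj hp) => //; rewrite -hb.
have cv : casimir p M v = gam k *: v.
  by apply/eqP; rewrite -subr_eq0 -(FE_wt hp HM k0 kv) Ev lfun0.
have Nv : N v = (gam k - b) *: v by rewrite nilcE cv scalerBl.
have := HN v; rewrite Nv lfunZ Nv scalerA => /eqP.
by rewrite scaler_eq0 (negPf v0) orbF mulf_eq0 orbb subr_eq0 => /eqP.
Qed.

Lemma string_E n v : wt (topw a s) v -> (n < s)%N ->
  E (iter n.+1 F v) = (a * br n.+1 * br (s - n.+1)) *: iter n F v + iter n F (N v).
Proof.
move=> kv ns; rewrite (EFn hp HM n (topw_neq0 hp s aa) kv).
rewrite cas_nilc hb (topcoef hp aa) //.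
by rewrite lfun_iterD lfun_iterZ addrC.
Qed.

(** v = E^(s-1) F^(s-1) u, and p - s + 1 further powers of E make E^p. *)
Lemma top_E_out v : (0 < s)%N -> wt (topw a s) v -> iter (p - s).+1 E v = 0.
Proof.
move=> s0 kv.
have [|u ku ->] := @lift_EF s.-1 _ _ (topw_neq0 hp s aa) kv.
  by move=> j js; rewrite hb (topcoef_neq0 hp aa) //; lia.
rewrite -iterD (_ : (_ + _ = p)%N); last by lia.
exact: opE_p.
Qed.

(** A weight vector of non-critical weight is v = F E u for some u of the same weight. Repeating
    this with E u either meets one of the two critical weights, putting v in [U], or writes v as F^n
    w for ever larger n, and F^p = 0. *)
Lemma block_gen (U : {vspace M}) : is_submodule U ->
  (forall v, wt (topw a s) v -> v \in U) ->
  (forall v, wt (topw (- a) (p - s)) v -> v \in U) -> U = fullv.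
Proof.
move=> subU U1 U2; apply/vspaceP => v; rewrite memvf.
have [UE UF _] := submoduleE subU.
pose Q v := v \in U; apply: (@wt_span _ _ hp _ HM Q); rewrite /Q ?mem0v //.
  by move=> x y; apply: memvD.
move=> k {}v k0 kv.
suff : forall n k v, k != 0 -> wt k v -> v \in U \/ exists u, v = iter n F u.
  case/(_ p k v k0 kv) => // -[u ->]; rewrite (opF_p HM) mem0v //.
elim=> [|n IH] {k k0 kv}k {}v k0 kv; first by right; exists v.
have [gk|gk] := eqVneq (gam k) b.
  by left; have [e|e] := gam_inj hp aa sp k0 (etrans gk hb); [apply: U1|apply: U2]; rewrite -e.
have [u ku uE] := nilc_invert gk kv; rewrite -uE -(FE_wt hp HM k0 ku).
have [|EU|[w ->]] := IH _ _ _ (wt_E hp HM ku).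
- by rewrite mulf_neq0 ?expf_neq0 ?q0.
- by left; apply: UF.
by right; exists w.
Qed.

Lemma block_sub_meet (U : {vspace M}) : is_submodule U -> U != 0%VS ->
  exists v, [/\ v \in U, v != 0, E v = 0 & wt (topw a s) v \/ wt (topw (- a) (p - s)) v].
Proof.
move=> subU U0; have [k [v [vU v0 Ev k0 kv]]] := submodule_singular hp HM subU U0.
exists v; split => //.
by have [e|e] := singular_wt k0 kv v0 Ev; [left|right]; rewrite -e.
Qed.

End OneBlock.

Section ProjectiveData.
Variables (M : rep R) (b : R[i]).
Hypothesis HM : is_module p M.
Hypothesis HN : forall v : M, nilc b M (nilc b M v) = 0.
Variables (a : R[i]) (s : nat).
Hypothesis aa : a * a = 1.
Hypothesis s0 : (0 < s)%N.
Hypothesis sp : (s < p)%N.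
Hypothesis hb : b = gam (topw a s).
Local Notation E := (opE M).
Local Notation F := (opF M).
Local Notation N := (nilc b M).
Implicit Types (v w u : M) (k : R[i]).

Let sp' : (s <= p)%N := ltnW sp.
Let hb' : b = gam (topw (- a) (p - s)).
Proof. by rewrite (gam_flip hp). Qed.

Lemma top_down v : wt (topw a s) v -> wt (topw (- a) (p - s)) (iter s F v).
Proof. by move=> kv; rewrite (topw_flip hp) //; apply: wt_iterF. Qed.

(** N v = F E v, and E v = F^(p-s-1) E^(p-s-1) u because no critical weight intervenes. So F^s N v
    contains the factor F^p. *)
Lemma top_FN v : wt (topw a s) v -> iter s F (N v) = 0.
Proof.
move=> kv; have top0 := topw_neq0 hp s aa.
have Nv : N v = F (E v) by rewrite (FE_wt hp HM top0 kv) -hb nilcE.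
have k20 : q ^+ 2 * topw a s != 0 by rewrite mulf_neq0 ?expf_neq0 ?q0.
have [j js|u ku uE] := lift_FE HM HN (n := (p - s).-1) k20 (wt_E hp HM kv).
  (* By q^(2p) = 1, the weights met above [topw a s] are those of the string below
     [topw (- a) (p - s)], read from its end. *)
  rewrite hb'; have <- : q ^- (2 * (p - s - j.+1)) * topw (- a) (p - s) = q ^+ (2 * j) * (q ^+ 2 * topw a s).
    rewrite (topw_flip hp) // mulrA -invfM -exprD mulrA -exprD; congr (_ * _).
    apply: (mulIf (expf_neq0 (2 * (p - s - j.+1) + 2 * s) q0)).
    rewrite mulVf ?expf_neq0 ?q0 // -exprD.
    by rewrite (_ : (_ + _ = 2 * p)%N) ?qroot_2p //; lia.
  by rewrite topcoef_neq0 ?signN //; lia.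
rewrite Nv -iterSr uE -iterD (_ : (_ + _ = p)%N); last by lia.
exact: opF_p.
Qed.

(** With v = E^(s-1) F^(s-1) u, the vanishing of [s - s] gives E F^s u = F^(s-1) N u and so N v =
    E^s F^s u. Now F^s u has the other top weight, hence is E^(p-s-1) F^(p-s-1) w, and E N v
    contains the factor E^p. *)
Lemma top_EN v : wt (topw a s) v -> E (N v) = 0.
Proof.
move=> kv; have top0 := topw_neq0 hp s aa.
have [|u ku vE] := @lift_EF _ _ HM HN s.-1 _ _ top0 kv.
  by move=> j js; rewrite hb (topcoef_neq0 hp aa) //; lia.
have -> : N v = iter s E (iter s F u).
  have s1 : s = s.-1.+1 by rewrite prednK.
  have ss : (s.-1 < s)%N by lia.
  rewrite {1 2}s1 iterSr (string_E HM aa hb ku ss) -s1 subnn qnum0 // mulr0 scale0r add0r.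
  by rewrite vE (nilc_iterE b HM) (nilc_iterF b HM).
rewrite -iterS; have kd := top_down ku.
have [|w kw ->] := @lift_EF _ _ HM HN (p - s).-1 _ _ (topw_neq0 hp (p - s) (signN aa)) kd.
  by move=> j js; rewrite hb' topcoef_neq0 ?signN //; lia.
rewrite -iterD (_ : (_ + _ = p)%N); last by lia.
exact: opE_p.
Qed.

(** This finds the head x of the string that ends in E v, the x_0 of [modP]. The head must be a
    multiple of E^(p-s) v, and then F^(p-s) x = F E v = N v. *)
Lemma topE_source_iter v : wt (topw a s) v ->
  exists2 c, c != 0 & let x := c *: iter (p - s) E v in
  [/\ wt (topw (- a) (p - s)) x, E x = 0, iter (p - s).-1 F x = E v & iter (p - s) F x = N v].
Proof.
move=> kv; have top0 := topw_neq0 hp s aa.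
have Nv : N v = F (E v) by rewrite (FE_wt hp HM top0 kv) -hb nilcE.
pose n := (p - s).-1.
have k20 : q ^+ 2 * topw a s != 0 by rewrite mulf_neq0 ?expf_neq0 ?q0.
have flip j : (j < n)%N -> q ^+ (2 * j) * (q ^+ 2 * topw a s) = q ^- (2 * (p - s - j.+1)) * topw (- a) (p - s).
  move=> jn; rewrite (topw_flip hp) // [RHS]mulrA -invfM -exprD mulrA -exprD; congr (_ * _).
  apply: (mulIf (expf_neq0 (2 * (p - s - j.+1) + 2 * s) q0)).
  rewrite mulVf ?expf_neq0 ?q0 // -exprD.
  by rewrite (_ : (_ + _ = 2 * p)%N) ?qroot_2p //; lia.
(* N kills E v by [top_EN], so the Casimir element acts there by [b] and F^n E^n by this product,
   whose factors are nonzero. *)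
pose c := \prod_(j < n) (b - gam (q ^+ (2 * j) * (q ^+ 2 * topw a s))).
have c0 : c != 0.
  apply/prodf_neq0 => j _; rewrite subr_eq0 eq_sym flip // hb'.
  by rewrite topcoef_neq0 ?signN //; have := ltn_ord j; rewrite /n; lia.
have FnE : iter n F (iter n E (E v)) = c *: E v.
  rewrite (FnEn hp HM n k20 (wt_E hp HM kv)) /c.
  elim: (n) => [|m IH]; first by rewrite !big_ord0 pev1 id_lfunE scale1r.
  rewrite !big_ord_recr /= pevM comp_lfunE pev_XsubC (cas_nilc b) (nilc_E b HM) (top_EN kv) add0r.
  by rewrite lfunZ IH scalerA mulrC.
have pn : (p - s)%N = n.+1 by rewrite /n; lia.
exists c^-1; rewrite /= ?invr_neq0 //.
have -> : iter (p - s) E v = iter n.+1 E v by rewrite pn.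
have wx : wt (topw (- a) (p - s)) (iter n.+1 E v).
  have := wt_iterE hp HM n.+1 kv; rewrite (topw_flip hp) //.
  congr (wt (_ * _) _); apply: (mulIf (expf_neq0 (2 * s) q0)).
  rewrite mulVf ?expf_neq0 ?q0 // -exprD.
  by rewrite (_ : (_ + _ = 2 * p)%N) ?qroot_2p //; rewrite /n; lia.
have e1 : iter n F (c^-1 *: iter n.+1 E v) = E v.
  by rewrite lfun_iterZ iterSr FnE scalerA mulVf // scale1r.
split => //.
- exact: wtZ.
- have := top_E_out HM HN aa sp' hb s0 kv.
  rewrite (_ : (p - s).+1 = n.+2)%N; last by rewrite /n; lia.
  by rewrite iterS lfunZ => ->; rewrite scaler0.
- by rewrite (_ : (p - s = n.+1)%N) ?iterS ?e1 // /n; lia.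
Qed.

Lemma topE_source v : wt (topw a s) v ->
  exists x, [/\ wt (topw (- a) (p - s)) x, E x = 0, iter (p - s).-1 F x = E v & iter (p - s) F x = N v].
Proof. by case/topE_source_iter => c _; exists (c *: iter (p - s) E v). Qed.
End ProjectiveData.
End BlockModules.

(** * Modules given by bases *)

Lemma lfun_commE (F : fieldType) (V : vectType F) (e f : 'End(V)) v (x y : F) :
  e (f v) = x *: v -> f (e v) = y *: v -> e (f v) - f (e v) = (x - y) *: v.
Proof. by move=> -> ->; rewrite scalerBl. Qed.

Section BasisModules.
Variables (R : realType) (p : nat).
Hypothesis hp : (1 < p)%N.
Local Notation q := (qroot R p).
Local Notation h := (q - q^-1).
Local Notation br := (qnum R p).
Local Notation q0 := (qroot_neq0 R hp).
Local Notation topw := (@topw R p).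

Section Basis.
Variable I : finType.
Local Notation W := {ffun I -> R[i]^o}.

Definition dl (i : I) : W := [ffun j => (j == i)%:R].

Lemma bvec_ord n (lab : 'I_n -> I) (i : 'I_n) : bvec R lab i = dl (lab i).
Proof. by rewrite /bvec valK. Qed.

Lemma bvec_out n (lab : 'I_n -> I) k : (n <= k)%N -> bvec R lab k = 0.
Proof. by move=> nk; rewrite /bvec insubN // -leqNgt. Qed.

Lemma bvecP n (lab : 'I_n -> I) k (P : W -> Prop) :
  P 0 -> (forall i : 'I_n, i = k :> nat -> P (dl (lab i))) -> P (bvec R lab k).
Proof.
move=> P0 Pi; case: (ltnP k n) => kn; last by rewrite bvec_out.
by have := Pi (Ordinal kn) erefl; rewrite -bvec_ord.
Qed.

Definition lmap_fun (V : vectType R[i]) (f : I -> V) (v : W) : V := \sum_i (v i : R[i]) *: f i.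

Lemma lmap_is_linear (V : vectType R[i]) (f : I -> V) : linear (lmap_fun f).
Proof.
move=> c v w; rewrite /lmap_fun scaler_sumr -big_split; apply: eq_bigr => i _.
by rewrite !ffunE scalerDl -scalerA.
Qed.
HB.instance Definition _ (V : vectType R[i]) (f : I -> V) :=
  GRing.isLinear.Build R[i] W V *:%R (lmap_fun f) (lmap_is_linear f).

Definition lmap (V : vectType R[i]) (f : I -> V) : 'Hom(W, V) := linfun (lmap_fun f).

Lemma lmap_dl (V : vectType R[i]) (f : I -> V) i : lmap f (dl i) = f i.
Proof.
rewrite lfunE /= /lmap_fun (bigD1 i) //= ffunE eqxx scale1r big1 ?addr0 // => j ji.
by rewrite ffunE (negPf ji) scale0r.
Qed.

Lemma lin_extE (f : I -> W) : lin_ext f = lmap f. Proof. by []. Qed.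

Lemma lin_ext_dl (f : I -> W) i : lin_ext f (dl i) = f i.
Proof. by rewrite lin_extE lmap_dl. Qed.

Lemma dl_decomp (v : W) : v = \sum_i (v i : R[i]) *: dl i.
Proof.
apply/ffunP => j; rewrite sum_ffunE (bigD1 j) //= big1 ?addr0 => [|i ij].
  by rewrite !ffunE eqxx; apply: esym; apply: mulr1.
by rewrite !ffunE eq_sym (negPf ij) scaler0.
Qed.

Lemma dl_ext (V : vectType R[i]) (f g : 'Hom(W, V)) : (forall i, f (dl i) = g (dl i)) -> f = g.
Proof.
move=> fg; apply/lfunP => v; rewrite [v]dl_decomp !lfun_sum.
by apply: eq_bigr => i _; rewrite !lfunZ fg.
Qed.

Lemma lmap_bvec (V : vectType R[i]) (f : I -> V) n (lab : 'I_n -> I) k :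
  lmap f (bvec R lab k) = if insub k is Some i then f (lab i) else 0.
Proof.
case: insubP => [i _ <-|kn]; first by rewrite bvec_ord lmap_dl.
by rewrite bvec_out ?lfun0 // leqNgt.
Qed.

Lemma lmap_hom (e f k : I -> W) (N : rep R) (g : I -> N) :
  (forall i, lmap g (e i) = opE N (g i)) -> (forall i, lmap g (f i) = opF N (g i)) ->
  (forall i, lmap g (k i) = opK N (g i)) ->
  is_hom (M := Rep (lin_ext e) (lin_ext f) (lin_ext k)) (lmap g).
Proof.
move=> He Hf Hk; split; apply: dl_ext => i; rewrite !comp_lfunE lin_ext_dl lmap_dl;
  [exact: He|exact: Hf|exact: Hk].
Qed.

Definition below (g : I -> nat) n (v : W) := forall j, (n <= g j)%N -> v j = 0.

Lemma below0 g n : below g n 0. Proof. by move=> j _; rewrite ffunE. Qed.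
Lemma belowD g n v w : below g n v -> below g n w -> below g n (v + w).
Proof. by move=> bv bw j gj; rewrite ffunE bv // bw // addr0. Qed.
Lemma belowZ g n (c : R[i]) v : below g n v -> below g n (c *: v).
Proof. by move=> bv j gj; rewrite ffunE bv // scaler0. Qed.
Lemma below_sum g n J (r : seq J) (P : pred J) (v : J -> W) :
  (forall i, P i -> below g n (v i)) -> below g n (\sum_(i <- r | P i) v i).
Proof. by move=> H; apply: big_ind => //; [exact: below0|exact: belowD]. Qed.
Lemma below_bvec g n m (lab : 'I_m -> I) k :
  (forall i : 'I_m, i = k :> nat -> (g (lab i) < n)%N) -> below g n (bvec R lab k).
Proof.
move=> H; apply: bvecP; first exact: below0.
move=> i ik j gj; rewrite ffunE; case: eqP => // ji.
by move: gj; rewrite ji leqNgt H.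
Qed.

(** [g] is a height that the operator strictly lowers; with all heights below n there is no room for
    n steps. *)
Lemma lower_nilp (g : I -> nat) n (e : I -> W) : (forall i, (g i < n)%N) ->
  (forall i, below g (g i) (e i)) -> lpow (lin_ext e) n = 0.
Proof.
move=> gn ge; apply/lfunP => v; rewrite lpowE zero_lfunE.
have: below g n v by move=> j; rewrite leqNgt gn.
elim: n v {gn} => [|n IH] v bv; first by apply/ffunP => j; rewrite bv ?ffunE.
rewrite iterSr IH // [v]dl_decomp lfun_sum; apply: below_sum => i _.
rewrite lfunZ lin_ext_dl; case: (ltnP n (g i)) => [gi|gi].
  by rewrite bv // scale0r; apply: below0.
by apply: belowZ => j gj; apply: ge; apply: leq_trans gi gj.
Qed.

(** Reduces the defining relations to basis vectors. The heights [gE] and [gF], bounded by p, are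
    what proves E^p = F^p = 0. *)
Lemma basis_module (e f k : I -> W) (c : I -> R[i]) (gE gF : I -> nat)
    (M := Rep (lin_ext e) (lin_ext f) (lin_ext k)) :
  (forall i, k i = c i *: dl i) -> (forall i, c i ^+ (2 * p) = 1) ->
  (forall i, wt (M := M) (q ^+ 2 * c i) (e i)) ->
  (forall i, wt (M := M) (q ^- 2 * c i) (f i)) ->
  (forall i, (gE i < p)%N) -> (forall i, (gF i < p)%N) ->
  (forall i, below gE (gE i) (e i)) -> (forall i, below gF (gF i) (f i)) ->
  (forall i, opE M (opF M (dl i)) - opF M (opE M (dl i)) = (h^-1 * (c i - (c i)^-1)) *: (dl i : M)) ->
  is_module p M.
Proof.
move=> ki cp eW fW gEp gFp eb fb comm.
have c0 i : c i != 0.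
  apply/eqP => ci; have := cp i; rewrite ci expr0n (_ : (2 * p == 0)%N = false); last by lia.
  by move/eqP; rewrite eq_sym oner_eq0.
have K1 : lpow (opK M) (2 * p) = \1%VF.
  apply: dl_ext => i; rewrite lpowE id_lfunE.
  have it n : iter n (opK M) (dl i) = c i ^+ n *: dl i.
    elim: n => [|n IH]; first by rewrite scale1r.
    by rewrite iterS IH lfunZ /= lin_ext_dl ki scalerA exprSr.
  by rewrite it cp scale1r.
have Kinj : lker (opK M) == 0%VS.
  apply/lker0P => v w vw; have := congr1 (fun g : 'End(M) => g v) K1.
  have := congr1 (fun g : 'End(M) => g w) K1; rewrite !lpowE !id_lfunE => <- <-.
  have -> : (2 * p = (2 * p).-1.+1)%N by lia.
  by rewrite !iterSr vw.
have VK (i : I) : (opK M)^-1%VF (dl i) = (c i)^-1 *: dl i.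
  have /lker0P inj := Kinj; apply: inj; rewrite -comp_lfunE lker0_compfV // id_lfunE.
  by rewrite lfunZ /= lin_ext_dl ki scalerA mulVf // scale1r.
split => //.
- by split; [apply: lower_nilp gEp eb|apply: lower_nilp gFp fb].
- apply: dl_ext => i; rewrite scale_lfunE !comp_lfunE VK !lfunZ /= lin_ext_dl.
  by have := eW i; rewrite /wt /= => ->; rewrite scalerA mulrCA mulVf // mulr1.
- apply: dl_ext => i; rewrite scale_lfunE !comp_lfunE VK !lfunZ /= lin_ext_dl.
  by have := fW i; rewrite /wt /= => ->; rewrite scalerA mulrCA mulVf // mulr1.
- apply: dl_ext => i; rewrite scale_lfunE !add_lfunE !opp_lfunE !comp_lfunE VK comm /= lin_ext_dl.
  by rewrite ki -scalerBl scalerA.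
Qed.

Lemma wt_bvec (k : I -> W) (e f : I -> W) (c : I -> R[i]) n (lab : 'I_n -> I) l x :
  (forall i, k i = c i *: dl i) -> (forall i : 'I_n, i = l :> nat -> c (lab i) = x) ->
  wt (M := Rep (lin_ext e) (lin_ext f) (lin_ext k)) x (bvec R lab l).
Proof.
move=> ki cx; rewrite /wt; apply: (bvecP (P := fun v => lin_ext k v = x *: v)).
  by rewrite lfun0 scaler0.
by move=> i il; rewrite lin_ext_dl ki cx.
Qed.
End Basis.

Lemma topw_2p a s n : a * a = 1 -> (q ^- (2 * n) * topw a s) ^+ (2 * p) = 1.
Proof.
have qm m : (q ^+ m) ^+ (2 * p) = 1 by rewrite -exprM mulnC exprM qroot_2p // expr1n.
move=> aa; rewrite /topw !exprMn !exprVn !qm qroot_2p // invr1 !mulr1 mul1r.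
by rewrite exprM expr2 aa expr1n.
Qed.

Lemma string_coef a s n : a * a = 1 -> (n < s)%N ->
  a * br n.+1 * br (s - n.+1) - a * br n * br (s - n) =
  h^-1 * (q ^- (2 * n) * topw a s - (q ^- (2 * n) * topw a s)^-1).
Proof.
move=> aa ns; rewrite -(topcoef hp aa ns) -(topcoef hp aa (ltnW ns)).
have k0 : q ^- (2 * n) * topw a s != 0.
  by rewrite mulf_neq0 ?invr_neq0 ?expf_neq0 ?q0 //; apply: topw_neq0.
rewrite opprB addrC addrA subrK -(gam_step hp k0).
by rewrite [q ^- 2 * _]mulrA -invfM -exprD mulnS.
Qed.
End BasisModules.

(** * The modules X and I(A, B) *)

Section ListedModules.
Variables (R : realType) (p : nat).
Hypothesis hp : (1 < p)%N.
Local Notation q := (qroot R p).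
Local Notation h := (q - q^-1).
Local Notation br := (qnum R p).
Local Notation q0 := (qroot_neq0 R hp).
Local Notation topw := (@topw R p).

Lemma q2_step n (t : R[i]) : q ^+ 2 * (q ^- (2 * n.+1) * t) = q ^- (2 * n) * t.
Proof. by rewrite mulnS exprD invfM mulrA mulrA mulfV ?expf_neq0 ?q0 // mul1r. Qed.

Lemma q2_stepF n (t : R[i]) : q ^- 2 * (q ^- (2 * n) * t) = q ^- (2 * n.+1) * t.
Proof. by rewrite mulrA -invfM -exprD mulnS. Qed.

(** The last vector of a (-a, p - s) string has the weight of E applied to a top vector of (a, s);
    hence E can send the one to the other. *)
Lemma topw_bottom a s : (0 < s)%N -> (s < p)%N ->
  q ^- (2 * (p - s).-1) * topw (- a) (p - s) = q ^+ 2 * topw a s.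
Proof.
move=> s0 sp; rewrite (topw_flip hp) ?(ltnW sp) // mulrA -invfM -exprD.
have -> : (2 * (p - s).-1 + 2 * s = 2 * (p.-1))%N by lia.
congr (_ * _); apply: (mulIf (expf_neq0 (2 * p.-1) q0)).
by rewrite mulVf ?expf_neq0 ?q0 // -exprD (_ : (_ + _ = 2 * p)%N) ?qroot_2p //; lia.
Qed.

Section OneSign.
Variables (a : R[i]) (s : nat).
Hypothesis aa : a * a = 1.
Hypothesis s0 : (0 < s)%N.
Hypothesis sp : (s <= p)%N.
Local Notation cf a s k := (a * br k * br (s - k)%N).

Lemma cf0 (c : R[i]) n : c * br 0%N * br n = 0.
Proof. by rewrite (qnum0 R hp) mulr0 mul0r. Qed.

Lemma cf_out (c : R[i]) k n : (n <= k)%N -> c * br k * br (n - k)%N = 0.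
Proof. by rewrite -subn_eq0 => /eqP ->; rewrite (qnum0 R hp) mulr0. Qed.

Definition vX k : modX p a s := bvec R (@id 'I_s) k.

Lemma X_E k : opE (modX p a s) (vX k) = cf a s k *: vX k.-1.
Proof.
rewrite [LHS]lmap_bvec; case: insubP => [i _ <- //|]; rewrite -leqNgt => sk.
by rewrite cf_out // scale0r.
Qed.

Lemma X_F k : opF (modX p a s) (vX k) = vX k.+1.
Proof.
rewrite [LHS]lmap_bvec; case: insubP => [i _ <- //|]; rewrite -leqNgt => sk.
by rewrite /vX bvec_out // leqW.
Qed.

Lemma X_module : is_module p (modX p a s).
Proof.
pose c (k : 'I_s) : R[i] := q ^- (2 * k) * topw a s.
have Kd (k : 'I_s) : (a * q ^ (s%:Z - 1 - 2 * (k : nat)%:Z)) *: vX k = c k *: dl R k.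
  by rewrite topw_exp // /vX bvec_ord.
apply: (basis_module hp (c := c)
  (gE := fun k : 'I_s => k : nat) (gF := fun k : 'I_s => (s.-1 - k)%N) Kd) => i.
- exact: topw_2p.
- case: i => -[|i] ip /=; first by rewrite cf0 scale0r; apply: wt0.
  by apply: wtZ; apply: (wt_bvec _ _ Kd) => j /= ji; rewrite /c ji q2_step.
- by apply: (wt_bvec _ _ Kd) => j /= ji; rewrite /c ji q2_stepF.
- exact: leq_trans (ltn_ord i) sp.
- by have := ltn_ord i; lia.
- case: i => -[|i] ip /=; first by rewrite cf0 scale0r; apply: below0.
  by apply: belowZ; apply: below_bvec => j /= ->.
- by apply: below_bvec => j /= ji; have := ltn_ord j; lia.
- rewrite -(string_coef hp aa (ltn_ord i)) -(bvec_ord R (@id 'I_s)) -/(vX i).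
  apply: lfun_commE; first by rewrite X_F X_E.
  rewrite X_E lfunZ X_F; case: (nat_of_ord i) => [|k]; last by [].
  by rewrite !cf0 !scale0r.
Qed.

Section ModuleI.
Variables (n m : nat) (A B : 'M[R[i]]_(n, m)).

(* The vectors va j l, vx i k satisfy the relations of the basis of modI p a s A B, that is,
   they are the images of that basis under a homomorphism. *)
Record is_modI (M : rep R) (va : 'I_m -> nat -> M) (vx : 'I_n -> nat -> M) : Prop := IsModI {
  mI_aout : forall j l, (s <= l)%N -> va j l = 0;
  mI_xout : forall i k, (p - s <= k)%N -> vx i k = 0;
  mI_Ka : forall j l, wt (q ^- (2 * l) * topw a s) (va j l);
  mI_Kx : forall i k, wt (q ^- (2 * k) * topw (- a) (p - s)) (vx i k);
  mI_Ea : forall j l, opE M (va j l.+1) = cf a s l.+1 *: va j l;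
  mI_Ea0 : forall j, opE M (va j 0%N) = \sum_i B i j *: vx i (p - s).-1;
  mI_Ex : forall i k, opE M (vx i k) = cf (- a) (p - s) k *: vx i k.-1;
  mI_Fa : forall j l, l != s.-1 -> opF M (va j l) = va j l.+1;
  mI_Flast : forall j, opF M (va j s.-1) = \sum_i A i j *: vx i 0%N;
  mI_Fx : forall i k, opF M (vx i k) = vx i k.+1 }.

Section Model.
Variables (M : rep R) (va : 'I_m -> nat -> M) (vx : 'I_n -> nat -> M).
Hypothesis H : is_modI va vx.

Lemma modI_comm_a j l : (l < s)%N -> opE M (opF M (va j l)) - opF M (opE M (va j l)) =
  (cf a s l.+1 - cf a s l) *: va j l.
Proof.
move=> ls; apply: lfun_commE.
  have [{}ls|ls'] := eqVneq l s.-1; last by rewrite (mI_Fa H) // (mI_Ea H).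
  rewrite ls (mI_Flast H) lfun_sum prednK // (cf_out _ (leqnn s)) scale0r big1 // => i _.
  by rewrite lfunZ (mI_Ex H) cf0 scale0r scaler0.
case: l ls => [|k] ls; last by rewrite (mI_Ea H) lfunZ (mI_Fa H) // ltn_eqF //; lia.
rewrite cf0 scale0r (mI_Ea0 H) lfun_sum big1 // => i _; rewrite lfunZ (mI_Fx H).
by rewrite (mI_xout H) ?scaler0 //; lia.
Qed.

Lemma modI_comm_x i k : (k < p - s)%N -> opE M (opF M (vx i k)) - opF M (opE M (vx i k)) =
  (cf (- a) (p - s) k.+1 - cf (- a) (p - s) k) *: vx i k.
Proof.
move=> kp; apply: lfun_commE; first by rewrite (mI_Fx H) (mI_Ex H).
by rewrite (mI_Ex H) lfunZ (mI_Fx H); case: k kp => [|k'] kp //; rewrite !cf0 !scale0r.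
Qed.

Definition homI_fun (b : ('I_m * 'I_s) + ('I_n * 'I_(p - s))) : M :=
  match b with inl (j, l) => va j l | inr (i, k) => vx i k end.

Definition homI : 'Hom(modI p a s A B, M) := lmap homI_fun.

Lemma homI_a j l : homI (bvec R (fun l' : 'I_s => inl (j, l')) l) = va j l.
Proof.
rewrite [LHS]lmap_bvec; case: insubP => [i _ <- //|]; rewrite -leqNgt => sk.
by rewrite (mI_aout H).
Qed.

Lemma homI_x i k : homI (bvec R (fun k' : 'I_(p - s) => inr (i, k')) k) = vx i k.
Proof.
rewrite [LHS]lmap_bvec; case: insubP => [j _ <- //|]; rewrite -leqNgt => sk.
by rewrite (mI_xout H).
Qed.

Lemma homI_is_hom : is_hom homI.
Proof.
apply: lmap_hom => -[[j l]|[i k]] /=.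
- case: eqP => [l0|/eqP l0].
    rewrite l0 (mI_Ea0 H) lfun_sum; apply: eq_bigr => i _; rewrite lfunZ; congr (_ *: _).
    exact: homI_x.
  rewrite lfunZ -[in RHS](prednK (n := l)) ?lt0n // (mI_Ea H) prednK ?lt0n //; congr (_ *: _).
  exact: homI_a.
- rewrite lfunZ (mI_Ex H); congr (_ *: _); exact: homI_x.
- case: eqP => [ls|/eqP ls].
    rewrite ls (mI_Flast H) lfun_sum; apply: eq_bigr => i _; rewrite lfunZ; congr (_ *: _).
    exact: homI_x.
  rewrite (mI_Fa H) //; exact: homI_a.
- rewrite (mI_Fx H); exact: homI_x.
- by rewrite lfunZ (mI_Ka H) topw_exp //; congr (_ *: _); apply: homI_a.
- by rewrite lfunZ (mI_Kx H) topw_exp //; congr (_ *: _); apply: homI_x.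
Qed.
End Model.

Definition vIa j l : modI p a s A B := bvec R (fun l' : 'I_s => inl (j, l')) l.
Definition vIx i k : modI p a s A B := bvec R (fun k' : 'I_(p - s) => inr (i, k')) k.

Definition cI (b : ('I_m * 'I_s) + ('I_n * 'I_(p - s))) : R[i] :=
  match b with inl (j, l) => q ^- (2 * l) * topw a s
             | inr (i, k) => q ^- (2 * k) * topw (- a) (p - s) end.

Lemma I_weights (b : ('I_m * 'I_s) + ('I_n * 'I_(p - s))) :
  match b with inl (j, l) => (a * q ^ (s%:Z - 1 - 2 * (l : nat)%:Z)) *: vIa j l
             | inr (i, k) => (- a * q ^ ((p - s)%N%:Z - 1 - 2 * (k : nat)%:Z)) *: vIx i k
  end = cI b *: dl R b.
Proof. by case: b => [[j l]|[i k]] /=; rewrite topw_exp // /vIa /vIx bvec_ord. Qed.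

Lemma modI_modI : is_modI vIa vIx.
Proof.
split.
- by move=> j l sl; apply: bvec_out.
- by move=> i k sk; apply: bvec_out.
- by move=> j l; apply: (wt_bvec _ _ I_weights) => i /= ->.
- by move=> i k; apply: (wt_bvec _ _ I_weights) => j /= ->.
- move=> j l; rewrite [LHS]lmap_bvec; case: insubP => [i _ -> //|]; rewrite -leqNgt => sk.
  by rewrite cf_out // scale0r.
- by move=> j; rewrite [LHS]lmap_bvec; case: insubP => [i _ ->|]; rewrite ?s0.
- move=> i k; rewrite [LHS]lmap_bvec; case: insubP => [j _ <- //|]; rewrite -leqNgt => sk.
  by rewrite cf_out // scale0r.
- move=> j l ls; rewrite [LHS]lmap_bvec; case: insubP => [i _ ->|]; first by rewrite (negPf ls).
  by rewrite -leqNgt => sk; rewrite /vIa bvec_out // leqW.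
- move=> j; rewrite [LHS]lmap_bvec; case: insubP => [i _ ->|]; first by rewrite eqxx.
  by rewrite prednK // leqnn.
- move=> i k; rewrite [LHS]lmap_bvec; case: insubP => [j _ -> //|]; rewrite -leqNgt => sk.
  by rewrite /vIx bvec_out // leqW.
Qed.

Lemma wt_vIx_last i : wt (q ^+ 2 * topw a s) (vIx i (p - s).-1).
Proof.
case: (ltnP s p) => sp'; first by rewrite -topw_bottom //; apply: (mI_Kx modI_modI).
by rewrite (mI_xout modI_modI); [exact: wt0|lia].
Qed.

Lemma wt_vIx_first i : wt (q ^- (2 * s) * topw a s) (vIx i 0).
Proof.
rewrite -(topw_flip hp) //; have := mI_Kx modI_modI i 0.
by rewrite muln0 expr0 invr1 mul1r.
Qed.

Lemma I_module : is_module p (modI p a s A B).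
Proof.
(* The heights place the top strings above the socle strings: E passes from a_0, at height p - s, to
   x_(p-s-1), one lower, and F passes from a_(s-1), at height p - s, to x_0. *)
apply: (basis_module hp (c := cI)
  (gE := fun b => match b with inl (j, l) => (p - s + l)%N | inr (i, k) => k : nat end)
  (gF := fun b => match b with inl (j, l) => (p.-1 - l)%N | inr (i, k) => ((p - s).-1 - k)%N end)
  I_weights) => -[[j l]|[i k]] /=.
- exact: topw_2p.
- exact: topw_2p (signN aa).
- case: eqP => [l0|/eqP l0].
    rewrite l0 muln0 expr0 invr1 mul1r.
    by apply: wt_sum => i _; apply: wtZ; exact: wt_vIx_last.
  rewrite -{1}(prednK (n := l)) ?lt0n // q2_step; apply: wtZ; exact: (mI_Ka modI_modI).
- case: k => -[|k] kp /=; first by rewrite cf0 scale0r; apply: wt0.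
  rewrite q2_step; apply: wtZ; exact: (mI_Kx modI_modI).
- case: eqP => [ls|/eqP ls].
    by rewrite q2_stepF ls prednK //; apply: wt_sum => i _; apply: wtZ; exact: wt_vIx_first.
  rewrite q2_stepF; exact: (mI_Ka modI_modI).
- rewrite q2_stepF; exact: (mI_Kx modI_modI).
- by have := ltn_ord l; lia.
- by have := ltn_ord k; lia.
- by lia.
- by have := ltn_ord k; lia.
- case: eqP => l0.
    apply: below_sum => i _; apply: belowZ; apply: below_bvec => k /= kE.
    by have := ltn_ord k; lia.
  by apply: belowZ; apply: below_bvec => k /= kE; lia.
- case: k => -[|k] kp /=; first by rewrite cf0 scale0r; apply: below0.
  by apply: belowZ; apply: below_bvec => j /= ->.
- case: eqP => ls.
    by apply: below_sum => i _; apply: belowZ; apply: below_bvec => k /= kE; have := ltn_ord k; lia.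
  by apply: below_bvec => k /= kE; have := ltn_ord k; have := ltn_ord l; lia.
- by apply: below_bvec => j /= jE; have := ltn_ord j; lia.
- have := modI_comm_a modI_modI j (ltn_ord l).
  rewrite (string_coef hp aa (ltn_ord l)) {1 2 3}/vIa !bvec_ord; exact.
- have := modI_comm_x modI_modI i (ltn_ord k).
  rewrite (string_coef hp (signN aa) (ltn_ord k)) {1 2 3}/vIx !bvec_ord; exact.
Qed.
End ModuleI.
End OneSign.
End ListedModules.

(** * The modules P *)

Section ProjectiveModules.
Variables (R : realType) (p : nat).
Hypothesis hp : (1 < p)%N.
Local Notation q := (qroot R p).
Local Notation h := (q - q^-1).
Local Notation br := (qnum R p).
Local Notation q0 := (qroot_neq0 R hp).
Local Notation topw := (@topw R p).
Variables (a : R[i]) (s : nat).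
Hypothesis aa : a * a = 1.
Hypothesis s0 : (0 < s)%N.
Hypothesis sp : (s < p)%N.
Local Notation cf a s k := (a * br k * br (s - k)%N).

(* The vectors satisfy the relations of the basis of modP p a s. *)
Record is_modP (M : rep R) (vb va vx vy : nat -> M) : Prop := IsModP {
  mP_bout : forall n, (s <= n)%N -> vb n = 0;
  mP_aout : forall n, (s <= n)%N -> va n = 0;
  mP_xout : forall k, (p - s <= k)%N -> vx k = 0;
  mP_yout : forall k, (p - s <= k)%N -> vy k = 0;
  mP_Kb : forall n, wt (q ^- (2 * n) * topw a s) (vb n);
  mP_Ka : forall n, wt (q ^- (2 * n) * topw a s) (va n);
  mP_Kx : forall k, wt (q ^- (2 * k) * topw (- a) (p - s)) (vx k);
  mP_Ky : forall k, wt (q ^- (2 * k) * topw (- a) (p - s)) (vy k);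
  mP_Eb0 : opE M (vb 0%N) = vx (p - s).-1;
  mP_Eb : forall n, (n.+1 < s)%N -> opE M (vb n.+1) = cf a s n.+1 *: vb n + va n;
  mP_Ea : forall n, opE M (va n) = cf a s n *: va n.-1;
  mP_Ex : forall k, opE M (vx k) = cf (- a) (p - s) k *: vx k.-1;
  mP_Ey0 : opE M (vy 0%N) = va s.-1;
  mP_Ey : forall k, opE M (vy k.+1) = cf (- a) (p - s) k.+1 *: vy k;
  mP_Fb : forall n, n != s.-1 -> opF M (vb n) = vb n.+1;
  mP_Fblast : opF M (vb s.-1) = vy 0%N;
  mP_Fa : forall n, opF M (va n) = va n.+1;
  mP_Fx : forall k, k != (p - s).-1 -> opF M (vx k) = vx k.+1;
  mP_Fxlast : opF M (vx (p - s).-1) = va 0%N;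
  mP_Fy : forall k, opF M (vy k) = vy k.+1 }.

Local Notation IP := (('I_s + 'I_s) + ('I_(p - s) + 'I_(p - s)))%type.

Section Model.
Variables (M : rep R) (vb va vx vy : nat -> M).
Hypothesis H : is_modP vb va vx vy.

Lemma modP_comm_b n : (n < s)%N -> opE M (opF M (vb n)) - opF M (opE M (vb n)) =
  (cf a s n.+1 - cf a s n) *: vb n.
Proof.
move=> ns.
have -> : opE M (opF M (vb n)) = cf a s n.+1 *: vb n + va n.
  have [{}ns|ns'] := eqVneq n s.-1; last by rewrite (mP_Fb H) // (mP_Eb H) //; lia.
  by rewrite ns (mP_Fblast H) (mP_Ey0 H) prednK // (cf_out hp _ (leqnn s)) scale0r add0r.
have -> : opF M (opE M (vb n)) = cf a s n *: vb n + va n.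
  case: n ns => [|n] ns; first by rewrite (mP_Eb0 H) (mP_Fxlast H) (cf0 hp) scale0r add0r.
  by rewrite (mP_Eb H) // lfunD lfunZ (mP_Fa H) (mP_Fb H) // ltn_eqF //; lia.
by rewrite scalerBl opprD addrACA subrr addr0.
Qed.

Lemma modP_comm_a n : (n < s)%N -> opE M (opF M (va n)) - opF M (opE M (va n)) =
  (cf a s n.+1 - cf a s n) *: va n.
Proof.
move=> ns; apply: lfun_commE; first by rewrite (mP_Fa H) (mP_Ea H).
by rewrite (mP_Ea H) lfunZ (mP_Fa H); case: n ns => [|k'] kp //; rewrite !(cf0 hp) !scale0r.
Qed.

Lemma modP_comm_x k : (k < p - s)%N -> opE M (opF M (vx k)) - opF M (opE M (vx k)) =
  (cf (- a) (p - s) k.+1 - cf (- a) (p - s) k) *: vx k.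
Proof.
move=> kp; apply: lfun_commE.
  have [{}kp|kp'] := eqVneq k (p - s).-1; last by rewrite (mP_Fx H) // (mP_Ex H).
  rewrite kp (mP_Fxlast H) (mP_Ea H) (cf0 hp) scale0r prednK ?subn_gt0 //.
  by rewrite (cf_out hp _ (leqnn _)) scale0r.
rewrite (mP_Ex H) lfunZ; case: k kp => [|k] kp; first by rewrite !(cf0 hp) !scale0r.
by rewrite (mP_Fx H) //= ltn_eqF //; lia.
Qed.

Lemma modP_comm_y k : (k < p - s)%N -> opE M (opF M (vy k)) - opF M (opE M (vy k)) =
  (cf (- a) (p - s) k.+1 - cf (- a) (p - s) k) *: vy k.
Proof.
move=> kp; apply: lfun_commE; first by rewrite (mP_Fy H) (mP_Ey H).
case: k kp => [|k] kp; last by rewrite (mP_Ey H) lfunZ (mP_Fy H).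
by rewrite (mP_Ey0 H) (mP_Fa H) (mP_aout H) ?prednK // (cf0 hp) scale0r.
Qed.

Definition homP_fun (b : IP) : M :=
  match b with inl (inl n) => vb n | inl (inr n) => va n
             | inr (inl k) => vx k | inr (inr k) => vy k end.

Definition homP : 'Hom(modP p a s, M) := lmap homP_fun.

Lemma homP_b n : homP (bvec R (fun n' : 'I_s => inl (inl n')) n) = vb n.
Proof.
rewrite [LHS]lmap_bvec; case: insubP => [i _ <- //|]; rewrite -leqNgt => sk.
by rewrite (mP_bout H).
Qed.
Lemma homP_a n : homP (bvec R (fun n' : 'I_s => inl (inr n')) n) = va n.
Proof.
rewrite [LHS]lmap_bvec; case: insubP => [i _ <- //|]; rewrite -leqNgt => sk.
by rewrite (mP_aout H).
Qed.
Lemma homP_x k : homP (bvec R (fun k' : 'I_(p - s) => inr (inl k')) k) = vx k.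
Proof.
rewrite [LHS]lmap_bvec; case: insubP => [i _ <- //|]; rewrite -leqNgt => sk.
by rewrite (mP_xout H).
Qed.
Lemma homP_y k : homP (bvec R (fun k' : 'I_(p - s) => inr (inr k')) k) = vy k.
Proof.
rewrite [LHS]lmap_bvec; case: insubP => [i _ <- //|]; rewrite -leqNgt => sk.
by rewrite (mP_yout H).
Qed.

Lemma homP_is_hom : is_hom homP.
Proof.
apply: lmap_hom => -[[n|n]|[k|k]] /=.
- case: eqP => [n0|/eqP n0]; first by rewrite n0 (mP_Eb0 H); exact: homP_x.
  rewrite -[in RHS](prednK (n := n)) ?lt0n // (mP_Eb H) prednK ?lt0n // lfunD lfunZ.
  by congr (_ *: _ + _); [exact: homP_b|exact: homP_a].
- by rewrite lfunZ (mP_Ea H); congr (_ *: _); exact: homP_a.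
- by rewrite lfunZ (mP_Ex H); congr (_ *: _); exact: homP_x.
- case: eqP => [n0|/eqP n0]; first by rewrite n0 (mP_Ey0 H); exact: homP_a.
  rewrite -[in RHS](prednK (n := k)) ?lt0n // (mP_Ey H) prednK ?lt0n // lfunZ.
  by congr (_ *: _); exact: homP_y.
- case: eqP => [ns|/eqP ns]; first by rewrite ns (mP_Fblast H); exact: homP_y.
  by rewrite (mP_Fb H) //; exact: homP_b.
- by rewrite (mP_Fa H); exact: homP_a.
- case: eqP => [ns|/eqP ns]; first by rewrite ns (mP_Fxlast H); exact: homP_a.
  by rewrite (mP_Fx H) //; exact: homP_x.
- by rewrite (mP_Fy H); exact: homP_y.
- by rewrite lfunZ (mP_Kb H) topw_exp //; congr (_ *: _); apply: homP_b.
- by rewrite lfunZ (mP_Ka H) topw_exp //; congr (_ *: _); apply: homP_a.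
- by rewrite lfunZ (mP_Kx H) topw_exp //; congr (_ *: _); apply: homP_x.
- by rewrite lfunZ (mP_Ky H) topw_exp //; congr (_ *: _); apply: homP_y.
Qed.
End Model.

Definition vPb n : modP p a s := bvec R (fun n' : 'I_s => inl (inl n')) n.
Definition vPa n : modP p a s := bvec R (fun n' : 'I_s => inl (inr n')) n.
Definition vPx k : modP p a s := bvec R (fun k' : 'I_(p - s) => inr (inl k')) k.
Definition vPy k : modP p a s := bvec R (fun k' : 'I_(p - s) => inr (inr k')) k.

Definition cP (b : IP) : R[i] :=
  match b with inl (inl n) => q ^- (2 * n) * topw a s
             | inl (inr n) => q ^- (2 * n) * topw a s
             | inr (inl k) => q ^- (2 * k) * topw (- a) (p - s)
             | inr (inr k) => q ^- (2 * k) * topw (- a) (p - s) end.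

Lemma P_weights (b : IP) :
  match b with
      | inl (inl n) => (a * q ^ (s%:Z - 1 - 2 * (n : nat)%:Z)) *: vPb n
      | inl (inr n) => (a * q ^ (s%:Z - 1 - 2 * (n : nat)%:Z)) *: vPa n
      | inr (inl k) => (- a * q ^ ((p - s)%N%:Z - 1 - 2 * (k : nat)%:Z)) *: vPx k
      | inr (inr k) => (- a * q ^ ((p - s)%N%:Z - 1 - 2 * (k : nat)%:Z)) *: vPy k
      end = cP b *: dl R b.
Proof.
by case: b => [[n|n]|[k|k]] /=; rewrite topw_exp // /vPb /vPa /vPx /vPy bvec_ord.
Qed.

Lemma modP_modP : is_modP vPb vPa vPx vPy.
Proof.
split.
- by move=> n; apply: bvec_out.
- by move=> n; apply: bvec_out.
- by move=> n; apply: bvec_out.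
- by move=> n; apply: bvec_out.
- by move=> n; apply: (wt_bvec _ _ P_weights) => i /= ->.
- by move=> n; apply: (wt_bvec _ _ P_weights) => i /= ->.
- by move=> n; apply: (wt_bvec _ _ P_weights) => i /= ->.
- by move=> n; apply: (wt_bvec _ _ P_weights) => i /= ->.
- by rewrite [LHS]lmap_bvec; case: insubP => [i _ ->|]; rewrite ?s0.
- by move=> n ns; rewrite [LHS]lmap_bvec; case: insubP => [i _ ->|]; rewrite ?ns.
- move=> n; rewrite [LHS]lmap_bvec; case: insubP => [i _ <- //|]; rewrite -leqNgt => sk.
  by rewrite (cf_out hp) // scale0r.
- move=> n; rewrite [LHS]lmap_bvec; case: insubP => [i _ <- //|]; rewrite -leqNgt => sk.
  by rewrite (cf_out hp) // scale0r.
- by rewrite [LHS]lmap_bvec; case: insubP => [i _ ->|]; rewrite ?subn_gt0 ?sp.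
- move=> n; rewrite [LHS]lmap_bvec; case: insubP => [i _ -> //|]; rewrite -leqNgt => sk.
  by rewrite (cf_out hp) // scale0r.
- move=> n ns; rewrite [LHS]lmap_bvec; case: insubP => [i _ ->|]; first by rewrite (negPf ns).
  by rewrite -leqNgt => sk; rewrite /vPb bvec_out // leqW.
- by rewrite [LHS]lmap_bvec; case: insubP => [i _ ->|]; rewrite ?eqxx // prednK ?leqnn.
- move=> n; rewrite [LHS]lmap_bvec; case: insubP => [i _ -> //|]; rewrite -leqNgt => sk.
  by rewrite /vPa bvec_out // leqW.
- move=> n ns; rewrite [LHS]lmap_bvec; case: insubP => [i _ ->|]; first by rewrite (negPf ns).
  by rewrite -leqNgt => sk; rewrite /vPx bvec_out // leqW.
- rewrite [LHS]lmap_bvec; case: insubP => [i _ ->|]; first by rewrite eqxx.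
  by rewrite prednK ?subn_gt0 ?leqnn.
- move=> n; rewrite [LHS]lmap_bvec; case: insubP => [i _ -> //|]; rewrite -leqNgt => sk.
  by rewrite /vPy bvec_out // leqW.
Qed.

Lemma P_module : is_module p (modP p a s).
Proof.
have MP := modP_modP.
(* For E the b string stands on top of the x string and the y string on top of the a string; for F
   it is b above y and x above a. Each pile has p levels. *)
apply: (basis_module hp (c := cP)
  (gE := fun b : IP => match b with inl (inl n) => (p - s + n)%N | inl (inr n) => n : nat
                             | inr (inl k) => k : nat | inr (inr k) => (s + k)%N end)
  (gF := fun b : IP => match b with inl (inl n) => (p.-1 - n)%N | inl (inr n) => (s.-1 - n)%N
                             | inr (inl k) => (p.-1 - k)%N | inr (inr k) => (p.-1 - s - k)%N end)
  P_weights) => -[[n|n]|[k|k]] /=.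
- exact: topw_2p.
- exact: topw_2p.
- exact: topw_2p (signN aa).
- exact: topw_2p (signN aa).
- case: eqP => [n0|/eqP n0].
    by rewrite n0 muln0 expr0 invr1 mul1r -topw_bottom //; exact: (mP_Kx MP).
  rewrite -{1}(prednK (n := n)) ?lt0n // q2_step //.
  by apply: wtD; [apply: wtZ; exact: (mP_Kb MP)|exact: (mP_Ka MP)].
- case: n => -[|n] np /=; first by rewrite (cf0 hp) scale0r; apply: wt0.
  by rewrite q2_step //; apply: wtZ; exact: (mP_Ka MP).
- case: k => -[|k] kp /=; first by rewrite (cf0 hp) scale0r; apply: wt0.
  by rewrite q2_step //; apply: wtZ; exact: (mP_Kx MP).
- case: eqP => [k0|/eqP k0].
    rewrite k0 muln0 expr0 invr1 mul1r (topw_flip hp) ?(ltnW sp) //.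
    rewrite -[X in q ^- (2 * X)](prednK s0) q2_step //; exact: (mP_Ka MP).
  rewrite -{1}(prednK (n := k)) ?lt0n // q2_step //.
  by apply: wtZ; exact: (mP_Ky MP).
- case: eqP => [ns|/eqP ns].
    rewrite q2_stepF ns prednK // -(topw_flip hp) ?(ltnW sp) //.
    by have := mP_Ky MP 0; rewrite muln0 expr0 invr1 mul1r; exact.
  rewrite q2_stepF; exact: (mP_Kb MP).
- rewrite q2_stepF; exact: (mP_Ka MP).
- case: eqP => [ks|/eqP ks].
    rewrite ks topw_bottom // mulrA mulVf ?expf_neq0 ?q0 // mul1r.
    by have := mP_Ka MP 0; rewrite muln0 expr0 invr1 mul1r; exact.
  rewrite q2_stepF; exact: (mP_Kx MP).
- rewrite q2_stepF; exact: (mP_Ky MP).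
- by have := ltn_ord n; lia.
- by have := ltn_ord n; lia.
- by have := ltn_ord k; lia.
- by have := ltn_ord k; lia.
- by lia.
- by lia.
- by lia.
- by lia.
- case: eqP => [n0|n0]; first by apply: below_bvec => i /= ii; have := ltn_ord i; lia.
  by apply: belowD; [apply: belowZ|]; apply: below_bvec => i /= ii; lia.
- case: n => -[|n] np /=; first by rewrite (cf0 hp) scale0r; apply: below0.
  by apply: belowZ; apply: below_bvec => i /= ->.
- case: k => -[|k] kp /=; first by rewrite (cf0 hp) scale0r; apply: below0.
  by apply: belowZ; apply: below_bvec => i /= ->.
- case: eqP => [k0|k0]; first by apply: below_bvec => i /= ii; have := ltn_ord i; lia.
  by apply: belowZ; apply: below_bvec => i /= ii; lia.
- by case: eqP => ns; apply: below_bvec => i /= ii; have := ltn_ord i; have := ltn_ord n; lia.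
- by apply: below_bvec => i /= ii; have := ltn_ord i; lia.
- by case: eqP => ns; apply: below_bvec => i /= ii; have := ltn_ord i; have := ltn_ord k; lia.
- by apply: below_bvec => i /= ii; have := ltn_ord i; lia.
- have := modP_comm_b MP (ltn_ord n).
  rewrite (string_coef hp aa (ltn_ord n)) /vPb bvec_ord; exact.
- have := modP_comm_a MP (ltn_ord n).
  rewrite (string_coef hp aa (ltn_ord n)) /vPa bvec_ord; exact.
- have := modP_comm_x MP (ltn_ord k).
  rewrite (string_coef hp (signN aa) (ltn_ord k)) /vPx bvec_ord; exact.
- have := modP_comm_y MP (ltn_ord k).
  rewrite (string_coef hp (signN aa) (ltn_ord k)) /vPy bvec_ord; exact.
Qed.
End ProjectiveModules.

(** * Homomorphisms, submodules and blocks *)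

Section Homs.
Variables (R : realType) (p : nat).
Hypothesis hp : (1 < p)%N.
Local Notation q := (qroot R p).

Lemma hom_eltP (M N : rep R) (f : 'Hom(M, N)) : is_hom f <->
  [/\ forall v, f (opE M v) = opE N (f v), forall v, f (opF M v) = opF N (f v) &
      forall v, f (opK M v) = opK N (f v)].
Proof.
split=> [[HE HF HK]|[HE HF HK]].
  by split=> v; rewrite -!comp_lfunE ?HE ?HF ?HK.
by split; apply/lfunP => v; rewrite !comp_lfunE.
Qed.

Lemma hom_id (M : rep R) : is_hom (\1%VF : 'End(M)).
Proof. by apply/hom_eltP; split=> v; rewrite !id_lfunE. Qed.

Lemma hom_comp (M N L : rep R) (f : 'Hom(M, N)) (g : 'Hom(N, L)) :
  is_hom f -> is_hom g -> is_hom (g \o f)%VF.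
Proof.
move=> /hom_eltP [fE fF fK] /hom_eltP [gE gF gK]; apply/hom_eltP.
by split=> v; rewrite !comp_lfunE ?fE ?fF ?fK ?gE ?gF ?gK.
Qed.

Lemma hom_sub (M N : rep R) (f g : 'Hom(M, N)) : is_hom f -> is_hom g -> is_hom (f - g).
Proof.
move=> /hom_eltP [fE fF fK] /hom_eltP [gE gF gK]; apply/hom_eltP.
by split=> v; rewrite !add_lfunE !opp_lfunE ?fE ?fF ?fK ?gE ?gF ?gK lfunB.
Qed.

Lemma hom_iterE (M N : rep R) (f : 'Hom(M, N)) n v : is_hom f ->
  f (iter n (opE M) v) = iter n (opE N) (f v).
Proof. by move=> /hom_eltP [fE _ _]; elim: n => //= n <-; rewrite fE. Qed.

Lemma hom_iterF (M N : rep R) (f : 'Hom(M, N)) n v : is_hom f ->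
  f (iter n (opF M) v) = iter n (opF N) (f v).
Proof. by move=> /hom_eltP [_ fF _]; elim: n => //= n <-; rewrite fF. Qed.

Lemma hom_wt (M N : rep R) (f : 'Hom(M, N)) k v : is_hom f -> wt k v -> wt k (f v).
Proof. by move=> /hom_eltP [_ _ fK]; rewrite /wt -fK => ->; rewrite lfunZ. Qed.

Lemma submoduleI (M : rep R) (U : {vspace M}) :
  (forall v, v \in U -> opE M v \in U) -> (forall v, v \in U -> opF M v \in U) ->
  (forall v, v \in U -> opK M v \in U) -> is_submodule U.
Proof.
move=> UE UF UK; split; apply/subvP => w /memv_imgP [v vU ->]; [exact: UE|exact: UF|exact: UK].
Qed.

Lemma lker_submodule (M N : rep R) (f : 'Hom(M, N)) : is_hom f -> is_submodule (lker f).
Proof.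
move=> /hom_eltP [fE fF fK]; apply: submoduleI => v; rewrite !memv_ker => /eqP fv.
- by rewrite fE fv lfun0.
- by rewrite fF fv lfun0.
- by rewrite fK fv lfun0.
Qed.

Lemma img_submodule (M N : rep R) (f : 'Hom(M, N)) (U : {vspace M}) :
  is_hom f -> is_submodule U -> is_submodule (f @: U)%VS.
Proof.
move=> /hom_eltP [fE fF fK] /submoduleE [UE UF UK].
apply: submoduleI => _ /memv_imgP [v vU ->].
- by rewrite -fE memv_img // UE.
- by rewrite -fF memv_img // UF.
- by rewrite -fK memv_img // UK.
Qed.

Lemma full_submodule (M : rep R) : is_submodule (fullv : {vspace M}).
Proof. by apply: submoduleI => v _; rewrite memvf. Qed.

Lemma limg_submodule (M N : rep R) (f : 'Hom(M, N)) : is_hom f -> is_submodule (limg f).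
Proof. by move=> fh; apply: img_submodule => //; apply: full_submodule. Qed.

Lemma cap_submodule (M : rep R) (U V : {vspace M}) :
  is_submodule U -> is_submodule V -> is_submodule (U :&: V)%VS.
Proof.
move=> /submoduleE [UE UF UK] /submoduleE [VE VF VK].
by apply: submoduleI => v; rewrite !memv_cap => /andP [vU vV];
  rewrite ?UE ?UF ?UK ?VE ?VF ?VK.
Qed.

Lemma add_submodule (M : rep R) (U V : {vspace M}) :
  is_submodule U -> is_submodule V -> is_submodule (U + V)%VS.
Proof.
move=> /submoduleE [UE UF UK] /submoduleE [VE VF VK].
by apply: submoduleI => _ /memv_addP [u uU [v vV ->]]; rewrite lfunD memv_add //;
  auto.
Qed.

Lemma isomorphicI (M N : rep R) (f : 'Hom(M, N)) : is_hom f -> lker f == 0%VS ->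
  limg f = fullv -> isomorphic M N.
Proof.
move=> fh f0 fN; exists f, (f^-1)%VF.
have ff : (f^-1 \o f)%VF = \1%VF := lker0_compVf f0.
have ff' : (f \o f^-1)%VF = \1%VF.
  by apply/lfunP => v; rewrite comp_lfunE id_lfunE limg_lfunVK // fN memvf.
have inj : injective f by apply/lker0P.
split => //; move/hom_eltP: (fh) => [fE fF fK]; apply/hom_eltP.
have fV v : f (f^-1%VF v) = v by rewrite -comp_lfunE ff' id_lfunE.
by split=> v; apply: inj; rewrite ?fE ?fF ?fK !fV.
Qed.

Lemma isomorphic_sym (M N : rep R) : isomorphic M N -> isomorphic N M.
Proof. by case=> f [g [fh gh gf fg]]; exists g, f. Qed.

Lemma isomorphic_trans (M N L : rep R) : isomorphic M N -> isomorphic N L -> isomorphic M L.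
Proof.
case=> f [g [fh gh gf fg]] [f' [g' [fh' gh' gf' fg']]].
exists (f' \o f)%VF, (g \o g')%VF; split; try exact: hom_comp.
  by rewrite comp_lfunA -[(_ \o _ \o f')%VF]comp_lfunA gf' comp_lfun1r.
by rewrite comp_lfunA -[(_ \o _ \o g)%VF]comp_lfunA fg comp_lfun1r.
Qed.

Lemma isomorphicE (M N : rep R) : isomorphic M N ->
  exists f : 'Hom(M, N), [/\ is_hom f, injective f & limg f = fullv].
Proof.
case=> f [g [fh gh gf fg]]; exists f; split => //.
  by apply: (can_inj (g := g)) => v; rewrite -comp_lfunE gf id_lfunE.
apply/vspaceP => v; rewrite memvf; have -> : v = f (g v) by rewrite -comp_lfunE fg id_lfunE.
by rewrite memv_img ?memvf.
Qed.

Section Casimir.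
Variables (M N : rep R) (f : 'Hom(M, N)).
Hypothesis fh : is_hom f.

Lemma hom_opV v : lker (opK M) == 0%VS -> lker (opK N) == 0%VS ->
  f ((opK M)^-1%VF v) = (opK N)^-1%VF (f v).
Proof.
move=> KM KN; have [_ _ fK] := (hom_eltP f).1 fh.
have /lker0P inj := KN; apply: inj; rewrite -fK -![opK _ _]comp_lfunE !lker0_compfV //.
by rewrite !id_lfunE.
Qed.

Lemma module_inj : is_module p N -> injective f -> is_module p M.
Proof.
move=> HN finj; have [fE fF fK] := (hom_eltP f).1 fh.
have K1 : lpow (opK M) (2 * p) = \1%VF.
  apply/lfunP => v; apply: finj; rewrite lpowE id_lfunE -[RHS](opK_2p HN).
  by elim: (2 * p)%N => //= n <-; rewrite fK.
have KM : lker (opK M) == 0%VS.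
  have /lker0P Kinj := opK_inj hp HN.
  by apply/lker0P => v w vw; apply: finj; apply: Kinj; rewrite -!fK vw.
have fV v := hom_opV v KM (opK_inj hp HN).
case: (HN) => [_ _ HE HF HEF]; split => //.
- split; apply/lfunP => v; apply: finj; rewrite lpowE lfunE /= lfun0.
    by rewrite (hom_iterE _ _ fh) (opE_p HN).
  by rewrite (hom_iterF _ _ fh) (opF_p HN).
- apply/lfunP => v; apply: finj; have := congr1 (fun g : 'End(N) => g (f v)) HE.
  by rewrite !scale_lfunE lfunZ !comp_lfunE fK fE fV fE.
- apply/lfunP => v; apply: finj; have := congr1 (fun g : 'End(N) => g (f v)) HF.
  by rewrite !scale_lfunE lfunZ !comp_lfunE fK fF fV fF.
- apply/lfunP => v; apply: finj; have := congr1 (fun g : 'End(N) => g (f v)) HEF.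
  by rewrite !scale_lfunE !add_lfunE !opp_lfunE !comp_lfunE lfunZ !lfunB fV fK !(fE, fF).
Qed.

Hypothesis HM : is_module p M.
Hypothesis HN : is_module p N.

Lemma hom_cas v : f (casimir p M v) = casimir p N (f v).
Proof.
have [fE fF fK] := (hom_eltP f).1 fh.
rewrite !casimirE lfun_lin3 fF fE fK.
by rewrite hom_opV ?(opK_inj hp).
Qed.

Lemma hom_nilc b v : f (nilc p b M v) = nilc p b N (f v).
Proof. by rewrite !nilcE lfunB hom_cas lfunZ. Qed.

Lemma hom_pev P v : f (pev (casimir p M) P v) = pev (casimir p N) P (f v).
Proof.
rewrite -!comp_lfunE; congr (fun_of_lfun _ v); apply: pev_comm.
by apply/lfunP => w; rewrite !comp_lfunE hom_cas.
Qed.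
End Casimir.

Section Subrep.
Variable M : rep R.
Hypothesis HM : is_module p M.

Lemma cas_pev_hom P : is_hom (pev (casimir p M) P).
Proof.
by apply/hom_eltP; split=> v; rewrite -!comp_lfunE; congr (fun_of_lfun _ v); apply/esym/pev_comm;
  apply/lfunP => w; rewrite !comp_lfunE ?cas_E ?cas_F ?cas_K.
Qed.

Definition subrep (U : {vspace M}) : rep R :=
  @Rep R (subvs_of U) (linfun (vsproj U \o opE M \o vsval))
    (linfun (vsproj U \o opF M \o vsval)) (linfun (vsproj U \o opK M \o vsval)).

Definition subincl (U : {vspace M}) : 'Hom(subrep U, M) := linfun (@vsval _ _ U).

Lemma subinclE U v : subincl U v = vsval v. Proof. by rewrite lfunE. Qed.

Lemma subincl_hom U : is_submodule U -> is_hom (subincl U).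
Proof.
move=> /submoduleE [UE UF UK]; apply/hom_eltP.
by split=> v; rewrite !subinclE /= lfunE /= vsprojK ?UE ?UF ?UK ?subvsP.
Qed.

Lemma subincl_inj U : injective (subincl U).
Proof. by move=> v w; rewrite !subinclE => /subvs_inj. Qed.

Lemma subrep_module U : is_submodule U -> is_module p (subrep U).
Proof. by move=> sU; apply: (module_inj (subincl_hom sU) HM); apply: subincl_inj. Qed.

Definition subproj (e : 'End(M)) : 'Hom(M, subrep (limg e)) := linfun (vsproj (limg e) \o e).

Lemma subprojE e v : subincl _ (subproj e v) = e v.
Proof. by rewrite subinclE lfunE /= vsprojK // memv_img ?memvf. Qed.

Lemma subproj_hom e : is_hom e -> is_hom (subproj e).
Proof.
move=> eh; have [eE eF eK] := (hom_eltP e).1 eh.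
have [iE iF iK] := (hom_eltP _).1 (subincl_hom (limg_submodule eh)).
by apply/hom_eltP; split=> v; apply: subincl_inj; rewrite ?iE ?iF ?iK !subprojE.
Qed.

Lemma idempotents_dsum (I : finType) (e : I -> 'End(M)) :
  (forall i, is_hom (e i)) -> (forall i j, i != j -> (e i \o e j)%VF = 0) ->
  \sum_i e i = \1%VF -> is_dsum (fun i => subrep (limg (e i))) M.
Proof.
move=> eh eo es.
(* Idempotence is a consequence of orthogonality and of the sum being 1. *)
have ee i v : e i (e i v) = e i v.
  have := congr1 (fun f : 'End(M) => f (e i v)) es.
  rewrite sum_lfunE id_lfunE (bigD1 i) //= big1 ?addr0 // => j ji.
  by rewrite -comp_lfunE eo // lfunE.
exists (fun i => subincl _), (fun i => subproj (e i)); split.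
- by split=> i; [apply/subincl_hom/limg_submodule|apply: subproj_hom].
- move=> i; apply/lfunP => v; apply: subincl_inj; rewrite comp_lfunE id_lfunE subprojE subinclE.
  by have /memv_imgP [w _ ->] := subvsP v; rewrite ee.
- move=> i j ij; apply/lfunP => v; apply: subincl_inj; rewrite comp_lfunE zero_lfunE lfun0 subprojE subinclE.
  by have /memv_imgP [w _ ->] := subvsP v; rewrite -comp_lfunE eo ?zero_lfunE // eq_sym.
- rewrite -es; apply: eq_bigr => i _; apply/lfunP => v; rewrite comp_lfunE subprojE //.
Qed.
End Subrep.
End Homs.

(** * Decomposition of the category into blocks *)

Section BlockDecomposition.
Variables (R : realType) (p : nat).
Hypothesis hp : (1 < p)%N.
Local Notation q := (qroot R p).
Local Notation h := (q - q^-1).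
Local Notation q0 := (qroot_neq0 R hp).
Local Notation gam := (@gam R p).
Local Notation topw := (@topw R p).

Definition cas_value (i : nat) : R[i] := (q ^+ i + q ^- i) / h ^+ 2.
Local Notation bt := cas_value.

Lemma gam_exp m : gam (q ^+ m) = bt m.+1.
Proof. by rewrite /gam -exprS. Qed.

Lemma gam_top1 s : gam (topw 1 s) = bt s.
Proof. by rewrite (gam_topw hp) ?mulr1 // mul1r. Qed.

Lemma cas_value_periodic i : bt (2 * p + i) = bt i.
Proof. by rewrite /bt exprD qroot_2p // mul1r. Qed.

Lemma cas_value_sym i : (i <= 2 * p)%N -> bt (2 * p - i) = bt i.
Proof.
move=> ip; have e : q ^+ (2 * p - i) = q ^- i.
  apply: (mulIf (expf_neq0 i q0)); rewrite mulVf ?expf_neq0 ?q0 //.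
  by rewrite -exprD subnK // qroot_2p.
by rewrite /bt e invrK addrC.
Qed.

Lemma cas_value_inj i j : (i <= p)%N -> (j <= p)%N -> bt i = bt j -> i = j.
Proof.
move=> ip jp /(mulIf _) H; have {}H : q ^+ i + q ^- i = q ^+ j + q ^- j.
  by apply: H; rewrite invr_neq0 // expf_neq0 // qdiff_neq0.
wlog ij : i j ip jp H / (i <= j)%N.
  move=> W; case: (leqP i j) => [/W->//|/ltnW ji].
  by apply/esym/W.
have [e|e] := inv_sum_eq (expf_neq0 i q0) (expf_neq0 j q0) H.
  have : q ^+ (j - i) == 1.
    by rewrite -(inj_eq (mulIf (expf_neq0 i q0))) mul1r -exprD subnK // e.
  rewrite qroot_exp1 // => d; case: (posnP (j - i)) => [|ji]; first by lia.
  by have := dvdn_leq ji d; lia.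
move/eqP: e; rewrite -exprD qroot_exp1 // => d.
case: (posnP (i + j)) => [|ji]; first by lia.
by have := dvdn_leq ji d; lia.
Qed.

Lemma prod_even_odd (g : nat -> {poly R[i]}) n :
  \prod_(i < 2 * n) g i = (\prod_(j < n) g (2 * j)%N) * \prod_(j < n) g (2 * j).+1.
Proof.
elim: n => [|n IH]; first by rewrite !big_ord0 mulr1.
rewrite mulnS addnC !addnS addn0 !big_ord_recr /= IH; ring.
Qed.

Lemma prod_shift (g : nat -> {poly R[i]}) n m : (forall i, g (n + i)%N = g i) ->
  \prod_(i < n) g (m + i)%N = \prod_(i < n) g i.
Proof.
case: n => [|n] gn; first by rewrite !big_ord0.
elim: m => [//|m IH]; rewrite -IH big_ord_recr [RHS]big_ord_recl /= addn0 mulrC.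
have -> : g (m.+1 + n)%N = g m by rewrite -(gn m); congr g; lia.
by congr (_ * _); apply: eq_bigr => i _; congr g; rewrite /bump; lia.
Qed.

Definition cas_poly : {poly R[i]} := \prod_(i < 2 * p) ('X - (bt i)%:P).

(** On a vector of weight q^m, F^p E^p = 0 is a polynomial in the Casimir element with roots
    [bt (m.+1 + 2 * j)], indices of a single parity. Taking both parities gives a polynomial
    independent of m. *)
Lemma casimir_annihilated (M : rep R) : is_module p M -> pev (casimir p M) cas_poly = 0.
Proof.
move=> HM; apply/lfunP => v; rewrite zero_lfunE.
have [e /(_ M HM) [ew edec _]] := wt_polys R hp.
rewrite [v]edec lfun_sum big1 // => m _; move: (pev _ _ v) (ew m v) => {}v wv.
have k0 : q ^+ m != 0 by rewrite expf_neq0 ?q0.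
pose g i : {poly R[i]} := 'X - (bt i)%:P.
have gE : cas_poly = (\prod_(j < p) g (m.+1 + 2 * j)%N) * \prod_(j < p) g (m.+1 + (2 * j).+1)%N.
  rewrite -(prod_even_odd (fun i => g (m.+1 + i)%N)) (@prod_shift g) //.
  by move=> i; rewrite /g cas_value_periodic.
apply: (@pev_dvdv0 _ _ _ (\prod_(j < p) g (m.+1 + 2 * j)%N)); first by rewrite gE dvdp_mulIl.
have := FnEn hp HM p k0 wv; rewrite (opE_p HM) lfun_iter0 => /esym.
congr (fun_of_lfun (pev _ _) _ = _); apply: eq_bigr => j _; congr ('X - _%:P).
by rewrite -exprD gam_exp; congr bt; lia.
Qed.

(* The Casimir element acts on modX p 1 s by cas_value s, and on modX p (-1) (p - s) as well;
   since the components 0 and p are those of modX p 1 p and modX p (-1) p, the two end values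
   are exchanged. *)
Definition block_index (i : nat) : nat := if i == 0%N then p else if i == p then 0%N else i.
Definition block_mult (i : nat) : nat := if (i == 0%N) || (i == p) then 1 else 2.
Definition block_poly (i : nat) : {poly R[i]} := ('X - (bt (block_index i))%:P) ^+ block_mult i.

Definition in_block (i : 'I_p.+1) (M : rep R) : Prop :=
  is_module p M /\ pev (casimir p M) (block_poly i) = 0.

Lemma block_poly_coprime (i j : 'I_p.+1) : i != j -> coprimep (block_poly i) (block_poly j).
Proof.
move=> ij; apply/coprimep_expl/coprimep_expr/coprimep_XsubC2.
rewrite subr_eq0; apply/eqP => /cas_value_inj H; case/eqP: ij; apply: val_inj => /=.
have := leq_ord i; have := leq_ord j; move: H; rewrite /block_index.
do 4?case: eqP => /=; lia.
Qed.

(** The indices i and 2p - i give the same root; only 0 and p are alone, which explains the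
    multiplicities in [block_mult]. *)
Lemma block_poly_prod : \prod_(i < p.+1) block_poly i = cas_poly.
Proof.
have gE : cas_poly = \prod_(i < 2 * p) ('X - (bt i)%:P) by [].
pose g i : {poly R[i]} := 'X - (bt i)%:P.
have p1 : p = p.-1.+1 by lia.
have -> : \prod_(i < p.+1) block_poly i = g p * (\prod_(i < p.-1) (g i.+1 * g i.+1)) * g 0%N.
  rewrite big_ord_recr /=; congr (_ * _); last first.
    by rewrite /block_poly /block_index /block_mult /= eqxx gtn_eqF ?orbT // ltnW.
  rewrite -(big_mkord xpredT block_poly) big_ltn ?big_add1 ?big_mkord; last by lia.
  congr (_ * _); apply: eq_bigr => i _; rewrite /block_poly /block_index /block_mult /=.
  by rewrite ltn_eqF ?expr2 //; have := ltn_ord i; lia.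
rewrite gE (_ : (2 * p = p + p)%N); last by lia.
have p0 : (0 < p)%N by lia.
have half (f : nat -> {poly R[i]}) : \prod_(i < p) f i = f 0%N * \prod_(i < p.-1) f i.+1.
  by rewrite -(big_mkord xpredT f) big_ltn // big_add1 big_mkord.
rewrite big_split_ord /= (half g) (half (fun i => g (p + i)%N)) addn0.
have -> : \prod_(i < p.-1) g (p + i.+1)%N = \prod_(i < p.-1) g i.+1.
  rewrite (reindex_inj rev_ord_inj) /=; apply: eq_bigr => i _; congr ('X - _%:P).
  rewrite -(@cas_value_sym i.+1); last by have := ltn_ord i; lia.
  by congr bt; have := ltn_ord i; lia.
by rewrite big_split /=; ring.
Qed.

Lemma in_block_iso i (M N : rep R) : in_block i M -> is_module p N -> isomorphic M N -> in_block i N.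
Proof.
move=> [HM QM] HN /isomorphicE [f [fh _ fN]]; split => //; apply/lfunP => v.
have : v \in limg f by rewrite fN memvf.
by case/memv_imgP => w _ ->; rewrite -(hom_pev hp fh HM HN) QM !zero_lfunE lfun0.
Qed.

(** Both block polynomials kill f v, and they are coprime. *)
Lemma in_block_orth i j (M N : rep R) (f : 'Hom(M, N)) :
  i != j -> in_block i M -> in_block j N -> is_hom f -> f = 0.
Proof.
move=> ij [HM QM] [HN QN] fh; apply/lfunP => v; rewrite zero_lfunE.
have [[u w] /= uw] := Bezout_eq1_coprimepP _ _ (block_poly_coprime ij).
have := pev1 (casimir p N); rewrite -uw pevD !pevM QN comp_lfun0r addr0.
move/(congr1 (fun g : 'End(N) => g (f v))); rewrite comp_lfunE id_lfunE => <-.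
by rewrite -(hom_pev hp fh HM HN) QM zero_lfunE !lfun0.
Qed.

Lemma block_idempotents : exists e : 'I_p.+1 -> {poly R[i]},
  [/\ forall i j : 'I_p.+1, i != j -> block_poly j %| e i,
      forall (M : rep R) (i j : 'I_p.+1), is_module p M -> i != j ->
        (pev (casimir p M) (e i) \o pev (casimir p M) (e j))%VF = 0,
      forall (M : rep R), is_module p M -> \sum_i pev (casimir p M) (e i) = \1%VF &
      forall (M : rep R) (i : 'I_p.+1), is_module p M ->
        (pev (casimir p M) (block_poly i) \o pev (casimir p M) (e i))%VF = 0].
Proof.
have [e [e1 e2 e3]] := poly_CRT block_poly_coprime.
have ann (M : rep R) P : is_module p M -> \prod_(j < p.+1) block_poly j %| P -> pev (casimir p M) P = 0.
  by move=> HM /pev_dvd0; apply; rewrite block_poly_prod; apply: casimir_annihilated.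
have es (M : rep R) : is_module p M -> \sum_i pev (casimir p M) (e i) = \1%VF.
  move=> HM; have := ann M _ HM e3; rewrite pevB pev1 pev_sum => /eqP.
  by rewrite subr_eq0 => /eqP.
exists e; split => //.
- move=> M i j HM ij; rewrite -pevM; apply: ann => //.
  apply: coprime_prod_dvdp; first exact: block_poly_coprime.
  move=> k; have [->|ki] := eqVneq k i; first by rewrite dvdp_mull // e1 // eq_sym.
  by rewrite dvdp_mulr // e1 // eq_sym.
- by move=> M i HM; rewrite -pevM; apply: ann.
Qed.

Lemma block_decomposition : is_decomposition p in_block.
Proof.
split; first by move=> i M [].
- exact: in_block_iso.
- exact: in_block_orth.
move=> M HM; have [e [_ e1 e2 e3]] := block_idempotents.
have eh i := cas_pev_hom hp HM (e i).
exists (fun i => subrep (limg (pev (casimir p M) (e i)))); split; last first.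
  apply: idempotents_dsum => //; last exact: e2.
  by move=> i j; apply: e1.
move=> i; have sU := limg_submodule (eh i).
have HS := subrep_module hp HM sU; split => //.
apply/lfunP => v; apply: subincl_inj; rewrite (hom_pev hp (subincl_hom sU) HS HM) zero_lfunE lfun0 subinclE.
by have /memv_imgP [w _ ->] := subvsP v; rewrite -comp_lfunE e3 ?zero_lfunE.
Qed.

(** For lifting problems: when the target vector g m already lies in block i, a preimage can be
    moved into the block component of [M] without changing its image. *)
Lemma block_component (M : rep R) i : is_module p M ->
  exists (S : rep R) (inj : 'Hom(S, M)),
    [/\ in_block i S, is_hom inj &
     forall (N : rep R) (g : 'Hom(M, N)) m, is_module p N -> is_hom g ->
       pev (casimir p N) (block_poly i) (g m) = 0 -> exists t, g (inj t) = g m].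
Proof.
move=> HM; have [e [e0 _ e2 e3]] := block_idempotents.
have eh := cas_pev_hom hp HM (e i); have sU := limg_submodule eh.
have HS := subrep_module hp HM sU.
exists (subrep (limg (pev (casimir p M) (e i)))), (subincl _); split.
- split => //; apply/lfunP => v; apply: subincl_inj.
  rewrite (hom_pev hp (subincl_hom sU) HS HM) zero_lfunE lfun0 subinclE.
  by have /memv_imgP [w _ ->] := subvsP v; rewrite -comp_lfunE e3 ?zero_lfunE.
- exact: subincl_hom.
move=> N g m HN gh Qgm.
exists (subproj (pev (casimir p M) (e i)) m); rewrite subprojE (hom_pev hp gh HM HN).
have := congr1 (fun f : 'End(N) => f (g m)) (e2 N HN); rewrite sum_lfunE id_lfunE (bigD1 i) //=.
rewrite big1 ?addr0 // => j ji; apply: pev_dvdv0 Qgm; exact: e0.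
Qed.

End BlockDecomposition.

(** * Projective modules *)

Section SignBlocks.
Variables (R : realType) (p : nat).
Hypothesis hp : (1 < p)%N.
Local Notation q := (qroot R p).
Local Notation q0 := (qroot_neq0 R hp).
Local Notation gam := (@gam R p).
Local Notation topw := (@topw R p).
Local Notation br := (qnum R p).
Local Notation cf a s k := (a * br k * br (s - k)%N).

(** The middle blocks, indexed by a sign and s rather than by one index, so that each block can be
    entered from either of its two kinds of top. *)
Definition sblock (a : R[i]) (s : nat) (M : rep R) : Prop :=
  is_module p M /\
  forall v : M, nilc p (gam (topw a s)) M (nilc p (gam (topw a s)) M v) = 0.

Lemma sblock_flip a s M : a * a = 1 -> (s <= p)%N -> sblock a s M <-> sblock (- a) (p - s) M.
Proof. by move=> aa sp; rewrite /sblock (gam_flip hp). Qed.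

Lemma nilc_pev b (M : rep R) v : nilc p b M v = pev (casimir p M) ('X - b%:P) v.
Proof. by rewrite pev_XsubC nilcE. Qed.

Lemma in_block_mid (s : 'I_p.+1) (M : rep R) : (0 < s < p)%N ->
  in_block s M <-> sblock 1 s M.
Proof.
case/andP=> s0 sp; rewrite /in_block /block_poly /block_index /block_mult.
rewrite !(gtn_eqF s0) (ltn_eqF sp) /sblock gam_top1 // expr2 pevM.
split=> -[HM H]; split => //; [move=> v|apply/lfunP => v].
  by rewrite !nilc_pev -comp_lfunE H zero_lfunE.
by rewrite comp_lfunE -!nilc_pev H zero_lfunE.
Qed.

Lemma in_block0 (M : rep R) :
  @in_block R p ord0 M <-> is_module p M /\ forall v : M, nilc p (gam (topw 1 p)) M v = 0.
Proof.
rewrite /in_block /block_poly /block_index /block_mult /= expr1 gam_top1 //.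
split=> -[HM H]; split => //; [move=> v|apply/lfunP => v].
  by rewrite nilc_pev H zero_lfunE.
by rewrite -nilc_pev H zero_lfunE.
Qed.

Lemma in_block_max (M : rep R) :
  @in_block R p ord_max M <-> is_module p M /\ forall v : M, nilc p (gam (topw (- 1) p)) M v = 0.
Proof.
have := gam_flip hp (mulr1 (1 : R[i])) (leq0n p); rewrite subn0 => ->.
rewrite /in_block /block_poly /block_index /block_mult /= gtn_eqF 1?ltnW // eqxx /= expr1 gam_top1 //.
split=> -[HM H]; split => //; [move=> v|apply/lfunP => v].
  by rewrite nilc_pev H zero_lfunE.
by rewrite -nilc_pev H zero_lfunE.
Qed.

Lemma nilc_hom b (M : rep R) : is_module p M -> is_hom (nilc p b M).
Proof.
move=> HM; apply/hom_eltP; split=> v.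
- exact: nilc_E.
- exact: nilc_F.
- exact: nilc_K.
Qed.

Lemma q_exp_inj n m (t : R[i]) : t != 0 -> (n < p)%N -> (m < p)%N ->
  q ^- (2 * n) * t = q ^- (2 * m) * t -> n = m.
Proof.
move=> t0 np mp /(mulIf t0) /invr_inj.
wlog nm : n m np mp / (n <= m)%N.
  by move=> W H; case: (leqP n m) => [nm|/ltnW nm]; [apply: W|apply/esym/W].
move=> H; have : q ^+ (2 * m - 2 * n) == 1.
  rewrite -(inj_eq (mulIf (expf_neq0 (2 * n) q0))) mul1r -exprD subnK ?H //; lia.
rewrite qroot_exp1 // => d; case: (posnP (2 * m - 2 * n)) => [|ji]; first by lia.
by have := dvdn_leq ji d; lia.
Qed.

Lemma wt_coord (I : finType) (e f k : I -> {ffun I -> R[i]^o}) (c : I -> R[i]) x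
    (v : Rep (lin_ext e) (lin_ext f) (lin_ext k)) i :
  (forall i, k i = c i *: dl R i) -> wt x v -> c i != x -> (v : {ffun _ -> _}) i = 0.
Proof.
move=> ki kv ci; have := congr1 (fun w : {ffun I -> R[i]^o} => w i) kv.
rewrite /= [v in LHS]dl_decomp lfun_sum sum_ffunE (bigD1 i) //= big1 ?addr0.
  rewrite lfunZ lin_ext_dl ki !ffunE eqxx => /eqP; rewrite -subr_eq0.
  rewrite -[_ *: _]/(_ * (_ * 1)) -[x *: _]/(x * _) mulr1 mulrC -mulrBl mulf_eq0 subr_eq0 (negPf ci).
  by move/eqP.
move=> j ji; rewrite lfunZ lin_ext_dl ki !ffunE eq_sym (negPf ji).
by rewrite !scaler0.
Qed.

Lemma dl_pair (I : finType) (v : {ffun I -> R[i]^o}) (j1 j2 : I) : j1 != j2 ->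
  (forall i, i != j1 -> i != j2 -> v i = 0) ->
  v = (v j1 : R[i]) *: dl R j1 + (v j2 : R[i]) *: dl R j2.
Proof.
move=> j12 v0; rewrite {1}[v]dl_decomp (bigD1 j1) //= (bigD1 j2) 1?eq_sym //= addrA.
rewrite [X in _ + X]big1 ?addr0 // => i /andP [i1 i2].
by rewrite v0 // scale0r.
Qed.

Lemma topw_exp_ord a s : a * a = 1 -> (0 < s)%N -> (s <= p)%N ->
  exists m : 'I_(2 * p), topw a s = q ^+ m.
Proof.
move=> aa s0 sp; have : a == 1 \/ a == -1 by apply/orP; rewrite -eqf_sqr expr2 aa expr1n.
have qs : q ^+ s / q = q ^+ s.-1 by rewrite -{1}(prednK s0) exprSr mulfK ?q0.
case=> /eqP ->.
  have m1 : (s.-1 < 2 * p)%N by lia.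
  by exists (Ordinal m1); rewrite /topw mul1r qs.
have m1 : (p + s.-1 < 2 * p)%N by lia.
by exists (Ordinal m1); rewrite /topw /= -mulrA qs exprD qroot_p.
Qed.

Lemma block_of_sign a s : a * a = 1 -> (0 < s)%N -> (s < p)%N ->
  exists i : 'I_p.+1, (0 < i < p)%N /\ forall M, in_block i M <-> sblock a s M.
Proof.
move=> aa s0 sp; have : a == 1 \/ a == -1 by apply/orP; rewrite -eqf_sqr expr2 aa expr1n.
case=> /eqP ->.
  exists (inord s); rewrite inordK ?s0 ?sp //; last by lia.
  split => // M; have := @in_block_mid (inord s) M; rewrite inordK; last by lia.
  by apply; rewrite s0 sp.
exists (inord (p - s)); rewrite inordK; last by lia.
split => [|M]; first by lia.
have := @in_block_mid (inord (p - s)) M; rewrite inordK; last by lia.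
have -> : sblock (-1) s M <-> sblock 1 (p - s) M.
  by have := @sblock_flip (-1) s M; rewrite mulrNN mulr1 opprK; apply=> //; apply: ltnW.
by apply; lia.
Qed.

Section Projective.
Variables (a : R[i]) (s : nat).
Hypothesis aa : a * a = 1.
Hypothesis s0 : (0 < s)%N.
Hypothesis sp : (s < p)%N.
Local Notation b := (gam (topw a s)).
Local Notation is_modP := (is_modP p a s).
Let sp' := ltnW sp.
Let hb' : b = gam (topw (- a) (p - s)). Proof. by rewrite gam_flip. Qed.

Lemma singular_nilc (M : rep R) c t (v : M) : is_module p M -> c * c = 1 ->
  wt (topw c t) v -> opE M v = 0 -> nilc p (gam (topw c t)) M v = 0.
Proof.
by move=> HM cc kv Ev; rewrite nilcE -(FE_wt hp HM (topw_neq0 hp t cc) kv) Ev lfun0.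
Qed.

(** The universal property of P: any v of top weight serves as b_0. Then b and y are the string F^n
    v cut at n = s, a is the string of N v, and x is the string ending in E v. *)
Lemma block_modP (M : rep R) (v : M) : sblock a s M -> wt (topw a s) v ->
  exists vb va vx vy : nat -> M, [/\ is_modP vb va vx vy, vb 0%N = v & va 0%N = nilc p b M v].
Proof.
move=> [HM HN] kv; set N := nilc p b M.
have [x [kx Ex Fx Fx']] := topE_source hp HM HN aa s0 sp erefl kv.
have FN := top_FN hp HM HN aa s0 sp erefl kv.
have EN := top_EN hp HM HN aa s0 sp erefl kv.
have kN : wt (topw a s) (N v) by apply: nilc_wt.
have Nx : N x = 0 by rewrite /N hb'; apply: singular_nilc => //; apply: signN.
have kw := top_down hp HM sp kv.
exists (fun n => if (n < s)%N then iter n (opF M) v else 0), (fun n => iter n (opF M) (N v)),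
  (fun k => if (k < p - s)%N then iter k (opF M) x else 0), (fun k => iter (s + k) (opF M) v).
have p_s : (0 < p - s)%N by lia.
split; [|by rewrite s0|by []].
split; cbv beta.
- by move=> n; rewrite ltnNge => ->.
- by move=> n sn; apply: lfun_iter_out FN.
- by move=> k; rewrite ltnNge => ->.
- by move=> k sk; apply: lfun_iter_out (opF_p HM v); lia.
- by move=> n; case: ifP => _; [apply: wt_iterF|apply: wt0].
- by move=> n; apply: wt_iterF.
- by move=> n; case: ifP => _; [apply: wt_iterF|apply: wt0].
- by move=> k; rewrite addnC iterD; apply: wt_iterF.
- by rewrite s0 ltn_predL p_s.
- move=> n ns; rewrite ns (ltnW ns) (string_E hp HM aa erefl kv) //; exact: ltnW.
- move=> [|n]; first by rewrite /= EN (cf0 hp) scale0r.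
  case: (ltnP n s) => ns; last first.
    rewrite (lfun_iter_out (leq_trans ns (leqnSn n)) FN) lfun0.
    by rewrite (lfun_iter_out ns FN) scaler0.
  by rewrite (string_E hp HM aa erefl kN ns) HN lfun_iter0 addr0.
- move=> [|k]; first by rewrite p_s /= Ex (cf0 hp) scale0r.
  case: ifP => ks; last by rewrite lfun0 (cf_out hp) ?scale0r // leqNgt ks.
  rewrite ltnW // (string_E hp HM (signN aa) hb' kx) ?(ltnW ks) //.
  by rewrite -/N Nx lfun_iter0 addr0.
- rewrite addn0 -{1}(prednK s0) (string_E hp HM aa erefl kv) ?prednK //.
  by rewrite (cf_out hp _ (leqnn s)) scale0r add0r.
- move=> k; rewrite addnC iterD [(s + k)%N]addnC iterD.
  case: (ltnP k (p - s)) => ks.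
    rewrite (string_E hp HM (signN aa) hb' kw) // (nilc_iterF hp _ HM) FN.
    by rewrite lfun_iter0 addr0.
  have z n : (p <= n)%N -> iter n (opF M) v = 0 by move=> pn; apply: lfun_iter_out (opF_p HM v).
  by rewrite -!iterD !z ?lfun0 ?scaler0 //; lia.
- move=> n ns; case: ifP => ns'; last first.
    by rewrite lfun0 ifN // -leqNgt; apply: leqW; rewrite leqNgt ns'.
  by rewrite ifT //; lia.
- by rewrite ltn_predL s0 -iterS prednK // addn0.
- by move=> n.
- move=> k kn; case: ifP => ks; last first.
    by rewrite lfun0 ifN // -leqNgt; apply: leqW; rewrite leqNgt ks.
  by rewrite ifT //; lia.
- by rewrite ltn_predL p_s -iterS prednK.
- by move=> k; rewrite addnS.
Qed.

(** E b_0 is the end of the x string. Powers of E climb this string with nonzero coefficients, and F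
    then gives a from x and y from b. *)
Lemma modP_gen (M : rep R) (vb va vx vy : nat -> M) (U : {vspace M}) : is_modP vb va vx vy ->
  is_submodule U -> vb 0%N \in U ->
  [/\ forall n, vb n \in U, forall n, va n \in U, forall k, vx k \in U & forall k, vy k \in U].
Proof.
move=> H /submoduleE [UE UF _] b0.
have Ub n : vb n \in U.
  elim: n => // n IH; case: (eqVneq n s.-1) => [ns|ns]; last by rewrite -(mP_Fb H ns) UF.
  by rewrite (mP_bout H) ?mem0v // ns prednK.
have Ux j : vx ((p - s).-1 - j)%N \in U.
  elim: j => [|j IH]; first by rewrite subn0 -(mP_Eb0 H) UE.
  case: (ltnP j (p - s).-1) => jp; last by move: IH; rewrite (_ : _ - j.+1 = (p - s).-1 - j)%N //; lia.
  have e : ((p - s).-1 - j = ((p - s).-1 - j.+1).+1)%N by lia.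
  have := UE _ IH; rewrite e (mP_Ex H) /=.
  set c := (_ * _) => cU; have c0 : c != 0.
    by rewrite /c; apply: mulf_neq0; [apply: mulf_neq0; first exact: sign_neq0 (signN aa)|]; apply: qnum_neq0; lia.
  by rewrite -[X in X \in U](scalerK c0) rpredZ.
have Ux' k : vx k \in U.
  case: (ltnP k (p - s)) => kp; last by rewrite (mP_xout H) ?mem0v.
  by have := Ux ((p - s).-1 - k)%N; rewrite subKn //; lia.
have Ua n : va n \in U.
  elim: n => [|n IH]; first by rewrite -(mP_Fxlast H) UF.
  by rewrite -(mP_Fa H) UF.
have Uy k : vy k \in U.
  elim: k => [|k IH]; first by rewrite -(mP_Fblast H) UF.
  by rewrite -(mP_Fy H) UF.
by split.
Qed.

Local Notation P := (modP p a s).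
Let PP : is_modP (vPb p a s) (vPa p a s) (vPx p a s) (vPy p a s) := modP_modP hp a s0 sp.

Lemma P_full (U : {vspace P}) : is_submodule U -> vPb p a s 0 \in U -> U = fullv.
Proof.
move=> sU b0; have [Ub Ua Ux Uy] := modP_gen PP sU b0.
apply/vspaceP => v; rewrite memvf [v]dl_decomp; apply: rpred_sum => -[[n|n]|[k|k]] _; apply: rpredZ.
- by have := Ub n; rewrite /vPb bvec_ord.
- by have := Ua n; rewrite /vPa bvec_ord.
- by have := Ux k; rewrite /vPx bvec_ord.
- by have := Uy k; rewrite /vPy bvec_ord.
Qed.

Lemma P_ext (M : rep R) (f g : 'Hom(P, M)) : is_hom f -> is_hom g ->
  f (vPb p a s 0) = g (vPb p a s 0) -> f = g.
Proof.
move=> fh gh fg; have sU := lker_submodule (hom_sub fh gh).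
have := P_full sU; rewrite memv_ker add_lfunE opp_lfunE fg subrr eqxx => /(_ isT) U1.
apply/lfunP => v; have : v \in lker (f - g) by rewrite U1 memvf.
by move/eqlfunP.
Qed.

Lemma P_in_module : is_module p P. Proof. exact: P_module. Qed.

Lemma modP_nilc (M : rep R) (vb va vx vy : nat -> M) : is_module p M -> is_modP vb va vx vy ->
  nilc p b M (vb 0%N) = va 0%N /\ nilc p b M (va 0%N) = 0.
Proof.
move=> HM H; have top0 := topw_neq0 hp s aa.
have kb : wt (topw a s) (vb 0%N) by have := mP_Kb H 0; rewrite muln0 expr0 invr1 mul1r.
have ka : wt (topw a s) (va 0%N) by have := mP_Ka H 0; rewrite muln0 expr0 invr1 mul1r.
split; rewrite nilcE -(FE_wt hp HM top0) //.
  by rewrite (mP_Eb0 H) (mP_Fxlast H).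
by rewrite (mP_Ea H) (cf0 hp) scale0r lfun0.
Qed.

Definition P_nilc := modP_nilc P_in_module PP.

Lemma P_sblock : sblock a s P.
Proof.
have HP := P_in_module; split => // v; have [Nb Na] := P_nilc.
have nh := nilc_hom b HP; have := P_full (lker_submodule (hom_comp nh nh)).
rewrite memv_ker comp_lfunE Nb Na eqxx => /(_ isT) U1.
have : v \in lker (nilc p b P \o nilc p b P)%VF by rewrite U1 memvf.
by rewrite memv_ker comp_lfunE => /eqP.
Qed.

Lemma P_neq0 : [/\ vPb p a s 0 != 0, vPa p a s 0 != 0, vPx p a s (p - s).-1 != 0 & vPa p a s s.-1 != 0].
Proof.
have dl0 i : dl R i != 0 :> {ffun (('I_s + 'I_s) + ('I_(p - s) + 'I_(p - s)))%type -> R[i]^o}.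
  apply/eqP => /ffunP /(_ i); rewrite !ffunE eqxx => /eqP.
  by rewrite oner_eq0.
have s1 : (s.-1 < s)%N by lia.
have ps1 : ((p - s).-1 < p - s)%N by lia.
split.
- by have := dl0 (inl (inl (Ordinal s0))); rewrite -(bvec_ord R (fun n' : 'I_s => inl (inl n'))).
- by have := dl0 (inl (inr (Ordinal s0))); rewrite -(bvec_ord R (fun n' : 'I_s => inl (inr n'))).
- by have := dl0 (inr (inl (Ordinal ps1))); rewrite -(bvec_ord R (fun n' : 'I_(p - s) => inr (inl n'))).
- by have := dl0 (inl (inr (Ordinal s1))); rewrite -(bvec_ord R (fun n' : 'I_s => inl (inr n'))).
Qed.

Lemma P_wt_coord (v : P) x i : wt x v -> @cP R p a s i != x -> (v : {ffun _ -> _}) i = 0.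
Proof. by apply: wt_coord; apply: P_weights. Qed.

Lemma P_top (v : P) : wt (topw a s) v ->
  exists x y, v = x *: vPb p a s 0 + y *: vPa p a s 0.
Proof.
move=> kv; pose j1 : 'I_s + 'I_s + ('I_(p - s) + 'I_(p - s)) := inl (inl (Ordinal s0)).
pose j2 : 'I_s + 'I_s + ('I_(p - s) + 'I_(p - s)) := inl (inr (Ordinal s0)).
exists ((v : {ffun _ -> _}) j1 : R[i]), ((v : {ffun _ -> _}) j2 : R[i]).
have -> : vPb p a s 0 = dl R j1 by rewrite -(bvec_ord R (fun n' : 'I_s => inl (inl n'))).
have -> : vPa p a s 0 = dl R j2 by rewrite -(bvec_ord R (fun n' : 'I_s => inl (inr n'))).
apply: dl_pair => //= i i1 i2; apply: (P_wt_coord kv); apply/eqP => e.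
have top0 := topw_neq0 hp s aa; have p0 : (0 < p)%N by lia.
have n0 n : (n < p)%N -> q ^- (2 * n) * topw a s = topw a s -> n = 0%N.
  by move=> np H; apply: (q_exp_inj top0 np p0); rewrite H muln0 expr0 invr1 mul1r.
have flip k : (k < p - s)%N -> q ^- (2 * k) * topw (- a) (p - s) <> topw a s.
  move=> kp; rewrite (topw_flip hp) // mulrA -invfM -exprD -mulnDr => /n0; lia.
case: i i1 i2 e => [[n|n]|[k|k]] /=.
- move=> /eqP i1 _ /n0 H; apply: i1; congr (inl (inl _)); apply: val_inj; apply: H.
  by have := ltn_ord n; lia.
- move=> _ /eqP i1 /n0 H; apply: i1; congr (inl (inr _)); apply: val_inj; apply: H.
  by have := ltn_ord n; lia.
- by move=> _ _ /flip; apply.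
- by move=> _ _ /flip; apply.
Qed.

Lemma P_bot (v : P) : wt (topw (- a) (p - s)) v ->
  exists x y, v = x *: vPx p a s 0 + y *: vPy p a s 0.
Proof.
have ps0 : (0 < p - s)%N by lia.
move=> kv; pose j1 : 'I_s + 'I_s + ('I_(p - s) + 'I_(p - s)) := inr (inl (Ordinal ps0)).
pose j2 : 'I_s + 'I_s + ('I_(p - s) + 'I_(p - s)) := inr (inr (Ordinal ps0)).
exists ((v : {ffun _ -> _}) j1 : R[i]), ((v : {ffun _ -> _}) j2 : R[i]).
have -> : vPx p a s 0 = dl R j1 by rewrite -(bvec_ord R (fun n' : 'I_(p - s) => inr (inl n'))).
have -> : vPy p a s 0 = dl R j2 by rewrite -(bvec_ord R (fun n' : 'I_(p - s) => inr (inr n'))).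
apply: dl_pair => //= i i1 i2; apply: (P_wt_coord kv); apply/eqP => e.
have top0 := topw_neq0 hp (p - s) (signN aa); have p0 : (0 < p)%N by lia.
have n0 n : (n < p)%N -> q ^- (2 * n) * topw (- a) (p - s) = topw (- a) (p - s) -> n = 0%N.
  by move=> np H; apply: (q_exp_inj top0 np p0); rewrite H muln0 expr0 invr1 mul1r.
have flip n : (n < s)%N -> q ^- (2 * n) * topw a s <> topw (- a) (p - s).
  by move=> ns; rewrite (topw_flip hp) // => /(q_exp_inj (topw_neq0 hp s aa)); lia.
case: i i1 i2 e => [[n|n]|[k|k]] /=; first by move=> _ _ /flip; apply.
- by move=> _ _ /flip; apply.
- move=> /eqP i1 _ /n0 H; apply: i1; congr (inr (inl _)); apply: val_inj; apply: H.
  by have := ltn_ord k; lia.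
move=> _ /eqP i1 /n0 H; apply: i1; congr (inr (inr _)); apply: val_inj; apply: H.
by have := ltn_ord k; lia.
Qed.

(** This shows that the socle is simple. In the top weight, E detects the b_0 component, and in the
    other weight the y_0 component, so v is a multiple of a_0 or of x_0; finally F^(p-s) x_0 =
    a_0. *)
Lemma modP_singular (M : rep R) (vb va vx vy : nat -> M) (U : {vspace M}) (v : M) x y :
  is_modP vb va vx vy -> is_submodule U -> v \in U -> v != 0 -> opE M v = 0 ->
  vx (p - s).-1 != 0 -> va s.-1 != 0 ->
  v = x *: vb 0%N + y *: va 0%N \/ v = x *: vx 0%N + y *: vy 0%N -> va 0%N \in U.
Proof.
move=> H sU vU v0 Ev x1 a1 [vE|vE].
  move: Ev; rewrite vE lfunD !lfunZ (mP_Eb0 H) (mP_Ea H) (cf0 hp).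
  rewrite scale0r scaler0 addr0 => /eqP; rewrite scaler_eq0 (negPf x1) orbF => /eqP x0.
  move: vE; rewrite x0 scale0r add0r => vE; have y0 : y != 0.
    by apply: contraNneq v0 => y0; rewrite vE y0 scale0r.
  by rewrite -[va _](scalerK y0) rpredZ // -vE.
move: Ev; rewrite vE lfunD !lfunZ (mP_Ey0 H) (mP_Ex H) (cf0 hp).
rewrite scale0r scaler0 add0r => /eqP; rewrite scaler_eq0 (negPf a1) orbF => /eqP y0.
move: vE; rewrite y0 scale0r addr0 => vE; have x0 : x != 0.
  by apply: contraNneq v0 => x0; rewrite vE x0 scale0r.
have xU : vx 0%N \in U by rewrite -[vx _](scalerK x0) rpredZ // -vE.
have FU : iter (p - s) (opF M) (vx 0%N) \in U by case: (submodule_iter (p - s) sU xU).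
have it k : (k < p - s)%N -> iter k (opF M) (vx 0%N) = vx k.
  by elim: k => //= k IH ks; rewrite IH ?(mP_Fx H) //; lia.
move: FU; rewrite (_ : (p - s = (p - s).-1.+1)%N); last by lia.
by rewrite iterS it ?(mP_Fxlast H) //; lia.
Qed.

Lemma P_socle (U : {vspace P}) : is_submodule U -> U != 0%VS -> vPa p a s 0 \in U.
Proof.
move=> sU U0; have [HP HN] := P_sblock; have [b0 a0 x1 a1] := P_neq0.
have [v [vU v0 Ev kv]] := block_sub_meet hp HP HN aa sp' erefl sU U0.
case: kv => kv; [have [x [y vE]] := P_top kv|have [x [y vE]] := P_bot kv].
  by apply: (modP_singular PP sU vU v0 Ev x1 a1 (x := x) (y := y)); left.
by apply: (modP_singular PP sU vU v0 Ev x1 a1 (x := x) (y := y)); right.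
Qed.

(** Two nonzero submodules both contain a_0 and so cannot be complementary. The kernel of N is a
    proper nonzero submodule, since it contains a_0 and not b_0. *)
Lemma P_indecomposable : nonirr_indecomposable P.
Proof.
have [b0 a0 x1 a1] := P_neq0; have HP := P_in_module; split; first split.
- by apply: contraNneq a0 => P0; rewrite -memv0 -P0 memvf.
- move=> U V sU sV UV UIV; have [->|U0] := eqVneq U 0%VS; first by left.
  have [->|V0] := eqVneq V 0%VS; first by right.
  have : vPa p a s 0 \in (U :&: V)%VS by rewrite memv_cap !P_socle.
  by rewrite UIV memv0 (negPf a0).
case=> _ /(_ _ (lker_submodule (nilc_hom b HP))); have [Nb Na] := P_nilc; case=> Ker.
  by case/negP: a0; rewrite -memv0 -Ker memv_ker Na.
have : vPb p a s 0 \in lker (nilc p b P) by rewrite Ker memvf.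
by rewrite memv_ker Nb (negPf a0).
Qed.

(** A preimage of f(b_0) is corrected to lie in the right block and to have the top weight; the
    universal property then gives the lift. *)
Lemma P_projective : projective p P.
Proof.
split; first exact: P_in_module.
move=> M N g f HM HN gh fh gN.
have [i [i0 iP]] := block_of_sign aa s0 sp.
have [HP QP] := (iP _).2 P_sblock.
have kb : wt (topw a s) (vPb p a s 0) by have := mP_Kb PP 0; rewrite muln0 expr0 invr1 mul1r.
have : f (vPb p a s 0) \in limg g by rewrite gN memvf.
case/memv_imgP => m _ gm.
have [S [inj [BS injh compS]]] := block_component hp i HM.
have [|t gt] := compS _ g m HN gh; first by rewrite -gm -(hom_pev hp fh HP HN) QP zero_lfunE lfun0.
have SS := (iP _).1 BS; have [e ee] := wt_polys R hp.
have [j jE] := topw_exp_ord aa s0 sp'.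
have [eS _ _] := ee S SS.1; have [_ _ eN] := ee N HN.
(* g commutes with the weight projection, and g sends t to a vector that already has this weight, so
   the image is unchanged. *)
pose t' := pev (opK S) (e j) t.
have kt : wt (topw a s) t' by rewrite jE; apply: eS.
have [vb [va [vx [vy [H b0 _]]]]] := block_modP SS kt.
have Hh : is_hom (@homP R p a s S vb va vx vy) by apply: homP_is_hom.
exists (inj \o @homP R p a s S vb va vx vy)%VF; have hh := hom_comp Hh injh; split => //.
apply: P_ext => //; first exact: hom_comp.
rewrite !comp_lfunE (homP_b H) b0 gm -gt /t'.
have [_ _ ghK] := (hom_eltP _).1 (hom_comp injh gh).
have -> : g (inj (pev (opK S) (e j) t)) = pev (opK N) (e j) (g (inj t)).
  have cm : ((g \o inj) \o pev (opK S) (e j) = pev (opK N) (e j) \o (g \o inj))%VF.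
    by apply: pev_comm; case: (hom_comp injh gh).
  by have := congr1 (fun u : 'Hom(S, N) => u t) cm; rewrite !comp_lfunE.
rewrite gt -gm (eN j) ?eqxx ?scale1r // -jE.
exact: hom_wt.
Qed.
End Projective.
End SignBlocks.

(** * Contragredient modules and the splitting of P *)

Section Duality.
Variables (R : realType) (p : nat).
Hypothesis hp : (1 < p)%N.
Local Notation q := (qroot R p).
Local Notation gam := (@gam R p).
Local Notation topw := (@topw R p).

Section Dual.
Variable M : rep R.
Local Notation D := 'Hom(M, R[i]^o).

Definition precomp_fun (g : 'End(M)) (f : D) : D := (f \o g)%VF.

Lemma precomp_is_linear g : linear (precomp_fun g).
Proof. by move=> c f f'; rewrite /precomp_fun comp_lfunDl -comp_lfunZl. Qed.
HB.instance Definition _ g := GRing.isLinear.Build R[i] D D *:%R (precomp_fun g) (precomp_is_linear g).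

Definition precomp (g : 'End(M)) : 'End(D) := linfun (precomp_fun g).

(* Contragredient along the anti-automorphism exchanging E and F and fixing K. *)
Definition dual : rep R := @Rep R D (precomp (opF M)) (precomp (opE M)) (precomp (opK M)).

Lemma precompE g (f : D) v : precomp g f v = f (g v).
Proof. by rewrite lfunE /= /precomp_fun comp_lfunE. Qed.

Lemma iter_precomp g n (f : D) v : iter n (precomp g) f v = f (iter n g v).
Proof. by elim: n v => // n IH v; rewrite iterS precompE IH -iterSr. Qed.

Hypothesis HM : is_module p M.

Lemma dual_opV (f : D) v : lker (precomp (opK M)) == 0%VS ->
  (precomp (opK M))^-1%VF f v = f ((opK M)^-1%VF v).
Proof.
move=> K0; have : precomp (opK M) ((precomp (opK M))^-1%VF f) = f.
  by rewrite -comp_lfunE lker0_compfV // id_lfunE.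
move/(congr1 (fun g : D => g ((opK M)^-1%VF v))); rewrite precompE.
by rewrite (opKK hp HM).
Qed.

Lemma dual_K0 : lker (precomp (opK M)) == 0%VS.
Proof.
apply/lker0P => f g fg; apply/lfunP => v; have := congr1 (fun u : D => u ((opK M)^-1%VF v)) fg.
by rewrite !precompE (opKK hp HM).
Qed.

Lemma dual_module : is_module p dual.
Proof.
split.
- split; apply/lfunP => f; apply/lfunP => v; rewrite lpowE iter_precomp !zero_lfunE.
    by rewrite (opF_p HM) lfun0.
  by rewrite (opE_p HM) lfun0.
- by apply/lfunP => f; apply/lfunP => v; rewrite lpowE iter_precomp (opK_2p HM) id_lfunE.
- apply/lfunP => f; apply/lfunP => v; rewrite !comp_lfunE !scale_lfunE !precompE.
  by rewrite dual_opV ?dual_K0 // (opVF hp HM) (opVK hp HM) lfunZ.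
- apply/lfunP => f; apply/lfunP => v; rewrite !comp_lfunE !scale_lfunE !precompE.
  by rewrite dual_opV ?dual_K0 // (opVE hp HM) (opVK hp HM) lfunZ.
- apply/lfunP => f; apply/lfunP => v.
  rewrite !add_lfunE !opp_lfunE !comp_lfunE !scale_lfunE !add_lfunE !opp_lfunE !precompE.
  rewrite dual_opV ?dual_K0 // (opEF HM) lfunD addrC addKr lfunZ lfunB //.
Qed.

(** The anti-automorphism fixes F E and K, hence the Casimir element; so passing to the dual
    preserves blocks. *)
Lemma dual_cas (f : dual) v : casimir p dual f v = f (casimir p M v).
Proof.
rewrite !casimirE lfun_lin3 !add_lfunE !scale_lfunE !add_lfunE !scale_lfunE !precompE.
by rewrite dual_opV ?dual_K0.
Qed.

Lemma dual_nilc b (f : dual) v : nilc p b dual f v = f (nilc p b M v).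
Proof. by rewrite !nilcE lfunB lfunZ -dual_cas add_lfunE opp_lfunE scale_lfunE. Qed.

Lemma dual_sblock a s : sblock p a s M -> sblock p a s dual.
Proof.
case=> _ HN; split; first exact: dual_module.
by move=> f; apply/lfunP => v; rewrite !dual_nilc HN lfun0 zero_lfunE.
Qed.
End Dual.

Lemma functional_neq0 (V : vectType R[i]) (v : V) : v != 0 ->
  exists f : 'Hom(V, R[i]^o), f v != 0.
Proof.
move=> v0; have bv := vbasisP (fullv : {vspace V}).
have vE := coord_vbasis (memvf v).
have [i ci] : exists i, coord (vbasis fullv) i v != 0.
  apply: contrapT => ne; case/negP: v0; rewrite vE big1 // => i _.
  suff -> : coord (vbasis fullv) i v = 0 by rewrite scale0r.
  by apply: contra_notP ne => /eqP ?; exists i.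
exists (linfun (coord (vbasis fullv) i : V -> R[i]^o)); by rewrite lfunE.
Qed.

Section Flip.
Variables (V W : vectType R[i]) (g : 'Hom(V, 'Hom(W, R[i]^o))).

Definition eval_fun (x : W) (f : 'Hom(W, R[i]^o)) : R[i]^o := f x.
Lemma eval_is_linear x : linear (eval_fun x).
Proof. by move=> c f f'; rewrite /eval_fun add_lfunE scale_lfunE. Qed.
HB.instance Definition _ x := GRing.isLinear.Build R[i] 'Hom(W, R[i]^o) R[i]^o *:%R
  (eval_fun x) (eval_is_linear x).

Definition flip_fun (x : W) : 'Hom(V, R[i]^o) := (linfun (eval_fun x) \o g)%VF.
Lemma flip_funE x y : flip_fun x y = g y x.
Proof. by rewrite comp_lfunE lfunE. Qed.
Lemma flip_is_linear : linear flip_fun.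
Proof.
by move=> c x y; apply/lfunP => v; rewrite add_lfunE scale_lfunE !flip_funE lfunD lfunZ.
Qed.
HB.instance Definition _ := GRing.isLinear.Build R[i] W 'Hom(V, R[i]^o) *:%R
  flip_fun flip_is_linear.

Definition flip_hom : 'Hom(W, 'Hom(V, R[i]^o)) := linfun flip_fun.
Lemma flip_homE x y : flip_hom x y = g y x.
Proof. by rewrite [flip_hom x]lfunE flip_funE. Qed.
End Flip.

Lemma flip_is_hom (M N : rep R) (g : 'Hom(M, dual N)) : is_hom g ->
  is_hom (flip_hom g : 'Hom(N, dual M)).
Proof.
move=> /hom_eltP [gE gF gK].
apply/hom_eltP; split=> x; apply/lfunP => y; rewrite precompE !flip_homE ?gE ?gF ?gK;
  by rewrite precompE.
Qed.

Lemma dim_functional (V : vectType R[i]) : dim 'Hom(V, R[i]^o) = dim V.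
Proof. by rewrite -[LHS]/(dim V * 1)%N muln1. Qed.

Section Splitting.
Variables (a : R[i]) (s : nat).
Hypothesis aa : a * a = 1.
Hypothesis s0 : (0 < s)%N.
Hypothesis sp : (s < p)%N.
Local Notation b := (gam (topw a s)).
Local Notation P := (modP p a s).

Lemma block_hom_P (M : rep R) (v : M) : sblock p a s M -> wt (topw a s) v ->
  exists f : 'Hom(P, M), [/\ is_hom f, f (vPb p a s 0) = v & f (vPa p a s 0) = nilc p b M v].
Proof.
move=> SM kv; have [vb [va [vx [vy [H b0 a0]]]]] := block_modP hp aa s0 sp SM kv.
exists (@homP R p a s M vb va vx vy); split; first exact: homP_is_hom.
- by rewrite (homP_b H).
- by rewrite (homP_a H).
Qed.

(* P embeds into M through v; a functional l with l (N v) <> 0 gives a homomorphism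
   P -> dual M, whose transpose M -> dual P is injective on the image of P, so that its
   kernel is a complement. *)
Lemma P_splits (M : rep R) (v : M) : sblock p a s M -> wt (topw a s) v -> nilc p b M v != 0 ->
  exists (f : 'Hom(P, M)) (W : {vspace M}), [/\ is_hom f, lker f == 0%VS, is_submodule W,
    (limg f + W)%VS = fullv & (limg f :&: W)%VS = 0%VS].
Proof.
move=> SM kv Nv; have HM := SM.1; have HD := dual_module HM.
have [f [fh fb fa]] := block_hom_P SM kv.
have [mu mun] := functional_neq0 Nv.
have [e /(_ _ HD) [ew edec _]] := wt_polys R hp.
have [m lN] : exists m, (pev (opK (dual M)) (e m) mu : 'Hom(M, _)) (nilc p b M v) != 0.
  apply: contrapT => ne; case/negP: mun; rewrite [mu](edec mu) sum_lfunE big1 // => m _.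
  by apply: contra_notP ne => /eqP ?; exists m.
move: (pev _ _ mu) (ew m mu) lN => l kl lN.
(* K is symmetric for the pairing, so a weight functional that is nonzero on N v must have the
   weight of N v. *)
have {kl}kl : wt (M := dual M) (topw a s) l.
  have := congr1 (fun u : 'Hom(M, R[i]^o) => u (nilc p b M v)) kl.
  rewrite precompE scale_lfunE (nilc_wt hp b HM kv) lfunZ => /eqP.
  rewrite -subr_eq0 -scalerBl scaler_eq0 (negPf lN) orbF subr_eq0 => /eqP e'.
  by rewrite e'.
have [g [gh gb _]] := block_hom_P (dual_sblock HM SM) kl.
pose th : 'Hom(M, dual P) := flip_hom g.
have thE x y : (th x : 'Hom(P, R[i]^o)) y = (g y : 'Hom(M, R[i]^o)) x := flip_homE g x y.
have thh : is_hom th := flip_is_hom gh.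
(* A nonzero kernel would contain a_0, but the image of a_0 takes the value l(N v) at b_0. *)
have tf0 : lker (th \o f)%VF == 0%VS.
  apply/negPn/negP => K0; have sK := lker_submodule (hom_comp fh thh).
  have := P_socle hp aa s0 sp sK K0; rewrite memv_ker comp_lfunE => /eqP.
  move/(congr1 (fun u : 'Hom(P, R[i]^o) => u (vPb p a s 0))).
  by rewrite thE gb fa zero_lfunE => /eqP; rewrite (negPf lN).
have f0 : lker f == 0%VS.
  apply/lker0P => x y xy; have /lker0P inj := tf0; apply: inj.
  by rewrite !comp_lfunE xy.
have cap0 : (limg f :&: lker th)%VS = 0%VS.
  apply/eqP; rewrite -subv0; apply/subvP => x; rewrite memv_cap => /andP [/memv_imgP [y _ ->]].
  rewrite memv_ker -comp_lfunE -memv_ker (eqP tf0) !memv0 => /eqP ->.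
  by rewrite lfun0.
exists f, (lker th); split => //; first exact: lker_submodule.
(* The rank of [th] is at most dim P, so its kernel is large enough to complement the image of
   [f]. *)
apply/eqP; rewrite eqEdim subvf /= (dimv_disjoint_sum cap0).
have d1 : \dim (limg f) = dim P by rewrite limg_dim_eq ?dimvf // (eqP f0) capv0.
have := limg_ker_dim th fullv; rewrite capfv => <-; rewrite addnC leq_add2r d1.
apply: leq_trans (dimvS (subvf _)) _; rewrite dimvf.
by rewrite dim_functional.
Qed.

Lemma indecomposable_P (M : rep R) (v : M) : sblock p a s M -> indecomposable M ->
  wt (topw a s) v -> nilc p b M v != 0 -> isomorphic M P.
Proof.
move=> SM [M0 Mi] kv Nv; have [f [W [fh f0 sW fW fIW]]] := P_splits SM kv Nv.
have [_ a0 _ _] := P_neq0 hp a s0 sp.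
have [f00|W0] := Mi _ _ (limg_submodule fh) sW fW fIW.
  have : f (vPa p a s 0) \in limg f by rewrite memv_img ?memvf.
  have /lker0P inj := f0; rewrite f00 memv0 -(lfun0 f) (inj_eq inj) => a00.
  by rewrite a00 in a0.
apply: isomorphic_sym; apply: isomorphicI fh f0 _.
by rewrite -fW W0 addv0.
Qed.
End Splitting.
End Duality.

(** * Modules of Loewy length two *)

Section KroneckerModules.
Variables (R : realType) (p : nat).
Hypothesis hp : (1 < p)%N.
Local Notation q := (qroot R p).
Local Notation q0 := (qroot_neq0 R hp).
Local Notation gam := (@gam R p).
Local Notation topw := (@topw R p).
Local Notation br := (qnum R p).
Variables (a : R[i]) (s : nat).
Hypothesis aa : a * a = 1.
Hypothesis s0 : (0 < s)%N.
Hypothesis sp : (s <= p)%N.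
Local Notation b := (gam (topw a s)).

Section Generic.
Variables (n m : nat) (A B : 'M[R[i]]_(n, m)).
Variables (M : rep R) (va : 'I_m -> nat -> M) (vx : 'I_n -> nat -> M).
Hypothesis H : is_modI p a s A B va vx.

Lemma modI_top j : wt (topw a s) (va j 0%N).
Proof. by have := mI_Ka H j 0; rewrite muln0 expr0 invr1 mul1r. Qed.

Lemma modI_bot i : wt (topw (- a) (p - s)) (vx i 0%N).
Proof. by have := mI_Kx H i 0; rewrite muln0 expr0 invr1 mul1r. Qed.

Lemma modI_iterFa j l : (l < s)%N -> iter l (opF M) (va j 0%N) = va j l.
Proof. by elim: l => //= l IH ls; rewrite IH ?(mI_Fa H) //; lia. Qed.

Lemma modI_iterFx i k : iter k (opF M) (vx i 0%N) = vx i k.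
Proof. by elim: k => //= k ->; rewrite (mI_Fx H). Qed.

Lemma modI_iterFs j : iter s (opF M) (va j 0%N) = \sum_i A i j *: vx i 0%N.
Proof. by rewrite -{1}(prednK s0) iterS modI_iterFa ?(mI_Flast H) //; lia. Qed.

Lemma modI_gen (U : {vspace M}) : is_submodule U ->
  (forall j, va j 0%N \in U) -> (forall i, vx i 0%N \in U) ->
  (forall j l, va j l \in U) /\ (forall i k, vx i k \in U).
Proof.
move=> sU Ua Ux; split=> [j l|i k].
  case: (ltnP l s) => ls; last by rewrite (mI_aout H) // mem0v.
  by rewrite -modI_iterFa //; case: (submodule_iter l sU (Ua j)).
by rewrite -modI_iterFx; case: (submodule_iter k sU (Ux i)).
Qed.

Lemma modI_nilc_gen : is_module p M ->
  (forall j, nilc p b M (va j 0%N) = 0) /\ (forall i, nilc p b M (vx i 0%N) = 0).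
Proof.
move=> HM; split=> [j|i].
  rewrite nilcE -(FE_wt hp HM (topw_neq0 hp s aa) (modI_top j)) (mI_Ea0 H) lfun_sum big1 // => i _.
  by rewrite lfunZ (mI_Fx H) (mI_xout H) ?scaler0 //; lia.
rewrite -(gam_flip hp aa sp) nilcE -(FE_wt hp HM (topw_neq0 hp _ (signN aa)) (modI_bot i)).
by rewrite (mI_Ex H) (cf0 hp) scale0r lfun0.
Qed.
End Generic.

(** Functoriality of I(A, B): a morphism of pencils, [S] on tops and [T] on socles, transports the
    defining relations. *)
Lemma modI_pull n m n' m' (A B : 'M[R[i]]_(n, m)) (A' B' : 'M[R[i]]_(n', m'))
    (M : rep R) (va : 'I_m' -> nat -> M) (vx : 'I_n' -> nat -> M)
    (S : 'M[R[i]]_(m', m)) (T : 'M[R[i]]_(n', n)) :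
  is_modI p a s A' B' va vx -> T *m A = A' *m S -> T *m B = B' *m S ->
  is_modI p a s A B (fun j l => \sum_i S i j *: va i l) (fun j k => \sum_i T i j *: vx i k).
Proof.
move=> H TA TB.
have key (X : 'M[R[i]]_(n, m)) (X' : 'M[R[i]]_(n', m')) j k : T *m X = X' *m S ->
    \sum_i S i j *: (\sum_l X' l i *: vx l k) = \sum_i X i j *: (\sum_l T l i *: vx l k).
  move=> TX; under eq_bigr do rewrite scaler_sumr.
  rewrite exchange_big /=; under [RHS]eq_bigr do rewrite scaler_sumr.
  rewrite [RHS]exchange_big; apply: eq_bigr => l _.
  have := congr1 (fun Z : 'M_(n', m) => Z l j) TX; rewrite !mxE => e.
  under eq_bigr do rewrite scalerA mulrC.
  under [RHS]eq_bigr do rewrite scalerA mulrC.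
  by rewrite -!scaler_suml e.
split.
- by move=> j l sl; rewrite big1 // => i _; rewrite (mI_aout H) ?scaler0.
- by move=> j l sl; rewrite big1 // => i _; rewrite (mI_xout H) ?scaler0.
- by move=> j l; apply: wt_sum => i _; apply: wtZ; apply: (mI_Ka H).
- by move=> j l; apply: wt_sum => i _; apply: wtZ; apply: (mI_Kx H).
- move=> j l; rewrite lfun_sum scaler_sumr; apply: eq_bigr => i _.
  by rewrite lfunZ (mI_Ea H) !scalerA mulrC.
- move=> j; rewrite lfun_sum -(key B B' j _ TB); apply: eq_bigr => i _.
  by rewrite lfunZ (mI_Ea0 H).
- move=> j l; rewrite lfun_sum scaler_sumr; apply: eq_bigr => i _.
  by rewrite lfunZ (mI_Ex H) !scalerA mulrC.
- move=> j l ls; rewrite lfun_sum; apply: eq_bigr => i _.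
  by rewrite lfunZ (mI_Fa H).
- move=> j; rewrite lfun_sum -(key A A' j _ TA); apply: eq_bigr => i _.
  by rewrite lfunZ (mI_Flast H).
- move=> j l; rewrite lfun_sum; apply: eq_bigr => i _.
  by rewrite lfunZ (mI_Fx H).
Qed.

Section Concrete.
Variables (n m : nat) (A B : 'M[R[i]]_(n, m)).
Local Notation MI := (modI p a s A B).
Local Notation va := (@vIa R p a s n m A B).
Local Notation vx := (@vIx R p a s n m A B).
Let II : is_modI p a s A B va vx := modI_modI hp a s0 A B.
Let HI : is_module p MI := I_module hp aa s0 sp A B.

Lemma I_full (U : {vspace MI}) : is_submodule U -> (forall j, va j 0%N \in U) ->
  (forall i, vx i 0%N \in U) -> U = fullv.
Proof.
move=> sU Ua Ux; have [Ga Gx] := modI_gen II sU Ua Ux.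
apply/vspaceP => v; rewrite memvf [v]dl_decomp; apply: rpred_sum => -[[j l]|[i k]] _; apply: rpredZ.
- by have := Ga j l; rewrite /vIa bvec_ord.
- by have := Gx i k; rewrite /vIx bvec_ord.
Qed.

Lemma I_ext (N : rep R) (f g : 'Hom(MI, N)) : is_hom f -> is_hom g ->
  (forall j, f (va j 0%N) = g (va j 0%N)) -> (forall i, f (vx i 0%N) = g (vx i 0%N)) -> f = g.
Proof.
move=> fh gh fa fx; have sU := lker_submodule (hom_sub fh gh).
have U1 : lker (f - g) = fullv.
  by apply: I_full => // j; rewrite memv_ker add_lfunE opp_lfunE ?fa ?fx subrr.
apply/lfunP => v; have : v \in lker (f - g) by rewrite U1 memvf.
by move/eqlfunP.
Qed.

Lemma I_nilc v : nilc p b MI v = 0.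
Proof.
have [Na Nx] := modI_nilc_gen II HI.
have U1 : lker (nilc p b MI) = fullv.
  apply: I_full; first exact: lker_submodule (nilc_hom hp b HI).
    by move=> j; rewrite memv_ker Na.
  by move=> i; rewrite memv_ker Nx.
by apply/eqP; rewrite -memv_ker U1 memvf.
Qed.

Lemma I_sblock : sblock p a s MI.
Proof. by split => // v; rewrite I_nilc. Qed.

Lemma I_wt_coord (v : MI) x i : wt x v -> cI a i != x -> (v : {ffun _ -> _}) i = 0.
Proof. by apply: wt_coord; apply: I_weights. Qed.

Lemma sum_dl (I : finType) k (lab : 'I_k -> I) (v : {ffun I -> R[i]^o}) : injective lab ->
  (forall i, i \notin codom lab -> v i = 0) ->
  v = \sum_j (v (lab j) : R[i]) *: dl R (lab j).
Proof.
move=> labi v0; apply/ffunP => i; rewrite sum_ffunE.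
have [/codomP [j ->]|iN] := boolP (i \in codom lab).
  rewrite (bigD1 j) //= big1 ?addr0 => [|l lj]; first by rewrite !ffunE eqxx; apply/esym/mulr1.
  by rewrite !ffunE (inj_eq labi) eq_sym (negPf lj) scaler0.
rewrite v0 // big1 // => j _; rewrite !ffunE; case: eqP => [e|_]; last by rewrite scaler0.
by rewrite e codom_f in iN.
Qed.

Lemma sum_dl_coord (I : finType) k (lab : 'I_k -> I) (x : 'I_k -> R[i]) : injective lab ->
  \sum_j x j *: dl R (lab j) = 0 -> forall j, x j = 0.
Proof.
move=> labi xs j; have := congr1 (fun w : {ffun I -> R[i]^o} => w (lab j)) xs.
rewrite sum_ffunE (bigD1 j) //= big1 ?addr0 => [|l lj]; last first.
  by rewrite !ffunE (inj_eq labi) eq_sym (negPf lj) scaler0.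
by rewrite !ffunE eqxx => e; rewrite -[LHS]mulr1.
Qed.

Lemma I_top (v : MI) : (s < p)%N || (n == 0%N) -> wt (topw a s) v ->
  exists x : 'I_m -> R[i], v = \sum_j x j *: va j 0%N.
Proof.
move=> spn kv; pose lab (j : 'I_m) : ('I_m * 'I_s) + ('I_n * 'I_(p - s)) := inl (j, Ordinal s0).
exists (fun j => (v : {ffun _ -> _}) (lab j)).
have -> : \sum_j ((v : {ffun _ -> _}) (lab j) : R[i]) *: va j 0%N =
    \sum_j ((v : {ffun _ -> R[i]^o}) (lab j) : R[i]) *: dl R (lab j).
  by apply: eq_bigr => j _; rewrite -(bvec_ord R (fun l' : 'I_s => inl (j, l'))).
apply: sum_dl => [j1 j2 [] //|i iN]; apply: (I_wt_coord kv); apply/eqP => e.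
case/negP: iN; have top0 := topw_neq0 hp s aa; have p0 : (0 < p)%N by lia.
case: i e => [[j l]|[i k]] /= e.
  apply/codomP; exists j; congr (inl (_, _)); apply: val_inj => /=.
  apply: (q_exp_inj hp top0 _ p0); last by rewrite e muln0 expr0 invr1 mul1r.
  by have := ltn_ord l; lia.
case/orP: spn => [sp'|/eqP n0]; last by move: (ltn_ord i); rewrite {2}n0.
move: e; rewrite (topw_flip hp) // mulrA -invfM -exprD -mulnDr -[RHS]mul1r.
rewrite -[in RHS]invr1 -(expr0 q) -(muln0 2) => /(q_exp_inj hp top0); have := ltn_ord k; lia.
Qed.

Lemma I_bot (v : MI) : (s < p)%N -> wt (topw (- a) (p - s)) v ->
  exists x : 'I_n -> R[i], v = \sum_i x i *: vx i 0%N.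
Proof.
move=> sp' kv; have ps0 : (0 < p - s)%N by lia.
pose lab (i : 'I_n) : ('I_m * 'I_s) + ('I_n * 'I_(p - s)) := inr (i, Ordinal ps0).
exists (fun j => (v : {ffun _ -> _}) (lab j)).
have -> : \sum_j ((v : {ffun _ -> _}) (lab j) : R[i]) *: vx j 0%N =
    \sum_j ((v : {ffun _ -> R[i]^o}) (lab j) : R[i]) *: dl R (lab j).
  by apply: eq_bigr => j _; rewrite -(bvec_ord R (fun l' : 'I_(p - s) => inr (j, l'))).
apply: sum_dl => [j1 j2 [] //|i iN]; apply: (I_wt_coord kv); apply/eqP => e.
case/negP: iN; have top0 := topw_neq0 hp (p - s) (signN aa); have p0 : (0 < p)%N by lia.
case: i e => [[j l]|[i k]] /= e.
  by move: e; rewrite (topw_flip hp) // => /(q_exp_inj hp (topw_neq0 hp s aa)); have := ltn_ord l; lia.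
apply/codomP; exists i; congr (inr (_, _)); apply: val_inj => /=.
apply: (q_exp_inj hp top0 _ p0); last by rewrite e muln0 expr0 invr1 mul1r.
by have := ltn_ord k; lia.
Qed.

Lemma I_indep_a (x : 'I_m -> R[i]) : \sum_j x j *: va j 0%N = 0 -> forall j, x j = 0.
Proof.
move=> xs; apply: (@sum_dl_coord _ _ (fun j => inl (j, Ordinal s0) : ('I_m * 'I_s) + ('I_n * 'I_(p - s)))).
  by move=> j1 j2 [].
by rewrite -[RHS]xs; apply: eq_bigr => j _; rewrite -(bvec_ord R (fun l' : 'I_s => inl (j, l'))).
Qed.

Lemma I_indep_x k (x : 'I_n -> R[i]) : (k < p - s)%N -> \sum_j x j *: vx j k = 0 -> forall j, x j = 0.
Proof.
move=> ks xs; apply: (@sum_dl_coord _ _ (fun j => inr (j, Ordinal ks) : ('I_m * 'I_s) + ('I_n * 'I_(p - s)))).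
  by move=> j1 j2 [].
by rewrite -[RHS]xs; apply: eq_bigr => j _; rewrite -(bvec_ord R (fun l' : 'I_(p - s) => inr (j, l'))).
Qed.
End Concrete.
End KroneckerModules.

(** * Indecomposability through idempotent endomorphisms *)

Section Indecomposability.
Variable R : realType.

Lemma direct_projection (K : fieldType) (V : vectType K) (U W : {vspace V}) :
  (U + W)%VS = fullv -> (U :&: W)%VS = 0%VS ->
  exists e : 'End(V), (forall u, u \in U -> e u = u) /\ (forall w, w \in W -> e w = 0).
Proof.
move=> UW UIW; have WIU : (W :&: U)%VS = 0%VS by rewrite capvC.
exists (daddv_pi U W); split=> [u|w wW]; first exact: daddv_pi_id.
have := daddv_pi_add UIW (w := w); rewrite UW memvf => /(_ isT).
by rewrite (daddv_pi_id WIU wW) => /eqP; rewrite -subr_eq0 addrK => /eqP.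
Qed.

Lemma submodule_projection (M : rep R) (U V : {vspace M}) : is_submodule U -> is_submodule V ->
  (U + V)%VS = fullv -> (U :&: V)%VS = 0%VS ->
  exists e : 'End(M), [/\ is_hom e, (e \o e)%VF = e, e = 0 -> U = 0%VS & e = \1%VF -> V = 0%VS].
Proof.
move=> /submoduleE [UE UF UK] /submoduleE [VE VF VK] UV UIV.
have [e [eU eV]] := direct_projection UV UIV.
have dec w : exists u v, [/\ u \in U, v \in V & w = u + v].
  have : w \in (U + V)%VS by rewrite UV memvf.
  by case/memv_addP => u uU [v vV ->]; exists u, v.
have eD u v : u \in U -> v \in V -> e (u + v) = u.
  by move=> uU vV; rewrite lfunD eU // eV // addr0.
exists e; split.
- apply/hom_eltP; split=> w; have [u [v [uU vV ->]]] := dec w; rewrite lfunD !eD ?UE ?UF ?UK ?VE ?VF ?VK //.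
- by apply/lfunP => w; have [u [v [uU vV ->]]] := dec w; rewrite comp_lfunE eD // eU.
- move=> e0; apply/eqP; rewrite -subv0; apply/subvP => u uU.
  by rewrite -(eU u uU) e0 zero_lfunE mem0v.
- move=> e1; apply/eqP; rewrite -subv0; apply/subvP => v vV.
  by rewrite memv0 -(eV v vV) e1 id_lfunE.
Qed.

Lemma indecomposableP (M : rep R) : indecomposable M <->
  (fullv : {vspace M}) != 0%VS /\
  forall e : 'End(M), is_hom e -> (e \o e)%VF = e -> e = 0 \/ e = \1%VF.
Proof.
split=> [[M0 Mi]|[M0 Mi]]; split => //.
  move=> e eh ee.
  have idem v : e (e v) = e v by rewrite -comp_lfunE ee.
  have : limg e = 0%VS \/ lker e = 0%VS.
    apply: (Mi _ _ (limg_submodule eh) (lker_submodule eh)).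
      apply/vspaceP => v; rewrite memvf -[v](subrK (e v)) addrC memv_add //.
        by rewrite memv_img ?memvf.
      by rewrite memv_ker lfunB idem subrr.
    apply/eqP; rewrite -subv0; apply/subvP => v; rewrite memv_cap memv_ker => /andP [/memv_imgP [w _ ->]].
    by rewrite idem memv0.
  case=> e0; [left|right]; apply/lfunP => v.
    by rewrite zero_lfunE; apply/eqP; rewrite -memv0 -e0 memv_img ?memvf.
  have : e v - v \in lker e by rewrite memv_ker lfunB idem subrr.
  by rewrite id_lfunE e0 memv0 subr_eq0 => /eqP.
move=> U V sU sV UV UIV; have [e [eh ee e0 e1]] := submodule_projection sU sV UV UIV.
by have [/e0|/e1] := Mi e eh ee; [left|right].
Qed.

Lemma isomorphic_neq0 (M N : rep R) : isomorphic M N -> (fullv : {vspace M}) != 0%VS ->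
  (fullv : {vspace N}) != 0%VS.
Proof.
case=> f [g [fh gh gf fg]]; apply: contra => /eqP N0; apply/eqP/vspaceP => v.
rewrite memvf memv0; have -> : v = g (f v) by rewrite -comp_lfunE gf id_lfunE.
have : f v \in (fullv : {vspace N}) by rewrite memvf.
by rewrite N0 memv0 => /eqP ->; rewrite lfun0 eqxx.
Qed.

Lemma isomorphic_indec (M N : rep R) : isomorphic M N -> indecomposable M -> indecomposable N.
Proof.
move=> MN /indecomposableP [M0 Mi]; apply/indecomposableP; split; first exact: isomorphic_neq0 MN M0.
case: MN => f [g [fh gh gf fg]] e eh ee.
have fgx v : f (g v) = v by rewrite -comp_lfunE fg id_lfunE.
have [||E0|E1] := Mi (g \o e \o f)%VF.
- by apply: hom_comp fh (hom_comp eh gh).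
- by apply/lfunP => v; rewrite !comp_lfunE fgx -[e (e _)]comp_lfunE ee.
- left; apply/lfunP => v; have := congr1 (fun u : 'End(M) => f (u (g v))) E0.
  by rewrite !comp_lfunE !fgx !zero_lfunE lfun0.
- right; apply/lfunP => v; have := congr1 (fun u : 'End(M) => f (u (g v))) E1.
  by rewrite !comp_lfunE !id_lfunE !fgx.
Qed.

Lemma isomorphic_irr (M N : rep R) : isomorphic M N -> irreducible M -> irreducible N.
Proof.
move=> MN [M0 Mi]; split; first exact: isomorphic_neq0 MN M0.
case: MN => f [g [fh gh gf fg]] U sU.
have fgx v : f (g v) = v by rewrite -comp_lfunE fg id_lfunE.
have [gU|gU] := Mi _ (img_submodule gh sU); [left|right].
  apply/eqP; rewrite -subv0; apply/subvP => u uU; rewrite memv0 -(fgx u).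
  have : g u \in (g @: U)%VS by rewrite memv_img.
  by rewrite gU memv0 => /eqP ->; rewrite lfun0.
apply/vspaceP => v; rewrite memvf; have : g v \in (g @: U)%VS by rewrite gU memvf.
by case/memv_imgP => u uU e; rewrite -(fgx v) e fgx.
Qed.

Lemma irr_indec (M : rep R) : irreducible M -> indecomposable M.
Proof.
case=> M0 Mi; split => // U V sU sV UV UIV; have [->|U1] := Mi U sU; first by left.
by right; move: UIV; rewrite U1 capfv.
Qed.
End Indecomposability.

(** * Correspondence between I(A, B) and the pencil (A, B) *)

Section KroneckerEquivalence.
Variables (R : realType) (p : nat).
Hypothesis hp : (1 < p)%N.
Local Notation q := (qroot R p).
Local Notation gam := (@gam R p).
Local Notation topw := (@topw R p).
Variables (a : R[i]) (s : nat).
Hypothesis aa : a * a = 1.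
Hypothesis s0 : (0 < s)%N.
Hypothesis sp : (s <= p)%N.
Local Notation b := (gam (topw a s)).
Local Notation va := (@vIa R p a s _ _ _ _).
Local Notation vx := (@vIx R p a s _ _ _ _).
Let II n m A B := @modI_modI R p hp a s s0 n m A B.
Let HI n m A B := @I_module R p hp a s aa s0 sp n m A B.

Lemma mx_comb (V : lmodType R[i]) n m r (X : 'M[R[i]]_(m, r)) (Y : 'M[R[i]]_(n, m)) (v : 'I_n -> V) j :
  \sum_i X i j *: (\sum_l Y l i *: v l) = \sum_l (Y *m X) l j *: v l.
Proof.
under eq_bigr do rewrite scaler_sumr.
rewrite exchange_big; apply: eq_bigr => l _; rewrite mxE scaler_suml.
by apply: eq_bigr => i _; rewrite scalerA mulrC.
Qed.

Lemma comb1 (V : lmodType R[i]) n (v : 'I_n -> V) j : \sum_i (1%:M : 'M[R[i]]_n) i j *: v i = v j.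
Proof.
rewrite (bigD1 j) //= mxE eqxx scale1r big1 ?addr0 // => i ij.
by rewrite mxE (negPf ij) scale0r.
Qed.

Lemma I_map n m n' m' (A B : 'M[R[i]]_(n, m)) (A' B' : 'M[R[i]]_(n', m'))
    (S : 'M[R[i]]_(m', m)) (T : 'M[R[i]]_(n', n)) :
  T *m A = A' *m S -> T *m B = B' *m S ->
  exists f : 'Hom(modI p a s A B, modI p a s A' B'), [/\ is_hom f,
    forall j l, f (va j l) = \sum_i S i j *: va i l &
    forall i k, f (vx i k) = \sum_l T l i *: vx l k].
Proof.
move=> TA TB; have H := modI_pull (II A' B') TA TB.
exists (@homI R p a s n m A B _ (fun j l => \sum_i S i j *: va i l) (fun j k => \sum_i T i j *: vx i k)).
split; first exact: (homI_is_hom hp H).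
- by move=> j l; exact: homI_a H j l.
- by move=> i k; exact: homI_x H i k.
Qed.

Lemma pencil_iso_modI n m n' m' (A B : 'M[R[i]]_(n, m)) (A' B' : 'M[R[i]]_(n', m')) :
  pencil_iso A B A' B' -> isomorphic (modI p a s A B) (modI p a s A' B').
Proof.
move=> [S [S' [T [T' [[SS' S'S TT' T'T] [TA TB]]]]]].
have inv (X : 'M_(n, m)) (X' : 'M_(n', m')) : T *m X = X' *m S -> T' *m X' = X *m S'.
  move=> TX; have -> : X' = T *m X *m S' by rewrite TX -mulmxA SS' mulmx1.
  by rewrite !mulmxA T'T mul1mx.
have [f [fh fa fx]] := I_map TA TB.
have [g [gh ga gx]] := I_map (inv _ _ TA) (inv _ _ TB).
exists f, g; split => //.
- apply: (I_ext hp s0 sp (hom_comp fh gh) (hom_id _)) => [j|i].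
    rewrite comp_lfunE id_lfunE fa lfun_sum; under eq_bigr do rewrite lfunZ ga.
    by rewrite mx_comb S'S comb1.
  rewrite comp_lfunE id_lfunE fx lfun_sum; under eq_bigr do rewrite lfunZ gx.
  by rewrite mx_comb T'T comb1.
- apply: (I_ext hp s0 sp (hom_comp gh fh) (hom_id _)) => [j|i].
    rewrite comp_lfunE id_lfunE ga lfun_sum; under eq_bigr do rewrite lfunZ fa.
    by rewrite mx_comb SS' comb1.
  rewrite comp_lfunE id_lfunE gx lfun_sum; under eq_bigr do rewrite lfunZ fx.
  by rewrite mx_comb TT' comb1.
Qed.

Lemma lfun_iter_comb (M : rep R) (f : 'End(M)) k n (x : 'I_n -> R[i]) (v : 'I_n -> M) :
  iter k f (\sum_i x i *: v i) = \sum_i x i *: iter k f (v i).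
Proof.
elim: k => //= k ->; rewrite lfun_sum; apply: eq_bigr => i _; exact: lfunZ.
Qed.

Section AbstractPencil.
Variables (n m : nat) (A B : 'M[R[i]]_(n, m)).
Hypothesis sp' : (s < p)%N.
Variables (M : rep R) (va : 'I_m -> nat -> M) (vx : 'I_n -> nat -> M).
Hypothesis H : is_modI p a s A B va vx.
Hypothesis inda : forall x : 'I_m -> R[i], \sum_j x j *: va j 0%N = 0 -> forall j, x j = 0.
Hypothesis indx : forall k (x : 'I_n -> R[i]), (k < p - s)%N ->
  \sum_j x j *: vx j k = 0 -> forall j, x j = 0.

Lemma comb_eq_a r (X Y : 'M[R[i]]_(m, r)) j :
  \sum_i X i j *: va i 0%N = \sum_i Y i j *: va i 0%N -> forall i, X i j = Y i j.
Proof.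
move=> XY i; apply/eqP; rewrite -subr_eq0; apply/eqP.
apply: (inda (x := fun i => X i j - Y i j)).
by under eq_bigr do rewrite scalerBl; rewrite sumrB XY subrr.
Qed.

Lemma comb_eq_x r k (X Y : 'M[R[i]]_(n, r)) j : (k < p - s)%N ->
  \sum_i X i j *: vx i k = \sum_i Y i j *: vx i k -> forall i, X i j = Y i j.
Proof.
move=> kp XY i; apply/eqP; rewrite -subr_eq0; apply/eqP.
apply: (indx (k := k) (x := fun i => X i j - Y i j) kp).
by under eq_bigr do rewrite scalerBl; rewrite sumrB XY subrr.
Qed.

(** F^s on a_0 reads off [A] in the coordinates x_0, and E on a_0 reads off [B] in the coordinates
    x_(p-s-1). Commuting with these two operators is being an endomorphism of the pencil. *)
Lemma idempotent_pencil (e : 'End(M)) (S : 'M[R[i]]_m) (T : 'M[R[i]]_n) :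
  is_hom e -> (e \o e)%VF = e ->
  (forall j, e (va j 0%N) = \sum_i S i j *: va i 0%N) ->
  (forall j, e (vx j 0%N) = \sum_i T i j *: vx i 0%N) ->
  [/\ S *m S = S, T *m T = T, T *m A = A *m S & T *m B = B *m S].
Proof.
move=> eh ee eX eY; have [eE eF eK] := (hom_eltP e).1 eh.
have idem v : e (e v) = e v by rewrite -comp_lfunE ee.
have eYk k j : e (vx j k) = \sum_i T i j *: vx i k.
  rewrite -(modI_iterFx H) (hom_iterF k _ eh) eY lfun_iter_comb.
  by apply: eq_bigr => i _; rewrite (modI_iterFx H).
have ps : (0 < p - s)%N by lia.
have ps1 : ((p - s).-1 < p - s)%N by lia.
split; apply/matrixP => i j.
- apply: comb_eq_a; rewrite -eX -mx_comb -idem eX lfun_sum.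
  by apply: eq_bigr => l _; rewrite lfunZ eX.
- apply: (comb_eq_x ps); rewrite -eY -mx_comb -idem eY lfun_sum.
  by apply: eq_bigr => l _; rewrite lfunZ eY.
- apply: (comb_eq_x ps); rewrite -!mx_comb.
  under eq_bigr do rewrite -eY -lfunZ.
  rewrite -lfun_sum -(modI_iterFs hp s0 sp H) (hom_iterF s _ eh) eX lfun_iter_comb.
  by apply: eq_bigr => l _; rewrite (modI_iterFs hp s0 sp H).
- apply: (comb_eq_x ps1); rewrite -!mx_comb.
  under eq_bigr do rewrite -eYk -lfunZ.
  rewrite -lfun_sum -(mI_Ea0 H) eE eX lfun_sum.
  by apply: eq_bigr => l _; rewrite lfunZ (mI_Ea0 H).
Qed.
End AbstractPencil.

Section OnePencil.
Variables (n m : nat) (A B : 'M[R[i]]_(n, m)).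
Hypothesis sp' : (s < p)%N.
Local Notation MI := (modI p a s A B).

Let inda := @I_indep_a R p a s s0 n m A B.
Let indx := @I_indep_x R p a s n m A B.

Lemma I_neq0 : (0 < n + m)%N -> (fullv : {vspace MI}) != 0%VS.
Proof.
move=> nm; apply/eqP => M0.
have M0' (v : MI) : v = 0 by apply/eqP; rewrite -memv0 -M0 memvf.
case: (posnP m) => [m0|m0].
  have n0 : (0 < n)%N by lia.
  have ps : (0 < p - s)%N by lia.
  have := @I_indep_x R p a s n m A B 0 (fun=> 1) ps (M0' _) (Ordinal n0).
  by move/eqP; rewrite oner_eq0.
have := @I_indep_a R p a s s0 n m A B (fun=> 1) (M0' _) (Ordinal m0).
by move/eqP; rewrite oner_eq0.
Qed.

(** An endomorphism preserves the two top weight spaces, spanned by the a_0 and the x_0, and is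
    determined by its action there. *)
Lemma pencil_indec_modI : (0 < n + m)%N -> pencil_indec A B -> indecomposable MI.
Proof.
move=> nm AB; apply/indecomposableP; split; first exact: I_neq0.
move=> e eh ee; have MM := II A B.
have /choice [X eX] j : exists x : 'I_m -> R[i], e (va j 0%N) = \sum_i x i *: va i 0%N.
  by apply: (I_top hp aa s0 sp); rewrite ?sp' //; apply: hom_wt eh (modI_top MM j).
have /choice [Y eY] i : exists y : 'I_n -> R[i], e (vx i 0%N) = \sum_l y l *: vx l 0%N.
  by apply: (I_bot hp aa s0 sp sp'); apply: hom_wt eh (modI_bot MM i).
pose S : 'M[R[i]]_m := \matrix_(i, j) X j i; pose T : 'M[R[i]]_n := \matrix_(i, j) Y j i.
have {}eX j : e (va j 0%N) = \sum_i S i j *: va i 0%N.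
  by rewrite eX; apply: eq_bigr => i _; rewrite mxE.
have {}eY j : e (vx j 0%N) = \sum_i T i j *: vx i 0%N.
  by rewrite eY; apply: eq_bigr => i _; rewrite mxE.
have [SS TT TA TB] := idempotent_pencil sp' MM inda indx eh ee eX eY.
have [[S0 T0]|[S1 T1]] := AB S T SS TT TA TB; [left|right].
- apply: (I_ext hp s0 sp eh) => [|j|j].
  + by apply/hom_eltP; split=> v; rewrite !zero_lfunE lfun0.
  + by rewrite eX zero_lfunE S0 big1 // => i _; rewrite mxE scale0r.
  + by rewrite eY zero_lfunE T0 big1 // => i _; rewrite mxE scale0r.
- apply: (I_ext hp s0 sp eh (hom_id _)) => [j|j].
  + by rewrite eX id_lfunE S1 comb1.
  + by rewrite eY id_lfunE T1 comb1.
Qed.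

Lemma modI_indec_pencil : indecomposable MI -> pencil_indec A B.
Proof.
move=> /indecomposableP [_ Mi] S T SS TT TA TB.
have [e [eh ea ex]] := I_map TA TB.
have ps : (0 < p - s)%N by lia.
have [|e0|e1] := Mi e eh.
- apply: (I_ext hp s0 sp (hom_comp eh eh) eh) => [j|j].
    rewrite comp_lfunE ea lfun_sum; under eq_bigr do rewrite lfunZ ea.
    by rewrite mx_comb SS.
  rewrite comp_lfunE ex lfun_sum; under eq_bigr do rewrite lfunZ ex.
  by rewrite mx_comb TT.
- left; split; apply/matrixP => i j.
    apply: (comb_eq_a inda); rewrite -ea e0 zero_lfunE big1 // => l _; by rewrite mxE scale0r.
  apply: (comb_eq_x indx ps); rewrite -ex e0 zero_lfunE big1 // => l _; by rewrite mxE scale0r.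
- right; split; apply/matrixP => i j.
    by apply: (comb_eq_a inda); rewrite -ea e1 id_lfunE comb1.
  by apply: (comb_eq_x indx ps); rewrite -ex e1 id_lfunE comb1.
Qed.

Lemma modI_reducible : (0 < n)%N -> (0 < m)%N -> ~ irreducible MI.
Proof.
move=> n0 m0 [_ Mi].
(* The map onto the module with the same top and empty socle; its kernel contains the socle and no
   a_0, so it is a proper nonzero submodule. *)
have [||f [fh fa fx]] := @I_map n m 0 m A B 0 0 1%:M 0; try by rewrite mul0mx mul0mx.
have := Mi _ (lker_submodule fh); case=> K.
  have : vx (Ordinal n0) 0%N \in lker f.
    by rewrite memv_ker fx big1 // => -[].
  rewrite K memv0 => /eqP v0; have ps : (0 < p - s)%N by lia.
  have /eqP : (Ordinal n0 == Ordinal n0)%:R = 0 :> R[i].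
    apply: (indx (k := 0) (x := fun j => (j == Ordinal n0)%:R) ps).
    by rewrite big1 // => j _; case: eqP => [->|_]; rewrite ?v0 ?scaler0 ?scale0r.
  by rewrite eqxx oner_eq0.
have : va (Ordinal m0) 0%N \in lker f by rewrite K memvf.
rewrite memv_ker fa comb1 => /eqP v0.
have /eqP : (Ordinal m0 == Ordinal m0)%:R = 0 :> R[i].
  apply: (@I_indep_a R p a s s0 0 m 0 0 (fun j => (j == Ordinal m0)%:R)).
  by rewrite big1 // => j _; case: eqP => [->|_]; rewrite ?v0 ?scaler0 ?scale0r.
by rewrite eqxx oner_eq0.
Qed.
End OnePencil.
End KroneckerEquivalence.

(** * Modules of a block on which N vanishes *)

Section SquareZeroBlock.
Variables (R : realType) (p : nat).
Hypothesis hp : (1 < p)%N.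
Local Notation q := (qroot R p).
Local Notation gam := (@gam R p).
Local Notation topw := (@topw R p).
Local Notation br := (qnum R p).

Lemma vspace0P (K : fieldType) (V : vectType K) (U : {vspace V}) :
  (forall v, v \in U -> v = 0) -> U = 0%VS.
Proof. by move=> U0; apply/eqP; rewrite -subv0; apply/subvP => v /U0 ->; rewrite mem0v. Qed.

(* For s = p the two families of top weights coincide. *)
Lemma top_cases (M : rep R) a s (v : M) : (s <= p)%N ->
  wt (topw a s) v \/ wt (topw (- a) (p - s)) v ->
  wt (topw a s) v \/ (s < p)%N /\ wt (topw (- a) (p - s)) v.
Proof.
move=> sp [kv|kv]; first by left.
case: (ltnP s p) => ps; first by right.
have spp : s = p by apply/eqP; rewrite eqn_leq sp.
by left; move: kv; rewrite (topw_flip hp) // {1}spp (qroot_2p R hp) invr1 mul1r.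
Qed.

Section Family.
Variables (M : rep R) (a : R[i]) (s : nat).
Hypothesis HM : is_module p M.
Hypothesis aa : a * a = 1.
Hypothesis s0 : (0 < s)%N.
Hypothesis sp : (s <= p)%N.
Hypothesis N0 : forall v : M, nilc p (gam (topw a s)) M v = 0.
Local Notation E := (opE M).
Local Notation F := (opF M).
Variables (T S : {vspace M}).
Hypothesis Ttop : forall v, v \in T -> wt (topw a s) v.
Hypothesis Sbot : forall v, v \in S -> wt (topw (- a) (p - s)) v.
Hypothesis TF : forall v, v \in T -> iter s F v \in S.
Hypothesis TE : forall v, v \in T -> exists2 x, x \in S & iter (p - s).-1 F x = E v.
Hypothesis SE : forall v, v \in S -> E v = 0.
Hypothesis SF : forall v, v \in S -> iter (p - s) F v = 0.

Let X (j : 'I_(\dim T)) : M := (vbasis T)`_j.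
Let Y (i : 'I_(\dim S)) : M := (vbasis S)`_i.

Let XT j : X j \in T.
Proof. by apply: vbasis_mem; apply: mem_nth; rewrite size_tuple. Qed.
Let YS i : Y i \in S.
Proof. by apply: vbasis_mem; apply: mem_nth; rewrite size_tuple. Qed.

(** When N = 0, strings satisfy the formulas of the simple modules exactly. The only remaining data
    are the coordinates of F^s v, and of the head of the string ending in E v, for v in a basis of
    [T]; they form [A] and [B]. *)
Lemma family_modI : exists A B va vx,
  [/\ @is_modI R p a s (\dim S) (\dim T) A B M va vx, forall j, va j 0%N = X j & forall i, vx i 0%N = Y i].
Proof.
have HN v : nilc p (gam (topw a s)) M (nilc p (gam (topw a s)) M v) = 0 by rewrite N0.
have /choice [x xP] (j : 'I_(\dim T)) : exists x, x \in S /\ iter (p - s).-1 F x = E (X j).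
  by have [x xS xE] := TE (XT j); exists x.
pose A : 'M[R[i]]_(\dim S, \dim T) := \matrix_(i, j) coord (vbasis S) i (iter s F (X j)).
pose B : 'M[R[i]]_(\dim S, \dim T) := \matrix_(i, j) coord (vbasis S) i (x j).
have comb (f : 'I_(\dim T) -> M) j k : f j \in S ->
    iter k F (f j) = \sum_i (\matrix_(i, j) coord (vbasis S) i (f j) : 'M[R[i]]__) i j *: iter k F (Y i).
  move=> fS; rewrite {1}(coord_vbasis fS) lfun_iter_comb.
  by apply: eq_bigr => i _; rewrite mxE.
exists A, B, (fun j l => if (l < s)%N then iter l F (X j) else 0), (fun i k => iter k F (Y i)).
split=> [|j|i //]; last by rewrite s0.
have aN := signN aa; have gf := gam_flip hp aa sp.
split.
- by move=> j l sl; rewrite ltnNge sl.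
- by move=> i k pk; apply: lfun_iter_out pk (SF (YS i)).
- by move=> j l; case: ifP => _; [apply: wt_iterF (Ttop (XT j))|apply: wt0].
- by move=> i k; apply: wt_iterF (Sbot (YS i)).
- move=> j l; case: (ltnP l.+1 s) => ls.
    by rewrite (ltnW ls) (string_E hp HM aa erefl (Ttop (XT j)) (ltnW ls)) N0 lfun_iter0 addr0.
  by rewrite lfun0 (cf_out hp) // scale0r.
- by move=> j; rewrite s0 /= -(xP j).2 (comb x) // (xP j).1.
- move=> i [|k]; first by rewrite (cf0 hp) scale0r (SE (YS i)).
  case: (ltnP k (p - s)) => kp.
    rewrite (string_E hp HM aN (esym gf) (Sbot (YS i)) kp).
    by rewrite N0 lfun_iter0 addr0.
  by rewrite (lfun_iter_out (leqW kp) (SF (YS i))) (lfun_iter_out kp (SF (YS i))) lfun0 scaler0.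
- move=> j l ls; case: (ltnP l s) => ls'; last by rewrite ltnNge (leqW ls') lfun0.
  by rewrite (_ : (l.+1 < s)%N) //; lia.
- move=> j; rewrite (_ : (s.-1 < s)%N) ?prednK // -iterS prednK //.
  by rewrite -[LHS]/(iter 0 F _) (comb (fun j => iter s F (X j))) // TF.
- by [].
Qed.

(** A nonzero kernel would contain a critical weight vector, but these are combinations of basis
    vectors sent to bases of [T] and [S]. The control over critical weight vectors in the image is
    what later makes two such images independent. *)
Lemma family_hom : (s < p)%N || (S == 0%VS) ->
  exists n m (A B : 'M[R[i]]_(n, m)) (f : 'Hom(modI p a s A B, M)),
  [/\ is_hom f, lker f == 0%VS, (S = 0%VS -> n = 0%N),
      forall v, v \in limg f -> wt (topw a s) v -> v \in T &
      [/\ (forall v, v \in limg f -> wt (topw (- a) (p - s)) v -> (s < p)%N -> v \in S),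
      (T <= limg f)%VS & (S <= limg f)%VS]].
Proof.
move=> spS; have [A [B [va [vx [H vaX vxY]]]]] := family_modI.
have MM := modI_modI hp a s0 A B; have HI := I_module hp aa s0 sp A B.
exists (\dim S), (\dim T), A, B, (@homI R p a s _ _ A B M va vx); set f := @homI _ _ _ _ _ _ _ _ _ _ _.
have fh : is_hom f := homI_is_hom hp H.
have fa j : f (vIa p a s A B j 0%N) = X j by rewrite -vaX; exact: homI_a H j 0%N.
have fx i : f (vIx p a s A B i 0%N) = Y i by rewrite -vxY; exact: homI_x H i 0%N.
have spS' : (s < p)%N || (\dim S == 0%N) by rewrite dimv_eq0.
have Tc v : wt (topw a s) v -> exists2 x : 'I_(\dim T) -> R[i],
    v = \sum_j x j *: vIa p a s A B j 0%N & f v = \sum_j x j *: X j.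
  move=> /(I_top hp aa s0 sp spS') [x ->]; exists x => //.
  by rewrite lfun_sum; apply: eq_bigr => j _; rewrite lfunZ fa.
have Sc v : (s < p)%N -> wt (topw (- a) (p - s)) v -> exists2 x : 'I_(\dim S) -> R[i],
    v = \sum_j x j *: vIx p a s A B j 0%N & f v = \sum_j x j *: Y j.
  move=> sp' /(I_bot hp aa s0 sp sp') [x ->]; exists x => //.
  by rewrite lfun_sum; apply: eq_bigr => j _; rewrite lfunZ fx.
have freeT := basis_free (vbasisP T); have freeS := basis_free (vbasisP S).
have finj : lker f == 0%VS.
  apply: contraT => ker0.
  have [|v [vk v0 _ kv]] := block_sub_meet hp HI _ aa sp erefl (lker_submodule fh) ker0.
    by move=> v; rewrite !(I_nilc hp aa s0 sp).
  have {kv} [kv|[sp' kv]] := top_cases sp kv.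
  - have [x vE fv] := Tc v kv; case/eqP: v0; rewrite vE big1 // => j _.
    by move: vk; rewrite memv_ker fv => /eqP /(freeP freeT) ->; rewrite scale0r.
  - have [x vE fv] := Sc v sp' kv; case/eqP: v0; rewrite vE big1 // => j _.
    by move: vk; rewrite memv_ker fv => /eqP /(freeP freeS) ->; rewrite scale0r.
have pull k v : v \in limg f -> wt k v -> exists2 w, wt k w & v = f w.
  case/memv_imgP => w _ -> kv; exists w => //; have [_ _ fK] := (hom_eltP f).1 fh.
  by apply: (lker0P finj); rewrite fK lfunZ; apply: kv.
split => //; first by move=> ->; rewrite dimv0.
- move=> v vI /(pull _ _ vI) [w /Tc [x _ fw] ->]; rewrite fw.
  by apply: rpred_sum => j _; apply: rpredZ; apply: XT.
split.
- move=> v vI /(pull _ _ vI) [w kw ->] sp'; have [x _ ->] := Sc w sp' kw.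
  by apply: rpred_sum => j _; apply: rpredZ; apply: YS.
- apply/subvP => v vT; rewrite (coord_vbasis vT); apply: rpred_sum => j _; apply: rpredZ.
  by rewrite -/(X j) -fa memv_img ?memvf.
- apply/subvP => v vT; rewrite (coord_vbasis vT); apply: rpred_sum => j _; apply: rpredZ.
  by rewrite -/(Y j) -fx memv_img ?memvf.
Qed.
End Family.

Definition wsp (M : rep R) (k : R[i]) : {vspace M} := lker (opK M - k *: \1%VF).

Lemma wspP (M : rep R) k (v : M) : (v \in wsp M k) <-> wt k v.
Proof.
rewrite memv_ker add_lfunE opp_lfunE scale_lfunE id_lfunE subr_eq0; split; first by move/eqP.
by move=> kv; apply/eqP.
Qed.

Section Arrows.
Variables (M : rep R) (a : R[i]) (s : nat).
Hypothesis HM : is_module p M.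
Hypothesis aa : a * a = 1.
Hypothesis s0 : (0 < s)%N.
Hypothesis sp : (s < p)%N.
Hypothesis N0 : forall v : M, nilc p (gam (topw a s)) M v = 0.
Local Notation E := (opE M).
Local Notation F := (opF M).

(** What the two pencil maps reach from all tops of (a, s). E^(p-s) stands for E because, up to a
    nonzero scalar, it gives the head of the string that ends in E v. *)
Definition arrows : {vspace M} :=
  (lpow F s @: wsp M (topw a s) + lpow E (p - s) @: wsp M (topw a s))%VS.

Lemma arrowsP x : x \in arrows -> exists u v,
  [/\ wt (topw a s) u, wt (topw a s) v & x = iter s F u + iter (p - s) E v].
Proof.
case/memv_addP => _ /memv_imgP [u /wspP ku ->] [_ /memv_imgP [v /wspP kv ->] ->].
by exists u, v; rewrite !lpowE.
Qed.

Lemma arrows_F v : wt (topw a s) v -> iter s F v \in arrows.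
Proof.
by move/wspP=> kv; apply: (subvP (addvSl _ _)); rewrite -lpowE memv_img.
Qed.

Lemma arrows_E v : wt (topw a s) v -> iter (p - s) E v \in arrows.
Proof.
by move/wspP=> kv; apply: (subvP (addvSr _ _)); rewrite -lpowE memv_img.
Qed.

Let HN v : nilc p (gam (topw a s)) M (nilc p (gam (topw a s)) M v) = 0.
Proof. exact: N0. Qed.

(** E F^s u = 0 since the coefficient [s - s] vanishes and N = 0, and F^(p-s) F^s = F^p = 0. For
    E^(p-s) v the claims are those on the head x of the string ending in E v, with F^(p-s) x = N v =
    0. *)
Lemma arrows_bot x : x \in arrows ->
  [/\ wt (topw (- a) (p - s)) x, E x = 0 & iter (p - s) F x = 0].
Proof.
case/arrowsP => u [v [ku kv ->]].
have [c c0 /= [kx Ex _ Fx]] := topE_source_iter hp HM HN aa s0 sp erefl kv.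
have vE : iter (p - s) E v = c^-1 *: (c *: iter (p - s) E v) by rewrite scalerA mulVf // scale1r.
have Eu : E (iter s F u) = 0.
  have ss : (s.-1 < s)%N by lia.
  rewrite -{1}(prednK s0) (string_E hp HM aa erefl ku ss) N0 lfun_iter0 addr0 prednK //.
  by rewrite subnn (qnum0 R hp) mulr0 scale0r.
split.
- by apply: wtD; [apply: (top_down hp HM)|rewrite vE; apply: wtZ] => //; apply: ltnW.
- by rewrite lfunD Eu add0r vE lfunZ Ex scaler0.
- rewrite lfun_iterD -iterD subnK ?(ltnW sp) // (opF_p HM) add0r vE lfun_iterZ.
  by rewrite Fx N0 scaler0.
Qed.

Lemma half_hom (T : {vspace M}) : (T <= wsp M (topw a s))%VS ->
  exists n m (A B : 'M[R[i]]_(n, m)) (f : 'Hom(modI p a s A B, M)),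
  [/\ is_hom f, lker f == 0%VS,
      forall v, v \in limg f -> wt (topw a s) v -> v \in T,
      forall v, v \in limg f -> wt (topw (- a) (p - s)) v -> v \in arrows &
      (T <= limg f)%VS /\ (arrows <= limg f)%VS].
Proof.
move=> Tt; have Ttop v : v \in T -> wt (topw a s) v by move=> vT; apply/wspP; apply: (subvP Tt).
have [||||||n [m [A [B [f [fh fi _ fT [fS TI SI]]]]]]] :=
    @family_hom M a s HM aa s0 (ltnW sp) N0 T arrows Ttop.
- by move=> v /arrows_bot [].
- by move=> v /Ttop /arrows_F.
- move=> v /Ttop kv.
  have [c c0 /= [kx Ex Fx _]] := topE_source_iter hp HM HN aa s0 sp erefl kv.
  by exists (c *: iter (p - s) E v) => //; apply: rpredZ; apply: arrows_E.
- by move=> v /arrows_bot [].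
- by move=> v /arrows_bot [].
- by rewrite sp.
exists n, m, A, B, f; split => // v vI kv; exact: fS.
Qed.
End Arrows.

(* Taking as tops of one sign a complement of what the maps F^s and E^(p-s) reach from the
   tops of the other sign, the two generated submodules are complementary. *)
Lemma square_zero_indecomposable (M : rep R) a s : is_module p M -> a * a = 1 ->
  (0 < s)%N -> (s < p)%N -> (forall v : M, nilc p (gam (topw a s)) M v = 0) -> indecomposable M ->
  (exists n m (A B : 'M[R[i]]_(n, m)), isomorphic M (modI p a s A B)) \/
  (exists n m (A B : 'M[R[i]]_(n, m)), isomorphic M (modI p (- a) (p - s) A B)).
Proof.
move=> HM aa s0 sp N0 Mi; have aN := signN aa.
have ps0 : (0 < p - s)%N by lia.
have ps : (p - s < p)%N by lia.
have N0' (v : M) : nilc p (gam (topw (- a) (p - s))) M v = 0.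
  by rewrite (gam_flip hp aa (ltnW sp)).
have fK := topw_flipK a (ltnW sp).
pose S1 := arrows M a s; pose S2 := arrows M (- a) (p - s).
pose T1 := (wsp M (topw a s) :\: S2)%VS; pose T2 := (wsp M (topw (- a) (p - s)) :\: S1)%VS.
have [n1 [m1 [A1 [B1 [f1 [fh1 fi1 fT1 fS1 [TI1 SI1]]]]]]] :=
  half_hom HM aa s0 sp N0 (diffvSl _ _ : (T1 <= wsp M (topw a s))%VS).
have [n2 [m2 [A2 [B2 [f2 [fh2 fi2 fT2 fS2 [TI2 SI2]]]]]]] :=
  half_hom HM aN ps0 ps N0' (diffvSl _ _ : (T2 <= wsp M (topw (- a) (p - s)))%VS).
rewrite fK in fS2.
have S1w : (S1 <= wsp M (topw (- a) (p - s)))%VS.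
  by apply/subvP => v /(arrows_bot HM aa s0 sp N0) [] /wspP.
have S2w : (S2 <= wsp M (topw a s))%VS.
  by apply/subvP => v /(arrows_bot HM aN ps0 ps N0') []; rewrite fK => /wspP.
have HN v : nilc p (gam (topw a s)) M (nilc p (gam (topw a s)) M v) = 0 by rewrite N0.
have U12 : (limg f1 + limg f2)%VS = fullv.
  have sU := add_submodule (limg_submodule fh1) (limg_submodule fh2).
  apply: (block_gen hp HM HN aa (ltnW sp) erefl sU) => v /wspP kv.
    have : v \in (T1 + S2)%VS by rewrite addv_diff (addv_idPl S2w).
    by apply: subvP; apply: addvS.
  have : v \in (T2 + S1)%VS by rewrite addv_diff (addv_idPl S1w).
  by rewrite addvC; apply: subvP; apply: addvS.
(* A critical weight vector in both images lies in [T1] and [S2], or in [T2] and [S1], and these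
   pairs meet in 0 by the choice of complements. *)
have I12 : (limg f1 :&: limg f2)%VS = 0%VS.
  apply/eqP; apply: contraT => I0.
  have sI := cap_submodule (limg_submodule fh1) (limg_submodule fh2).
  have [v [vI v0 _ [kv|kv]]] := block_sub_meet hp HM HN aa (ltnW sp) erefl sI I0;
    case/negP: v0; rewrite -memv0; move: vI; rewrite memv_cap => /andP [v1 v2].
  - by rewrite -(capv_diff (wsp M (topw a s)) S2) memv_cap fT1 ?fS2.
  - by rewrite -(capv_diff (wsp M (topw (- a) (p - s))) S1) memv_cap fT2 ?fS1.
case: Mi => _ /(_ _ _ (limg_submodule fh1) (limg_submodule fh2) U12 I12) [I0|I0]; [right|left].
- exists n2, m2, A2, B2; apply: isomorphic_sym; apply: (isomorphicI fh2 fi2).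
  by rewrite -U12 I0 add0v.
- exists n1, m1, A1, B1; apply: isomorphic_sym; apply: (isomorphicI fh1 fi1).
  by rewrite -U12 I0 addv0.
Qed.

End SquareZeroBlock.

(** * Simple modules and the classification *)

Section Simple.
Variables (R : realType) (p : nat).
Hypothesis hp : (1 < p)%N.
Local Notation q := (qroot R p).
Local Notation gam := (@gam R p).
Local Notation topw := (@topw R p).

Lemma surj_isomorphic (M N : rep R) (f : 'Hom(M, N)) : is_hom f -> limg f = fullv ->
  dim M = dim N -> isomorphic M N.
Proof.
move=> fh f1 dMN; apply: (isomorphicI fh) => //.
have := limg_ker_dim f fullv; rewrite capfv f1 !dimvf dMN -dimv_eq0 => /eqP.
by rewrite -{2}[dim N]add0n eqn_add2r.
Qed.

Lemma dim_dl (I : finType) : dim {ffun I -> R[i]^o} = #|I|.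
Proof. by rewrite -[LHS]/(#|I| * 1)%N muln1. Qed.

Variables (a : R[i]) (s : nat).
Hypothesis aa : a * a = 1.
Hypothesis s0 : (0 < s)%N.
Hypothesis sp : (s <= p)%N.

Lemma X_wt k : wt (q ^- (2 * k) * topw a s) (@vX R p a s k).
Proof.
have Kd (k' : 'I_s) : (a * q ^ (s%:Z - 1 - 2 * (k' : nat)%:Z)) *: @vX R p a s k' =
    (q ^- (2 * k') * topw a s) *: dl R k' by rewrite topw_exp // /vX bvec_ord.
by apply: (wt_bvec _ _ Kd) => j /= ->.
Qed.

Lemma X_span (N : rep R) (f : 'Hom(N, modX p a s)) : (forall k, vX p a s k \in limg f) -> limg f = fullv.
Proof.
move=> fX; apply/vspaceP => v; rewrite memvf [v]dl_decomp; apply: rpred_sum => k _; apply: rpredZ.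
by have := fX k; rewrite /vX bvec_ord.
Qed.

Lemma X_top : isomorphic (modI p a s (0 : 'M_(0, 1)) 0) (modX p a s).
Proof.
pose va (j : 'I_1) l : modX p a s := vX p a s l; pose vx (i : 'I_0) (k : nat) : modX p a s := 0.
have H : is_modI p a s (0 : 'M_(0, 1)) 0 va vx.
  split; rewrite ?/va ?/vx /=.
  - by move=> j l sl; apply: bvec_out.
  - by move=> i; have := ltn_ord i.
  - by move=> j l; apply: X_wt.
  - by move=> i; have := ltn_ord i.
  - by move=> j l; rewrite X_E.
  - by move=> j; rewrite big_ord0 (X_E hp) (cf0 hp) scale0r.
  - by move=> i; have := ltn_ord i.
  - by move=> j l ls; rewrite X_F.
  - by move=> j; rewrite big_ord0 X_F prednK //; apply: bvec_out.
  - by move=> i; have := ltn_ord i.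
apply: (surj_isomorphic (homI_is_hom hp H)).
  apply: X_span => k; rewrite -[vX p a s k]/(va ord0 k) -(homI_a H ord0 k).
  by rewrite memv_img ?memvf.
by rewrite !dim_dl card_sum !card_prod !card_ord mul1n mul0n addn0.
Qed.

Local Notation MI := (modI p a s (0 : 'M[R[i]]_(0, 1)) 0).

(** A nonzero submodule contains a critical weight vector; with empty socle it is a multiple of a_0,
    which generates. *)
Lemma simpleI_irreducible : irreducible MI.
Proof.
have inda := @I_indep_a R p a s s0 0 1 0 0.
split.
  apply/eqP => M0; have /eqP : (1 : R[i]) = 0; last by rewrite oner_eq0.
  by apply: (inda (fun=> 1) _ ord0); apply/eqP; rewrite -memv0 -M0 memvf.
move=> U sU; case: (eqVneq U 0%VS) => [->|U0]; [by left|right].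
have [|v [vU v0 _ /(top_cases hp sp) kv]] := block_sub_meet hp (I_module hp aa s0 sp 0 0) _ aa sp erefl sU U0.
  by move=> v; rewrite !(I_nilc hp aa s0 sp).
have [x vE] : exists x : R[i], v = x *: vIa p a s 0 0 ord0 0%N.
  case: kv => [kv|[sp' kv]].
    by have [|x ->] := I_top hp aa s0 sp _ kv; rewrite ?orbT // big_ord1; exists (x ord0).
  by have [x vE] := I_bot hp aa s0 sp sp' kv; case/eqP: v0; rewrite vE big_ord0.
have x0 : x != 0 by apply: contra v0 => /eqP x0; rewrite vE x0 scale0r.
apply: (I_full hp s0 sp sU) => [j|[]//]; rewrite (ord1 j).
by rewrite -[vIa _ _ _ _ _ _ _]scale1r -(mulVf x0) -scalerA -vE rpredZ.
Qed.

Lemma X_irreducible : irreducible (modX p a s).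
Proof. exact: isomorphic_irr X_top simpleI_irreducible. Qed.

Lemma X_nilc (v : modX p a s) : nilc p (gam (topw a s)) (modX p a s) v = 0.
Proof.
have [f [fh _ f1]] := isomorphicE X_top.
have : v \in limg f by rewrite f1 memvf.
case/memv_imgP => w _ ->; rewrite -(hom_nilc hp fh (I_module hp aa s0 sp 0 0) (X_module hp aa s0 sp)).
by rewrite (I_nilc hp aa s0 sp) lfun0.
Qed.

Lemma X_sblock : sblock p a s (modX p a s).
Proof. by split; [exact: X_module|move=> v; rewrite X_nilc]. Qed.

Lemma I_lin_ext n m (A B : 'M[R[i]]_(n, m)) (V : vectType R[i]) (f g : 'Hom(modI p a s A B, V)) :
  (forall j l, f (vIa p a s A B j l) = g (vIa p a s A B j l)) ->
  (forall i k, f (vIx p a s A B i k) = g (vIx p a s A B i k)) -> f = g.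
Proof.
move=> fa fx; apply: dl_ext => -[[j l]|[i k]].
  by have := fa j l; rewrite /vIa bvec_ord.
by have := fx i k; rewrite /vIx bvec_ord.
Qed.

Lemma modI0_dsum m (A B : 'M[R[i]]_(0, m)) : is_dsum (fun _ : 'I_m => MI) (modI p a s A B).
Proof.
have flat k (X Y : 'M[R[i]]_(0, k)) : X = Y by rewrite (flatmx0 X) (flatmx0 Y).
have /choice [inj injP] (i : 'I_m) : exists f : 'Hom(MI, modI p a s A B),
    is_hom f /\ forall j l, f (vIa p a s 0 0 j l) = vIa p a s A B i l.
  have [f [fh fa _]] := @I_map R p hp a s s0 0 1 0 m 0 0 A B (delta_mx i 0) 0 (flat _ _ _) (flat _ _ _).
  exists f; split=> // j l; rewrite fa (bigD1 i) //= big1 => [|k ki].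
    by rewrite mxE !ord1 !eqxx scale1r addr0.
  by rewrite mxE (negPf ki) scale0r.
have /choice [prj prjP] (i : 'I_m) : exists f : 'Hom(modI p a s A B, MI),
    is_hom f /\ forall j l, f (vIa p a s A B j l) = (j == i)%:R *: vIa p a s 0 0 ord0 l.
  have [f [fh fa _]] := @I_map R p hp a s s0 0 m 0 1 A B 0 0 (delta_mx 0 i) 0 (flat _ _ _) (flat _ _ _).
  by exists f; split=> // j l; rewrite fa big_ord1 mxE ord1 eqxx.
exists inj, prj; split.
- by split=> i; [case: (injP i)|case: (prjP i)].
- move=> i; apply: I_lin_ext => [j l|[]//].
  by rewrite comp_lfunE id_lfunE (injP i).2 (prjP i).2 eqxx scale1r (ord1 j).
- move=> i k ik; apply: I_lin_ext => [j l|[]//].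
  by rewrite comp_lfunE zero_lfunE (injP i).2 (prjP k).2 (negPf ik) scale0r.
- apply: I_lin_ext => [j l|[]//].
  rewrite sum_lfunE id_lfunE (bigD1 j) //= big1 => [|i ij].
    by rewrite comp_lfunE (prjP j).2 eqxx scale1r (injP j).2 addr0.
  by rewrite comp_lfunE (prjP i).2 eq_sym (negPf ij) scale0r lfun0.
Qed.
End Simple.

(** * The two semisimple blocks *)

Section EndBlocks.
Variables (R : realType) (p : nat).
Hypothesis hp : (1 < p)%N.
Local Notation gam := (@gam R p).
Local Notation topw := (@topw R p).

Lemma dsum_iso (I : finType) (N : I -> rep R) (M M' : rep R) :
  isomorphic M M' -> is_dsum N M -> is_dsum N M'.
Proof.
case=> f [g [fh gh gf fg]] [inj [prj [[ih ph] pi pj s1]]].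
exists (fun i => f \o inj i)%VF, (fun i => prj i \o g)%VF; split.
- by split=> i; apply: hom_comp.
- by move=> i; rewrite comp_lfunA -[(_ \o g \o f)%VF]comp_lfunA gf comp_lfun1r pi.
- by move=> i j ij; rewrite comp_lfunA -[(_ \o g \o f)%VF]comp_lfunA gf comp_lfun1r pj.
- apply/lfunP => v; rewrite sum_lfunE id_lfunE.
  have := congr1 (fun e : 'End(M) => f (e (g v))) s1.
  rewrite id_lfunE sum_lfunE lfun_sum -[f (g v)]comp_lfunE fg id_lfunE => {2}<-.
  by apply: eq_bigr => i _; rewrite !comp_lfunE.
Qed.

Lemma irreducible_dsum (I : finType) (N : I -> rep R) (M : rep R) : irreducible M ->
  (forall i, irreducible (N i)) -> is_dsum N M -> exists i, isomorphic (N i) M.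
Proof.
move=> [M0 Mi] Ni [inj [prj [[ih ph] pi pj s1]]].
have [i _|I0] := pickP (fun _ : I => true); last first.
  case/eqP: M0; apply: vspace0P => v _; rewrite -[v]id_lfunE -s1 big_pred0 // zero_lfunE //.
exists i.
have piE v : prj i (inj i v) = v by rewrite -comp_lfunE pi id_lfunE.
have inj0 : lker (inj i) == 0%VS by apply/lker0P; apply: can_inj piE.
apply: (isomorphicI (ih i) inj0); have [I0|//] := Mi _ (limg_submodule (ih i)).
have [/eqP[]] := Ni i; apply: vspace0P => v _; rewrite -(piE v).
have : inj i v \in limg (inj i) by rewrite memv_img ?memvf.
by rewrite I0 memv0 => /eqP ->; rewrite lfun0.
Qed.

Variable a : R[i].
Hypothesis aa : a * a = 1.
Let p0 : (0 < p)%N := ltnW hp.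

(** Here p - s = 0, so [top_E_out] says that E kills every vector of top weight, and F^p = 0. The
    whole weight space serves as space of tops, with zero socle. *)
Lemma end_block_I (M : rep R) : is_module p M ->
  (forall v : M, nilc p (gam (topw a p)) M v = 0) ->
  exists m (A B : 'M[R[i]]_(0, m)), isomorphic (modI p a p A B) M.
Proof.
move=> HM N0.
have HN (v : M) : nilc p (gam (topw a p)) M (nilc p (gam (topw a p)) M v) = 0 by rewrite N0.
have Tt v : v \in wsp M (topw a p) -> wt (topw a p) v by move/wspP.
have [||||||n [m [A [B [f [fh fi n0 _ [_ TI _]]]]]]] :=
    @family_hom R p hp M a p HM aa p0 (leqnn p) N0 (wsp M (topw a p)) 0%VS Tt.
- by move=> v; rewrite memv0 => /eqP ->; apply: wt0.
- by move=> v _; rewrite (opF_p HM) mem0v.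
- move=> v /Tt kv; exists 0; rewrite ?mem0v // lfun_iter0.
  by have := top_E_out hp HM HN aa (leqnn p) erefl p0 kv; rewrite subnn.
- by move=> v; rewrite memv0 => /eqP ->; rewrite lfun0.
- by move=> v; rewrite memv0 => /eqP ->; rewrite lfun_iter0.
- by rewrite eqxx orbT.
have {}n0 := n0 erefl; rewrite n0 in A B f fh fi TI *; exists m, A, B.
apply: (isomorphicI fh fi).
apply: (block_gen hp HM HN aa (leqnn p) erefl (limg_submodule fh)) => v kv;
  apply: (subvP TI); apply/wspP => //.
have [//|[]] := top_cases hp (leqnn p) (or_intror kv).
by rewrite ltnn.
Qed.

Lemma end_block (C : rep R -> Prop) :
  (forall M, C M <-> is_module p M /\ forall v : M, nilc p (gam (topw a p)) M v = 0) ->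
  [/\ semisimple C, C (modX p a p), irreducible (modX p a p)
     & forall M, C M -> irreducible M -> isomorphic M (modX p a p)].
Proof.
move=> CE; have Xi := X_irreducible hp aa p0 (leqnn p); split => //.
- move=> M /CE [HM N0]; have [m [A [B iso]]] := end_block_I HM N0.
  exists m, (fun=> modI p a p (0 : 'M_(0, 1)) 0); split=> [i|].
    split; last exact: simpleI_irreducible.
    by apply/CE; split; [apply: I_module|apply: I_nilc].
  exact: dsum_iso iso (modI0_dsum _ _ _ _ _).
- by apply/CE; split; [apply: X_module|apply: X_nilc].
- move=> M /CE [HM N0] Mi; have [m [A [B iso]]] := end_block_I HM N0.
  have [i iso'] := irreducible_dsum Mi (fun=> simpleI_irreducible hp aa p0 (leqnn p))
     (dsum_iso iso (modI0_dsum hp _ p0 _ _)).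
  exact: isomorphic_trans (isomorphic_sym iso') (X_top hp a p0).
Qed.
End EndBlocks.

(** * The blocks with two simple modules *)

Section MiddleBlock.
Variables (R : realType) (p : nat).
Hypothesis hp : (1 < p)%N.
Local Notation gam := (@gam R p).
Local Notation topw := (@topw R p).

Section OneSign.
Variables (a : R[i]) (s : nat).
Hypothesis aa : a * a = 1.
Hypothesis s0 : (0 < s)%N.
Hypothesis sp : (s < p)%N.
Let sp' := ltnW sp.
Let ps0 : (0 < p - s)%N.
Proof. by rewrite subn_gt0. Qed.

Lemma X_bot : isomorphic (modI p a s (0 : 'M_(1, 0)) 0) (modX p (- a) (p - s)).
Proof.
pose va (j : 'I_0) (l : nat) : modX p (- a) (p - s) := 0.
pose vx (i : 'I_1) k := vX p (- a) (p - s) k.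
have H : is_modI p a s (0 : 'M_(1, 0)) 0 va vx.
  split; rewrite ?/va ?/vx /=; try by move=> j; have := ltn_ord j.
  - by move=> i k sk; apply: bvec_out.
  - by move=> i k; apply: (X_wt hp (- a) (p - s)).
  - by move=> i k; rewrite (X_E hp).
  - by move=> i k; rewrite X_F.
apply: (surj_isomorphic (homI_is_hom hp H)).
  apply: X_span => k; rewrite -[vX _ _ _ k]/(vx ord0 k) -(homI_x H ord0 k).
  by rewrite memv_img ?memvf.
by rewrite !dim_dl card_sum !card_prod !card_ord mul1n mul0n add0n.
Qed.

(** Homomorphisms preserve weights, and the module with empty top has no nonzero vector of weight
    [topw a s]. *)
Lemma X_not_isomorphic : ~ isomorphic (modX p a s) (modX p (- a) (p - s)).
Proof.
move=> /(isomorphic_trans (X_top hp a s0)) /isomorphic_trans /(_ (isomorphic_sym X_bot)).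
move=> /isomorphicE [f [fh fi _]].
have va0 : f (vIa p a s 0 0 ord0 0%N) = f 0.
  have kv := hom_wt fh (modI_top (modI_modI hp a s0 (0 : 'M_(0, 1)) 0) ord0).
  have [|x ->] := I_top hp aa s0 sp' _ kv; rewrite ?sp //.
  by rewrite big_ord0 lfun0.
have /eqP : (1 : R[i]) = 0; last by rewrite oner_eq0.
by apply: (@I_indep_a R p a s s0 0 1 0 0 (fun=> 1) _ ord0); rewrite big_ord1 (fi _ _ va0) scaler0.
Qed.

Lemma modM_pencil n : modM p a s n = modI p a s (pencilWA R[i] n)^T (pencilWB R[i] n)^T.
Proof.
have EA : \matrix_(i < n, j < n.-1) (i == j :> nat)%:R = (pencilWA R[i] n)^T.
  by apply/matrixP => i j; rewrite !mxE eq_sym.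
have EB : \matrix_(i < n, j < n.-1) (i == j.+1 :> nat)%:R = (pencilWB R[i] n)^T.
  by apply/matrixP => i j; rewrite !mxE eq_sym.
exact: (congr2 (@modI R p a s n n.-1) EA EB).
Qed.

(** The smallest singular pencils, of sizes 0 by 1 and 1 by 0, give the two simple modules; this is
    why the W and M series start at 2. The infinite eigenvalue is the point 0 : 1. *)
Lemma modI_listed n m (A B : 'M[R[i]]_(n, m)) : indecomposable (modI p a s A B) ->
  [\/ isomorphic (modI p a s A B) (modX p a s),
      isomorphic (modI p a s A B) (modX p (- a) (p - s)) |
      exists2 N, indec_list p a s N & isomorphic (modI p a s A B) N].
Proof.
move=> Mi; have nm : (0 < n + m)%N.
  rewrite lt0n; apply: contraL isT; rewrite addn_eq0 => /andP [/eqP n0 /eqP m0].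
  case: Mi => /eqP M0 _; case: M0; apply: esym; apply: (I_full hp s0 sp').
  - by apply: submoduleI => v; rewrite !memv0 => /eqP ->; rewrite lfun0.
  - by move=> j; have := ltn_ord j; rewrite {2}m0.
  - by move=> j; have := ltn_ord j; rewrite {2}n0.
have := pencil_classification (modI_indec_pencil hp s0 sp' sp Mi) nm.
have iso n' m' (A' B' : 'M[R[i]]_(n', m')) := @pencil_iso_modI R p hp a s s0 sp' n m n' m' A B A' B'.
case=> -[r r0].
- move/iso => AB; case: r r0 AB => [//|[|r]] _ AB; last first.
    by apply: Or33; exists (modW p a s r.+2) => //; apply: IndecW.
  apply: Or31; apply: isomorphic_trans (X_top hp a s0).
  by move: AB; rewrite [pencilWA _ 1]flatmx0 [pencilWB _ 1]flatmx0.
- move/iso => AB; case: r r0 AB => [//|[|r]] _ AB.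
    apply: Or32; apply: isomorphic_trans X_bot.
    by move: AB; rewrite [(pencilWA _ 1)^T]thinmx0 [(pencilWB _ 1)^T]thinmx0.
  apply: Or33; exists (modM p a s r.+2); first exact: IndecM.
  by rewrite modM_pencil.
- case=> z /iso AB; apply: Or33; exists (modO p a s r 1 z).
    by apply: IndecO => //; rewrite xpair_eqE oner_eq0.
  by rewrite /modO oner_eq0 divr1.
- move=> /iso AB; apply: Or33; exists (modO p a s r 0 1).
    by apply: IndecO => //; rewrite xpair_eqE oner_eq0 andbF.
  by rewrite /modO eqxx.
Qed.

Lemma listed_indecomposable M : indec_list p a s M -> sblock p a s M /\ nonirr_indecomposable M.
Proof.
have key n m (A B : 'M[R[i]]_(n, m)) : (0 < n)%N -> (0 < m)%N -> pencil_indec A B ->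
    sblock p a s (modI p a s A B) /\ nonirr_indecomposable (modI p a s A B).
  move=> n0 m0 AB; split; first exact: I_sblock.
  split; last exact: modI_reducible.
  by apply: pencil_indec_modI; rewrite ?ltn_addr.
case=> [|n n2|n n2|n z1 z2 n1 _].
- by split; [exact: P_sblock|exact: P_indecomposable].
- by apply: key; rewrite ?(ltnW n2) ?ltn_predRL //; apply: pencilW_indec; rewrite ltnW.
- have n0 := ltnW n2; rewrite modM_pencil.
  by apply: key; rewrite ?ltn_predRL //; apply: pencilW_tr_indec.
- rewrite /modO; case: ifP => _; apply: key => //; [exact: pencilJ1_indec|exact: pencil1J_indec].
Qed.
End OneSign.

Variables (a : R[i]) (s : nat).
Hypothesis aa : a * a = 1.
Hypothesis s0 : (0 < s)%N.
Hypothesis sp : (s < p)%N.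

Lemma block_indecomposable M : sblock p a s M -> indecomposable M ->
  [\/ isomorphic M (modX p a s), isomorphic M (modX p (- a) (p - s)) |
      exists N, (indec_list p a s N \/ indec_list p (- a) (p - s) N) /\ isomorphic M N].
Proof.
move=> Ms Mi; have [HM HN] := Ms; have aN := signN aa.
have ps0 : (0 < p - s)%N by rewrite subn_gt0.
have ps : (p - s < p)%N by rewrite ltn_subrL s0 (leq_trans s0 (ltnW sp)).
have Ms' : sblock p (- a) (p - s) M := (sblock_flip hp M aa (ltnW sp)).1 Ms.
have gf := gam_flip hp aa (ltnW sp).
have [[v [kv Nv]]|N1] := pselect (exists v : M,
    wt (topw a s) v /\ nilc p (gam (topw a s)) M v != 0).
  apply: Or33; exists (modP p a s); split; first by left; apply: IndecP.
  exact: indecomposable_P kv Nv.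
have [[v [kv Nv]]|N2] := pselect (exists v : M,
    wt (topw (- a) (p - s)) v /\ nilc p (gam (topw a s)) M v != 0).
  apply: Or33; exists (modP p (- a) (p - s)); split; first by right; apply: IndecP.
  by apply: (indecomposable_P hp aN ps0 ps Ms' Mi kv); rewrite gf.
(* The kernel of N is a submodule that contains both critical weight spaces, hence is everything. *)
have N0 (v : M) : nilc p (gam (topw a s)) M v = 0.
  apply/eqP; rewrite -memv_ker.
  rewrite (block_gen hp HM HN aa (ltnW sp) erefl (U := lker _)) ?memvf //.
  - by apply: lker_submodule; apply: nilc_hom.
  - by move=> w kw; rewrite memv_ker; apply: contraT => Nw; case: N1; exists w.
  - by move=> w kw; rewrite memv_ker; apply: contraT => Nw; case: N2; exists w.
have [[n [m [A [B iso]]]]|[n [m [A [B iso]]]]] := square_zero_indecomposable hp HM aa s0 sp N0 Mi.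
  have [X|X|[N LN X]] := modI_listed s0 sp (isomorphic_indec iso Mi).
  - by apply: Or31; apply: isomorphic_trans iso X.
  - by apply: Or32; apply: isomorphic_trans iso X.
  - by apply: Or33; exists N; split; [left|apply: isomorphic_trans iso X].
have := modI_listed ps0 ps (isomorphic_indec iso Mi).
rewrite opprK subKn ?(ltnW sp) // => -[X|X|[N LN X]].
- by apply: Or32; apply: isomorphic_trans iso X.
- by apply: Or31; apply: isomorphic_trans iso X.
- by apply: Or33; exists N; split; [right|apply: isomorphic_trans iso X].
Qed.
End MiddleBlock.

Theorem theorem1p7 (R : realType) (p : nat) (hp : (2 <= p)%N) :
  exists C : 'I_p.+1 -> rep R -> Prop,
    is_decomposition p C /\
    [/\ semisimple (C ord0),
        C ord0 (modX p 1 p),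
        irreducible (modX p (1 : R[i]) p)
      & forall M, C ord0 M -> irreducible M -> isomorphic M (modX p 1 p)] /\
    [/\ semisimple (C ord_max),
        C ord_max (modX p (-1) p),
        irreducible (modX p (-1 : R[i]) p)
      & forall M, C ord_max M -> irreducible M ->
          isomorphic M (modX p (-1) p)] /\
    forall s : 'I_p.+1, (1 <= s)%N -> (s <= p - 1)%N ->
      [/\ C s (modX p 1 s) /\ irreducible (modX p (1 : R[i]) s),
          C s (modX p (-1) (p - s)) /\
            irreducible (modX p (-1 : R[i]) (p - s)),
          ~ isomorphic (modX p (1 : R[i]) s) (modX p (-1) (p - s))
        & forall M, C s M -> irreducible M ->
            isomorphic M (modX p 1 s) \/ isomorphic M (modX p (-1) (p - s))] /\
      [/\ projective p (modP p (1 : R[i]) s),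
          projective p (modP p (-1 : R[i]) (p - s)),
          forall M, indec_list p 1 s M \/ indec_list p (-1) (p - s) M ->
            C s M /\ nonirr_indecomposable M
        & forall M, C s M -> nonirr_indecomposable M ->
            exists N, (indec_list p 1 s N \/ indec_list p (-1) (p - s) N) /\
                      isomorphic M N].
Proof.
have one1 : 1 * 1 = 1 :> R[i] by rewrite mulr1.
have oneN := signN one1.
exists (@in_block R p); split; first exact: block_decomposition.
split; first by apply: end_block => // M; apply: in_block0.
split; first by apply: end_block => // M; apply: in_block_max.
move=> s s0 sp1; have sp : (s < p)%N by lia.
have ps0 : (0 < p - s)%N by lia.
have ps : (p - s < p)%N by lia.
have Cs (M : rep R) : in_block s M <-> sblock p 1 s M by apply: in_block_mid; rewrite // s0 sp.
have flip (M : rep R) : sblock p (- 1) (p - s) M -> in_block s M.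
  by move=> SM; apply: (Cs M).2; apply: (sblock_flip hp M one1 (ltnW sp)).2 SM.
have listed (M : rep R) : indec_list p 1 s M \/ indec_list p (- 1) (p - s) M ->
    in_block s M /\ nonirr_indecomposable M.
  case=> [/(listed_indecomposable hp one1 s0 sp)|/(listed_indecomposable hp oneN ps0 ps)] [SM iM].
    by split => //; apply/Cs.
  by split => //; apply: flip.
have X1 := X_irreducible hp one1 s0 (ltnW sp).
have X2 := X_irreducible hp oneN ps0 (ltnW ps).
split.
  split.
  - by split => //; apply/Cs; apply: X_sblock => //; apply: ltnW.
  - by split => //; apply: flip; apply: X_sblock => //; apply: ltnW.
  - exact: X_not_isomorphic.
  - move=> M /Cs SM iM.
    have [iso|iso|[N [LN iso]]] := block_indecomposable hp one1 s0 sp SM (irr_indec iM); [by left|by right|].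
    by have [_ [_ []]] := listed N LN; apply: isomorphic_irr iso iM.
split => //.
- exact: P_projective.
- exact: P_projective.
- move=> M /Cs SM [indM irrM].
  have [iso|iso|//] := block_indecomposable hp one1 s0 sp SM indM; case: irrM.
    exact: isomorphic_irr (isomorphic_sym iso) X1.
  exact: isomorphic_irr (isomorphic_sym iso) X2.
Qed.
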